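(* Let $\mathfrak X$ be a complex vector space, let $\mathfrak Y$ be an ordered Banach bimodule over a *-algebra $\mathfrak Y_0$, with positive cone $\mathfrak K$, and let $\Phi:\mathfrak X\times\mathfrak X\to\mathfrak Y$ be a positive sesquilinear map. Let $\Omega,\Upsilon$ be locally compact Hausdorff spaces, $\mathfrak M$ a von Neumann algebra and $\rho$ a faithful semifinite trace on $\mathfrak M$. Then the Cauchy-Schwarz inequality $$\|\Phi(x_1,x_2)\|_{\mathfrak Y}\le \|\Phi(x_1,x_1)\|_{\mathfrak Y}^{1/2}\,\|\Phi(x_2,x_2)\|_{\mathfrak Y}^{1/2},\qquad \forall x_1,x_2\in\mathfrak X,$$ holds in each one of the following cases: (1) $\mathfrak Y=L^2(\Omega)$; (2) $\mathfrak Y=\mathcal B(\mathfrak M,\mathcal B_1(\mathcal H))$, $\mathfrak Y_0=\mathfrak M$; (3) $\mathfrak Y=\mathfrak M^*$, the dual of $\mathfrak M$; (4) $\mathfrak Y=M(\Omega)$ and $\mathfrak Y_0=C(\Omega)$; (5) $\mathfrak Y=\mathcal B(\mathfrak M,M(\Omega))$, $\mathfrak Y_0=\mathfrak M$; (6) $\mathfrak Y=\mathcal B(C(\Omega),C(\Upsilon))$, or $\mathfrak Y=\mathcal B(\mathfrak M,C(\Omega))$; (7) $\mathfrak Y=L^1(\rho)$ or $\mathfrak Y=L^1(\Omega)$; (8) $\mathfrak Y=\mathcal B(\mathfrak M,\widetilde{\mathfrak M}^* )$ and $\mathfrak Y_0=\mathfrak M$, with $\widetilde{\mathfrak M}$ another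 von Neumann algebra; (9) $\mathfrak Y=\mathfrak Y_0=\ell_2(C(\Omega))$ (here with $\Omega$ compact).
   Context: An ordered Banach bimodule $\mathfrak Y$ over a *-algebra $\mathfrak Y_0$ is a Banach bimodule over $\mathfrak Y_0$ containing a closed cone $\mathfrak K$ (that is, $\mathfrak K+\mathfrak K\subset\mathfrak K$, $\lambda\mathfrak K\subset\mathfrak K$ for $\lambda\ge0$, $\mathfrak K\cap(-\mathfrak K)=\{0\}$) such that $z^*\mathfrak K z\subset\mathfrak K$ for all $z\in\mathfrak Y_0$; its norm is $\|\cdot\|_{\mathfrak Y}$. The *-algebra $\mathfrak Y_0$ carries a (not necessarily submultiplicative) norm. A map $\Phi:\mathfrak X\times\mathfrak X\to\mathfrak Y$ is positive sesquilinear if it is linear in the first variable, conjugate-linear in the second, and $\Phi(x,x)\in\mathfrak K$ for all $x\in\mathfrak X$. In the listed cases each $\mathfrak Y$ carries its usual norm and its natural positive cone. $L^p(\Omega)=L^p(\Omega,\mu)$ for a positive measure $\mu$ on $\Omega$, with cone the a.e. nonnegative functions. $C(\Omega)$ is the space of continuous functions on $\Omega$, with norm $\|\cdot\|_\infty$ and cone the nonnegative functions. $M(\Omega)$ is the Banach space of all complex Radon measures on $\Omega$ with the total variation norm, with cone the positive measures. $\mathcal B_1(\mathcal H)$ is the space of trace-class operators on a separable Hilbert space $\mathcal H$ with the trace norm, with cone the positive operators. $\mathfrak M^*$ has the dual norm and cone the positive functionals. $L^1(\rho)$ is the noncommutative $L^1$-space of $\rho$, with norm $\rho(|T|)$ and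 cone its positive elements. $\mathcal B(E,F)$ is the space of bounded linear operators from $E$ to $F$ with the operator norm, with cone the operators mapping positive elements to positive elements; when $E$ is a C*-algebra it is a bimodule over $E$ via $(A\cdot c)(d)=A(cd)$, $(c\cdot A)(d)=A(dc)$. $\ell_2(C(\Omega))$ is the space of square-summable sequences $(f_n)_n$ in $C(\Omega)$ (i.e. $\sum_n|f_n|^2$ converges in $C(\Omega)$), with norm $\|\sum_n|f_n|^2\|_\infty^{1/2}$ and cone the sequences whose entries are all nonnegative functions. *)

(* Defs.v *)
From HB Require Import structures.
From mathcomp Require Import all_boot all_order all_algebra.
From mathcomp Require Import complex.
From mathcomp Require Import all_classical all_reals all_analysis.

Set Implicit Arguments.
Unset Strict Implicit.
Unset Printing Implicit Defensive.

Import Order.TTheory GRing.Theory Num.Theory numFieldNormedType.Exports.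

Local Open Scope complex_scope.
Local Open Scope classical_set_scope.
Local Open Scope ring_scope.

(* R[i] itself carries no topology in the library; its regular module R[i]^o
   does.

   A concrete Banach space (L^p, M(Omega), B(E, F), etc) is not built as a
   type. A normed module V "is" the concrete space when a map J, sending the
   elements of V to the functions, measures or operators they stand for, is a
   linear isometry onto the concrete space: the predicates is_Lp,
   is_radon_measures, etc. The matching cones are Lp_cone, radon_cone, etc. *)

(* Norms of complex spaces are R[i]-valued in the library. *)
Definition rnorm (R : realType) (V : normedZmodType R[i]) (v : V) : R :=
  complex.Re `|v|.

(* No unit (l_2(C(Omega)) has none) and no compatibility between the norm and
   the product or the involution. *)
Record starAlgebra (R : realType) := StarAlgebra {
  star_sort :> normedModType R[i];
  smul : star_sort -> star_sort -> star_sort;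
  star : star_sort -> star_sort;
  smulA : forall x y z, smul x (smul y z) = smul (smul x y) z;
  smul_linearl : forall y a x x',
    smul (a *: x + x') y = a *: smul x y + smul x' y;
  smul_linearr : forall x a y y',
    smul x (a *: y + y') = a *: smul x y + smul x y';
  starK : forall x, star (star x) = x;
  star_mul : forall x y, star (smul x y) = smul (star y) (star x);
  star_antilinear : forall a x y,
    star (a *: x + y) = a^* *: star x + star y }.

Record orderedBanachBimodule (R : realType) (A : starAlgebra R) :=
  OrderedBanachBimodule {
  bimod_sort :> completeNormedModType R[i];
  lact : A -> bimod_sort -> bimod_sort;
  ract : bimod_sort -> A -> bimod_sort;
  lact_linearl : forall y a z w,
    lact (a *: z + w) y = a *: lact z y + lact w y;
  lact_linearr : forall z a y y',
    lact z (a *: y + y') = a *: lact z y + lact z y';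
  ract_linearl : forall z a y y',
    ract (a *: y + y') z = a *: ract y z + ract y' z;
  ract_linearr : forall y a z w,
    ract y (a *: z + w) = a *: ract y z + ract y w;
  lact_mul : forall z w y, lact (smul z w) y = lact z (lact w y);
  ract_mul : forall z w y, ract y (smul z w) = ract (ract y z) w;
  lract : forall z y w, lact z (ract y w) = ract (lact z y) w;
  lact_bounded : exists k : R, forall z y,
    rnorm (lact z y) <= k * rnorm z * rnorm y;
  ract_bounded : exists k : R, forall z y,
    rnorm (ract y z) <= k * rnorm z * rnorm y;
  cone : set bimod_sort;
  cone0 : cone 0;
  cone_closed : closed cone;
  coneD : forall y y', cone y -> cone y' -> cone (y + y');
  coneZ : forall (l : R) y, 0 <= l -> cone y -> cone (l%:C *: y);
  cone_proper : forall y, cone y -> cone (- y) -> y = 0;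
  cone_conj : forall z y, cone y -> cone (ract (lact (star z) y) z) }.
Arguments cone {R A} o.

Definition positive_sesquilinear (R : realType) (X : lmodType R[i])
    (A : starAlgebra R) (Y : orderedBanachBimodule A) (Phi : X -> X -> Y) :=
  [/\ forall x' a x y, Phi (a *: x + y) x' = a *: Phi x x' + Phi y x',
      forall x' a x y, Phi x' (a *: x + y) = a^* *: Phi x' x + Phi x' y
    & forall x, cone Y (Phi x x)].

Definition cauchy_schwarz (R : realType) (X : lmodType R[i])
    (A : starAlgebra R) (Y : orderedBanachBimodule A) :=
  forall Phi : X -> X -> Y, positive_sesquilinear Phi ->
  forall x1 x2 : X,
    rnorm (Phi x1 x2) <=
    Num.sqrt (rnorm (Phi x1 x1)) * Num.sqrt (rnorm (Phi x2 x2)).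

(* Used for L^p: the library's measurable spaces are pointed types. *)
Definition pointed_at (T : choiceType) (t : T) : Type := T.
HB.instance Definition _ (T : choiceType) (t : T) :=
  Choice.copy (pointed_at t) T.
HB.instance Definition _ (T : choiceType) (t : T) :=
  isPointed.Build (pointed_at t) t.

Section Lp.
Context d (T : measurableType d) (R : realType).
Variable mu : {measure set T -> \bar R}.

Definition complex_measurable (f : T -> R[i]) :=
  measurable_fun setT (fun t => complex.Re (f t)) /\
  measurable_fun setT (fun t => complex.Im (f t)).

Definition complex_Lnorm (p : R) (f : T -> R[i]) : \bar R :=
  Lnorm mu p%:E (fun t => (rnorm (f t))%:E).

(* J picks a representative of each class, hence the a.e. equalities. *)
Record is_Lp (p : R) (V : normedModType R[i]) (J : V -> T -> R[i]) : Prop :=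
  IsLp {
  Lp_linear : forall a v w,
    {ae mu, forall t, J (a *: v + w) t = a * J v t + J w t};
  Lp_measurable : forall v, complex_measurable (J v);
  Lp_norm : forall v, (rnorm v)%:E = complex_Lnorm p (J v);
  Lp_onto : forall f, complex_measurable f -> (complex_Lnorm p f < +oo)%E ->
    exists v, {ae mu, forall t, J v t = f t} }.

Definition Lp_cone (V : normedModType R[i]) (J : V -> T -> R[i]) : set V :=
  [set v | {ae mu, forall t, 0 <= J v t}].

End Lp.

Section continuous_functions.
Context (R : realType) (Omega : topologicalType).

(* The functions are bounded, so that the supremum norm is finite. *)
Definition bounded_continuous (f : Omega -> R[i]) :=
  continuous (f : Omega -> R[i]^o) /\
  exists k : R, forall w, rnorm (f w) <= k.

Record is_C (V : normedModType R[i]) (J : V -> Omega -> R[i]) : Prop := IsC {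
  C_linear : forall a v w, J (a *: v + w) = fun t => a * J v t + J w t;
  C_continuous : forall v, bounded_continuous (J v);
  C_norm : forall v, rnorm v = sup [set rnorm (J v t) | t in [set: Omega]];
  C_onto : forall f, bounded_continuous f -> exists v, J v = f }.

Definition C_cone (V : normedModType R[i]) (J : V -> Omega -> R[i]) : set V :=
  [set v | forall t, 0 <= J v t].

(* l_2(C(Omega)): g is the sum of |f_n|^2 in C(Omega). *)
Definition square_sum (f : nat -> Omega -> R[i]) (g : Omega -> R) :=
  [/\ forall n, continuous (f n : Omega -> R[i]^o), continuous g
    & {uniform, (fun n t => \sum_(i < n) rnorm (f i t) ^+ 2) @ \oo --> g}].

Record is_l2C (V : normedModType R[i]) (J : V -> nat -> Omega -> R[i]) :
    Prop := IsL2C {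
  l2C_linear : forall a v w,
    J (a *: v + w) = fun n t => a * J v n t + J w n t;
  l2C_summable : forall v, exists g, square_sum (J v) g;
  l2C_norm : forall v g, square_sum (J v) g ->
    rnorm v = Num.sqrt (sup [set g t | t in [set: Omega]]);
  l2C_onto : forall f g, square_sum f g -> exists v, J v = f }.

Definition l2C_cone (V : normedModType R[i]) (J : V -> nat -> Omega -> R[i]) :
    set V := [set v | forall n t, 0 <= J v n t].

End continuous_functions.

Definition is_C_algebra (R : realType) (Omega : topologicalType)
    (A : starAlgebra R) (J : A -> Omega -> R[i]) :=
  [/\ is_C J, forall f g, J (smul f g) = fun t => J f t * J g t
    & forall f, J (star f) = fun t => (J f t)^*].

Definition is_l2C_algebra (R : realType) (Omega : topologicalType)
    (A : starAlgebra R) (J : A -> nat -> Omega -> R[i]) :=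
  [/\ is_l2C J, forall f g, J (smul f g) = fun n t => J f n t * J g n t
    & forall f, J (star f) = fun n t => (J f n t)^*].

Definition l2C_action (R : realType) (Omega : topologicalType)
    (A : starAlgebra R) (J0 : A -> nat -> Omega -> R[i])
    (Y : orderedBanachBimodule A) (J : Y -> nat -> Omega -> R[i]) :=
  forall z y, J (lact z y) = (fun n t => J0 z n t * J y n t) /\
              J (ract y z) = (fun n t => J y n t * J0 z n t).

Section radon_measures.
Context (R : realType) (Omega : topologicalType).

Definition borel : set (set Omega) := <<s @open Omega >>.

(* The values of nu outside the Borel sets are irrelevant. *)
Definition complex_measure (nu : set Omega -> R[i]) :=
  forall F : nat -> set Omega, (forall n, borel (F n)) -> trivIset setT F ->
  (fun n => \sum_(i < n) nu (F i) : R[i]^o) @ \oo -->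
    (nu (\bigcup_n F n) : R[i]^o).

Definition variation (nu : set Omega -> R[i]) (E : set Omega) : \bar R :=
  ereal_sup [set (\sum_(0 <= n <oo) (rnorm (nu (F n)))%:E)%E |
    F in [set F : nat -> set Omega | [/\ forall n, borel (F n),
      trivIset setT F & \bigcup_n F n = E]]].

Definition radon (nu : set Omega -> R[i]) :=
  complex_measure nu /\
  forall E, borel E ->
    variation nu E =
      ereal_inf [set variation nu U | U in [set U | open U /\ E `<=` U]] /\
    variation nu E =
      ereal_sup [set variation nu K | K in [set K | compact K /\ K `<=` E]].

Record is_radon_measures (V : normedModType R[i])
    (J : V -> set Omega -> R[i]) : Prop := IsRadonMeasures {
  radon_linear : forall a v w E, borel E ->
    J (a *: v + w) E = a * J v E + J w E;
  radon_radon : forall v, radon (J v);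
  radon_norm : forall v, (rnorm v)%:E = variation (J v) setT;
  radon_onto : forall nu, radon nu ->
    exists v, forall E, borel E -> J v E = nu E }.

Definition radon_cone (V : normedModType R[i]) (J : V -> set Omega -> R[i]) :
    set V := [set v | forall E, borel E -> 0 <= J v E].

(* s is the integral over E of the bounded function f with respect to nu: the
   limit of the integrals of simple functions converging uniformly to f. *)
Definition is_integral (nu : set Omega -> R[i]) (f : Omega -> R[i])
    (E : set Omega) (s : R[i]) :=
  forall e : R, 0 < e ->
  exists (n : nat) (F : 'I_n -> set Omega) (c : 'I_n -> R[i]),
    [/\ forall i, borel (F i), trivIset setT F, \bigcup_i F i = setT,
        forall i t, F i t -> rnorm (f t - c i) <= e
      & rnorm (s - \sum_i c i * nu (E `&` F i)) <= e].

(* f . nu and nu . f are both the measure f dnu. *)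
Definition radon_action (A : starAlgebra R) (J0 : A -> Omega -> R[i])
    (Y : orderedBanachBimodule A) (J : Y -> set Omega -> R[i]) :=
  forall f y E, borel E -> is_integral (J y) (J0 f) E (J (lact f y) E) /\
                           is_integral (J y) (J0 f) E (J (ract y f) E).

End radon_measures.

Section bounded_operators.
Context (R : realType) (E F : normedModType R[i]).

Definition bounded_op (T : E -> F) :=
  (forall a x y, T (a *: x + y) = a *: T x + T y) /\
  exists k : R, forall x, rnorm (T x) <= k * rnorm x.

Definition opnorm (T : E -> F) : R :=
  sup [set rnorm (T x) | x in [set x : E | rnorm x <= 1]].

Record is_B (V : normedModType R[i]) (J : V -> E -> F) : Prop := IsB {
  B_linear : forall a v w, J (a *: v + w) = fun x => a *: J v x + J w x;
  B_bounded : forall v, bounded_op (J v);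
  B_norm : forall v, rnorm v = opnorm (J v);
  B_onto : forall T, bounded_op T -> exists v, J v = T }.

Definition B_cone (KE : set E) (KF : set F) (V : normedModType R[i])
    (J : V -> E -> F) : set V :=
  [set v | forall x, KE x -> KF (J v x)].

End bounded_operators.

Definition B_action (R : realType) (A : starAlgebra R)
    (F : normedModType R[i]) (Y : orderedBanachBimodule A) (J : Y -> A -> F) :=
  forall y c d, J (ract y c) d = J y (smul c d) /\
                J (lact c y) d = J y (smul d c).

(* The inner product is linear in the first variable. *)
Record hilbertSpace (R : realType) := HilbertSpace {
  hilbert_sort :> completeNormedModType R[i];
  inner : hilbert_sort -> hilbert_sort -> R[i];
  inner_linear : forall z a x y,
    inner (a *: x + y) z = a * inner x z + inner y z;
  inner_conj : forall x y, inner y x = (inner x y)^*;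
  inner_norm : forall x, inner x x = `|x| ^+ 2 }.

Section hilbert.
Context (R : realType) (H : hilbertSpace R).

Definition separable := exists D : set H, countable D /\ dense D.

Definition positive_op (T : H -> H) := forall x, 0 <= inner (T x) x.

Definition is_adjoint (T S : H -> H) :=
  forall x y, inner (T x) y = inner x (S y).

(* P = |T|, the positive square root of T^* T. *)
Definition is_abs_op (T P : H -> H) :=
  [/\ bounded_op P, positive_op P
    & exists S, is_adjoint T S /\ P \o P = S \o T].

Definition orthonormal_basis (B : set H) :=
  [/\ forall e, B e -> inner e e = 1,
      forall e e', B e -> B e' -> e != e' -> inner e e' = 0
    & forall x, (forall e, B e -> inner x e = 0) -> x = 0].

(* t is the trace of |T|, computed in some orthonormal basis. *)
Definition has_trace_norm (T : H -> H) (t : \bar R) :=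
  exists P B, [/\ is_abs_op T P, orthonormal_basis B
    & t = \esum_(e in B) (complex.Re (inner (P e) e))%:E].

Record is_trace_class (V : normedModType R[i]) (J : V -> H -> H) : Prop :=
  IsTraceClass {
  trace_class_linear : forall a v w,
    J (a *: v + w) = fun x => a *: J v x + J w x;
  trace_class_bounded : forall v, bounded_op (J v);
  trace_class_norm : forall v, has_trace_norm (J v) (rnorm v)%:E;
  trace_class_onto : forall T t, bounded_op T -> has_trace_norm T t ->
    (t < +oo)%E -> exists v, J v = T }.

Definition trace_class_cone (V : normedModType R[i]) (J : V -> H -> H) :
    set V := [set v | positive_op (J v)].

Definition commutant (S : set (H -> H)) : set (H -> H) :=
  [set T | bounded_op T /\ forall U, S U -> T \o U = U \o T].

End hilbert.

(* A *-algebra isometrically *-isomorphic, through vn_rep, to a self-adjoint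
   set of operators that is its own bicommutant. *)
Record vonNeumannAlgebra (R : realType) := VonNeumannAlgebra {
  vn_alg :> starAlgebra R;
  vn_space : hilbertSpace R;
  vn_rep : vn_alg -> vn_space -> vn_space;
  vn_rep_linear : forall a x y,
    vn_rep (a *: x + y) = fun h => a *: vn_rep x h + vn_rep y h;
  vn_rep_mul : forall x y, vn_rep (smul x y) = vn_rep x \o vn_rep y;
  vn_rep_star : forall x, is_adjoint (vn_rep x) (vn_rep (star x));
  vn_rep_norm : forall x, rnorm x = opnorm (vn_rep x);
  vn_bicommutant : commutant (commutant (range vn_rep)) = range vn_rep }.

Definition vn_pos (R : realType) (M : vonNeumannAlgebra R) : set M :=
  [set a | positive_op (vn_rep a)].

(* M^*, as B(M, C). *)
Definition is_dual (R : realType) (M : vonNeumannAlgebra R)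
    (V : normedModType R[i]) (J : V -> M -> R[i]^o) := is_B J.

Definition dual_cone (R : realType) (M : vonNeumannAlgebra R)
    (V : normedModType R[i]) (J : V -> M -> R[i]^o) : set V :=
  B_cone (F := R[i]^o) (@vn_pos R M) [set z : R[i] | 0 <= z] J.

Section trace.
Context (R : realType) (M : vonNeumannAlgebra R).

(* Only the values of rho on the positive elements matter. *)
Record is_trace (rho : M -> \bar R) : Prop := IsTrace {
  trace_ge0 : forall a, vn_pos a -> (0 <= rho a)%E;
  traceD : forall a b, vn_pos a -> vn_pos b ->
    rho (a + b) = (rho a + rho b)%E;
  traceZ : forall (l : R) a, 0 <= l -> vn_pos a ->
    rho (l%:C *: a) = (l%:E * rho a)%E;
  trace_star : forall a, rho (smul (star a) a) = rho (smul a (star a)) }.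

Definition faithful (rho : M -> \bar R) :=
  forall a, vn_pos a -> rho a = 0%E -> a = 0.

Definition semifinite (rho : M -> \bar R) :=
  forall a, vn_pos a -> a != 0 ->
  exists b, [/\ vn_pos b, vn_pos (a - b), b != 0 & (rho b < +oo)%E].

(* b = |a| *)
Definition is_abs (a b : M) := vn_pos b /\ smul b b = smul (star a) a.

Definition trace_ideal (rho : M -> \bar R) : set M :=
  [set a | exists b, is_abs a b /\ (rho b < +oo)%E].

(* L^1(rho) is the completion of trace_ideal rho for the norm rho(|a|); iota
   is the canonical map, whose values outside trace_ideal rho are irrelevant. *)
Record is_nc_L1 (rho : M -> \bar R) (V : completeNormedModType R[i])
    (iota : M -> V) : Prop := IsNcL1 {
  nc_L1_linear : forall c a b, trace_ideal rho a -> trace_ideal rho b ->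
    iota (c *: a + b) = c *: iota a + iota b;
  nc_L1_norm : forall a b, trace_ideal rho a -> is_abs a b ->
    (rnorm (iota a))%:E = rho b;
  nc_L1_dense : closure (iota @` trace_ideal rho) = setT }.

Definition nc_L1_cone (rho : M -> \bar R) (V : completeNormedModType R[i])
    (iota : M -> V) : set V :=
  closure (iota @` (trace_ideal rho `&` @vn_pos R M)).

End trace.

(* Main.v *)
Require Import Defs.
From HB Require Import structures.
From mathcomp Require Import all_boot all_order all_algebra.
From mathcomp Require cyclic separable cyclotomic.
From mathcomp Require Import complex ring lra zify.
From mathcomp Require Import all_classical all_reals all_analysis
  measurable_realfun.

(** Why the inequality holds.

    Only the four vectors y_ij = Phi(x_i, x_j) matter. Positivity of Phi says
    that they form a positive semidefinite quadruple: the vector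
    |a|^2 y11 + a b^* y12 + a^* b y21 + |b|^2 y22 is positive for all scalars a
    and b. Rescaling x1 and x2 by s and 1/s shows that the Cauchy-Schwarz
    inequality is equivalent to the mean inequality
    |y12| <= (|y11| + |y22|) / 2 for all such quadruples
    (cauchy_schwarz_of_mean). In this form it can be summed, integrated and
    averaged. For scalars it is elementary (scalar_mean_circle). In L^1, in L^2
    and in l_2(C(Omega)) the scalar inequality holds at (almost) every point,
    and for measures it holds on every piece of a partition.

    For spaces of operators on E = M or E = C(Omega), and for the dual of M, the
    quadruple of values at a positive element q of E is positive semidefinite in
    the target F, where the inequality is known. The difficulty is to get from
    positive elements to contractions, since a positive map on a
    noncommutative algebra need not be completely positive. The tool is
    approx_by_positives: every contraction is, up to a small error, a sum of
    l_m p_m with |l_m| = 1, p_m positive and p_1 + .. + p_N at most the unit e.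
    It comes from a discrete version of the Herglotz formula: one averages the
    positive elements S^* (1 - a^* a) S with S = 1 + z a + .. + (z a)^(n-1) over
    roots of unity z (herglotz_sum0, herglotz_sum1). If the norm of F is
    additive on the positive cone, as it is for scalars, measures, functionals
    and trace-class operators, then the inequalities at the p_m add up to the
    inequality at e (mean_operators). A map into C(Omega) is handled point by
    point.

    The spaces L^1(rho) and B_1(H) carry a trace norm, and the same
    decomposition is used on the dual side. The norm of y is attained on the
    pairing with a contraction u of the algebra, the phase of y; replacing u by
    a sum of l_m p_m reduces the estimate of y12 to positive elements
    (mean_inequality_trace). The pairing is built from the trace alone, which
    need not be normal: this takes square roots (sqrt_exists), polar
    decompositions inside the algebra (polar) and the positivity of the trace
    on products of positive elements (retr_mul_pos). Both spaces are instances
    of trace_norm_rep: the algebra is M with the trace rho in the first case,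
    and the algebra of all bounded operators with the sum of the diagonal
    entries in an orthonormal basis in the second, where Parseval's identity
    gives the trace property. *)

Set Implicit Arguments.
Unset Strict Implicit.
Unset Printing Implicit Defensive.

Import Order.TTheory GRing.Theory Num.Theory numFieldNormedType.Exports.

Local Open Scope complex_scope.
Local Open Scope classical_set_scope.
Local Open Scope ring_scope.

(** * Real-valued norms and positive semidefinite quadruples *)

Section RealNorm.
Context (R : realType) (V : normedZmodType R[i]).
Implicit Types v w : V.

Lemma normE v : `|v| = (rnorm v)%:C.
Proof. by rewrite /rnorm RRe_real // normr_real. Qed.

Lemma rnorm_ge0 v : 0 <= rnorm v.
Proof. by rewrite -ler0c -normE. Qed.

Lemma rnorm0 : rnorm (0 : V) = 0.
Proof. by rewrite /rnorm normr0. Qed.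

Lemma rnorm0_eq0 v : rnorm v = 0 -> v = 0.
Proof. by move=> v0; apply: normr0_eq0; rewrite normE v0. Qed.

Lemma rnormD v w : rnorm (v + w) <= rnorm v + rnorm w.
Proof. by rewrite -lecR rmorphD /= -!normE ler_normD. Qed.

Lemma rnormN v : rnorm (- v) = rnorm v.
Proof. by rewrite /rnorm normrN. Qed.

Lemma rnormBC v w : rnorm (v - w) = rnorm (w - v).
Proof. by rewrite -rnormN opprB. Qed.

Lemma rnorm_sum (I : finType) (F : I -> V) :
  rnorm (\sum_i F i) <= \sum_i rnorm (F i).
Proof.
elim/big_rec2: _ => [|i x y _ h]; first by rewrite rnorm0.
exact: le_trans (rnormD _ _) (lerD _ h).
Qed.

End RealNorm.

Section RealNormScale.
Context (R : realType).

Lemma rnormZ (V : normedModType R[i]) (a : R[i]) (v : V) :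
  rnorm (a *: v) = rnorm a * rnorm v.
Proof. by apply: (@complexI R); rewrite -normE normrZ !normE rmorphM. Qed.

Lemma rnormM (a b : R[i]) : rnorm (a * b) = rnorm a * rnorm b.
Proof. by apply: (@complexI R); rewrite -normE normrM !normE rmorphM. Qed.

Lemma rnormX (a : R[i]) n : rnorm (a ^+ n) = rnorm a ^+ n.
Proof. by apply: (@complexI R); rewrite -normE normrX normE rmorphXn. Qed.

Lemma conjR (x : R) : (x%:C)^* = x%:C :> R[i].
Proof. exact: conjc_real. Qed.

Lemma rnormJ (a : R[i]) : rnorm a^* = rnorm a.
Proof. by rewrite /rnorm norm_conjC. Qed.

Lemma rnorm_ge0E (a : R[i]) : 0 <= a -> rnorm a = complex.Re a.
Proof. by move=> a0; rewrite /rnorm ger0_norm. Qed.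

Lemma rnormR (x : R) : rnorm x%:C = `|x|.
Proof. by rewrite /rnorm normc_def /= expr0n addr0 sqrtr_sqr. Qed.

Lemma Re_le_rnorm (a : R[i]) : complex.Re a <= rnorm a.
Proof.
by apply: le_trans (ler_norm _) _; rewrite -lecR -normE normc_ge_Re.
Qed.

Lemma sqr_rnorm (a : R[i]) : (rnorm a ^+ 2)%:C = a * a^*.
Proof. by rewrite rmorphXn /= -normE normCK. Qed.

End RealNormScale.

(** Positive semidefiniteness of a 2 x 2 matrix with entries in a space ordered
    by K, tested on vectors of scalars. *)
Definition psd (R : realType) (V : lmodType R[i]) (K : set V)
    (y11 y12 y21 y22 : V) :=
  forall al be : R[i], K ((al * al^*) *: y11 + (al * be^*) *: y12
                          + (al^* * be) *: y21 + (be * be^*) *: y22).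

Section Psd.
Context (R : realType).
Implicit Types V W : lmodType R[i].

Lemma psd_diag V (K : set V) y11 y12 y21 y22 :
  psd K y11 y12 y21 y22 -> K y11 /\ K y22.
Proof.
move=> P; split.
- by have := P 1 0; rewrite rmorph1 rmorph0 mul1r !(mulr0, mul0r) scale1r
    !scale0r !addr0.
- by have := P 0 1; rewrite rmorph1 rmorph0 mul1r !(mulr0, mul0r) scale1r
    !scale0r !add0r.
Qed.

Lemma psd_map V W (K : set V) (K' : set W) (f : V -> W) :
  (forall a v w, f (a *: v + w) = a *: f v + f w) ->
  (forall v, K v -> K' (f v)) ->
  forall y11 y12 y21 y22, psd K y11 y12 y21 y22 ->
    psd K' (f y11) (f y12) (f y21) (f y22).
Proof.
move=> lin Kf y11 y12 y21 y22 P al be; have /Kf := P al be.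
have f0 : f 0 = 0.
  by have := lin (-1) 0 0; rewrite scaler0 addr0 scaleN1r addNr.
have fZ a v : f (a *: v) = a *: f v by rewrite -[a *: v]addr0 lin f0 addr0.
have fD v w : f (v + w) = f v + f w by rewrite -[v]scale1r lin !scale1r.
by rewrite !fD !fZ.
Qed.

(** Multiplying one vector by s and the other by 1/s leaves the off-diagonal
    entries alone. The Cauchy-Schwarz bound is invariant under this change, the
    mean bound is not, and optimizing over s turns the latter into the
    former. *)
Lemma psd_scale V (K : set V) y11 y12 y21 y22 (s : R) : 0 < s ->
  psd K y11 y12 y21 y22 ->
  psd K ((s ^+ 2)%:C *: y11) y12 y21 ((s ^- 2)%:C *: y22).
Proof.
move=> s0 P al be.
have := P (s%:C * al) (s^-1%:C * be).
rewrite ![(_ * _)^*]rmorphM /= !conjR.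
have sV : s%:C * s^-1%:C = 1 by rewrite -rmorphM mulfV ?gt_eqF.
have -> : s%:C * al * (s%:C * al^*) = al * al^* * (s ^+ 2)%:C.
  by rewrite rmorphXn /=; ring.
have -> : s%:C * al * (s^-1%:C * be^*) = al * be^*.
  by rewrite mulrACA sV mul1r.
have -> : s%:C * al^* * (s^-1%:C * be) = al^* * be.
  by rewrite mulrACA sV mul1r.
have -> : s^-1%:C * be * (s^-1%:C * be^*) = be * be^* * (s ^- 2)%:C.
  by rewrite -exprVn rmorphXn /=; ring.
by rewrite !scalerA.
Qed.

End Psd.

(** The arithmetic-mean form of the inequality. By homogeneity it is equivalent
    to the Cauchy-Schwarz inequality, and it is better behaved: unlike a
    product of square roots it can be summed term by term. *)
Definition mean_inequality (R : realType) (V : normedModType R[i])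
    (K : set V) :=
  forall y11 y12 y21 y22 : V, psd K y11 y12 y21 y22 ->
    rnorm y12 <= (rnorm y11 + rnorm y22) / 2.

(** The right-hand side is minimal at s^2 = sqrt B / sqrt A. *)
Lemma le_sqrt_of_scaled_mean (R : realType) (y A B : R) : 0 <= A -> 0 <= B ->
  (forall s, 0 < s -> y <= (s ^+ 2 * A + s ^- 2 * B) / 2) ->
  y <= Num.sqrt A * Num.sqrt B.
Proof.
move=> A0 B0 h; apply/ler_addgt0Pr => e e0.
(* If only one of A and B vanishes, the infimum over s is not attained, so
   both are perturbed. *)
pose g (d : R) : R := (Num.sqrt A + d) * (Num.sqrt B + d).
have key (d : R) : 0 < d -> y <= g d.
  move=> d0; set a := Num.sqrt A + d; set b := Num.sqrt B + d.
  have a0 : 0 < a by rewrite /a ltr_wpDl ?sqrtr_ge0.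
  have b0 : 0 < b by rewrite /b ltr_wpDl ?sqrtr_ge0.
  have s0 : 0 < Num.sqrt (b / a) by rewrite sqrtr_gt0 divr_gt0.
  apply: le_trans (h _ s0) _.
  rewrite sqr_sqrtr ?(ltW (divr_gt0 _ _))// invf_div.
  have Aa : A <= a ^+ 2.
    by rewrite -[A in A <= _](sqr_sqrtr A0) ler_sqr ?nnegrE ?sqrtr_ge0 ?(ltW
      a0)// /a lerDl ltW.
  have Bb : B <= b ^+ 2.
    by rewrite -[B in B <= _](sqr_sqrtr B0) ler_sqr ?nnegrE ?sqrtr_ge0 ?(ltW
      b0)// /b lerDl ltW.
  have -> : g d = (b / a * a ^+ 2 + a / b * b ^+ 2) / 2.
    by rewrite /g -/a -/b; field; rewrite !gt_eqF.
  by rewrite ler_pM2r ?invr_gt0// lerD// ler_wpM2l// ?divr_ge0 ?ltW.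
pose S := Num.sqrt A + Num.sqrt B + 1.
have S0 : 0 < S by rewrite /S ltr_wpDl ?addr_ge0 ?sqrtr_ge0.
pose d := Num.min 1 (e / S).
have d0 : 0 < d by rewrite /d lt_min ltr01 divr_gt0.
apply: le_trans (key _ d0) _.
have dS : d * S <= e by rewrite -ler_pdivlMr// /d ge_min lexx orbT.
have d1 : d <= 1 by rewrite /d ge_min lexx.
have : d * d <= d by rewrite ler_piMr // ltW.
by rewrite /g /S in dS *; nra.
Qed.

Lemma cauchy_schwarz_of_mean (R : realType) (X : lmodType R[i])
    (A : starAlgebra R) (Y : orderedBanachBimodule A) :
  mean_inequality (cone Y) -> cauchy_schwarz X Y.
Proof.
move=> mean Phi [Phil Phir Phi_pos] x1 x2.
have P : psd (cone Y) (Phi x1 x1) (Phi x1 x2) (Phi x2 x1) (Phi x2 x2).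
  move=> al be; have := Phi_pos (al *: x1 + be *: x2).
  have Phi0l x : Phi 0 x = 0.
    by have := Phil x (-1) 0 0; rewrite scaler0 addr0 scaleN1r addNr.
  have Phi0r x : Phi x 0 = 0.
    by have := Phir x (-1) 0 0; rewrite scaler0 addr0 rmorphN rmorph1 scaleN1r
      addNr.
  have PhiZl a x y : Phi (a *: x) y = a *: Phi x y.
    by rewrite -[a *: x]addr0 Phil Phi0l addr0.
  have PhiZr a x y : Phi x (a *: y) = a^* *: Phi x y.
    by rewrite -[a *: y]addr0 Phir Phi0r addr0.
  rewrite Phil PhiZl !Phir !PhiZr !scalerDr !scalerA.
  by rewrite [be * al^*]mulrC !addrA.
apply: le_sqrt_of_scaled_mean; rewrite ?rnorm_ge0// => s s0.
apply: le_trans (mean _ _ _ _ (psd_scale s0 P)) _.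
by rewrite !rnormZ !rnormR !ger0_norm// ?invr_ge0 exprn_ge0// ltW.
Qed.

(** * Scalars *)

Section Scalars.
Context (R : realType).
Implicit Types a b c d : R[i].

(** Real values at the four points 1, -1, i, -i of the circle force d = c^*;
    then al + be runs through the circle until it meets the phase of c. *)
Lemma scalar_mean_circle a b c d :
  (forall l : R[i], rnorm l = 1 -> 0 <= a + l^* * c + l * d + b) ->
  rnorm c <= (complex.Re a + complex.Re b) / 2.
Proof.
move=> P.
have n1 : rnorm (1 : R[i]) = 1 by rewrite /rnorm normr1.
have := P 1 n1; have := P (-1); rewrite rnormN => /(_ n1).
rewrite rmorphN rmorph1 !mulN1r !mul1r => hN1 h1.
have [c0|c0] := eqVneq c 0.
  rewrite c0 rnorm0; move: h1 hN1 {P}; rewrite c0 oppr0 addr0.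
  case: a => a1 a2; case: b => b1 b2; case: d => d1 d2.
  by rewrite !lecE /= => /andP[_ h] /andP[_ h']; lra.
have nc : 0 < rnorm c.
  by rewrite lt_def rnorm_ge0 andbT; apply: contra_neq c0 => /rnorm0_eq0.
have ni : rnorm ('i : R[i]) = 1.
  by rewrite /rnorm normc_def /= expr0n add0r expr1n sqrtr1.
have := P 'i ni; have := P (- 'i); rewrite rnormN => /(_ ni).
pose l := - (c / (rnorm c)%:C).
have nl : rnorm l = 1.
  rewrite /l rnormN rnormM -fmorphV rnormR gtr0_norm ?invr_gt0//.
  by rewrite mulfV// gt_eqF.
have := P l nl.
have -> : l^* * c = - (rnorm c)%:C.
  rewrite /l rmorphN rmorphM /= -fmorphV conjR mulNr; congr (- _).
  rewrite mulrAC [_^* * c]mulrC -sqr_rnorm -rmorphM /=; congr (_%:C).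
  by rewrite expr2 mulfK// gt_eqF.
move=> hl hNi hi.
have dE : d = c^*.
  move: h1 hN1 hi hNi {P l nl hl c0 nc ni}.
  case: a => a1 a2; case: b => b1 b2; case: d => d1 d2; case: c => c1 c2.
  rewrite !lecE /= => /andP[/eqP e1 _] /andP[/eqP e2 _] /andP[/eqP e3 _].
  move=> /andP[/eqP e4 _]; apply/eqP; rewrite eq_complex /=.
  by apply/andP; split; apply/eqP; lra.
have ld : l * d = - (rnorm c)%:C.
  rewrite dE /l -fmorphV mulNr; congr (- _).
  rewrite mulrAC -sqr_rnorm -rmorphM /=; congr (_%:C).
  by rewrite expr2 mulfK// gt_eqF.
move: hl; rewrite ld.
move: (rnorm c) => n.
case: a {P h1 hN1 hi hNi} => a1 a2; case: b => b1 b2.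
by rewrite !lecE /= => /andP[_ h]; lra.
Qed.

Lemma scalar_mean a c d b : psd [set z : R[i]^o | 0 <= z] a c d b ->
  rnorm c <= (complex.Re a + complex.Re b) / 2.
Proof.
move=> P; apply: (@scalar_mean_circle _ _ _ d) => l l1.
have := P 1 l; rewrite /= rmorph1 mul1r !mul1r.
have -> : l * l^* = 1 by rewrite -sqr_rnorm l1 expr1n.
by rewrite /GRing.scale /= !mul1r.
Qed.

Lemma mean_inequality_scalar :
  mean_inequality [set z : R[i]^o | 0 <= z].
Proof.
move=> a c d b P; have [a0 b0] := psd_diag P.
by rewrite (rnorm_ge0E a0) (rnorm_ge0E b0); exact: scalar_mean P.
Qed.

End Scalars.

(** * Functions and measures: scalar inequalities integrated or summed *)

(** The factor 1/2 is lost on squares, and recovered by rescaling. *)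
Lemma mean_inequality_of_squares (R : realType) (V : normedModType R[i])
    (K : set V) :
  (forall y11 y12 y21 y22 : V, psd K y11 y12 y21 y22 ->
    rnorm y12 ^+ 2 <= (rnorm y11 ^+ 2 + rnorm y22 ^+ 2) / 2) ->
  mean_inequality K.
Proof.
move=> h y11 y12 y21 y22 P; set A := rnorm y11; set B := rnorm y22.
have A0 : 0 <= A by exact: rnorm_ge0.
have B0 : 0 <= B by exact: rnorm_ge0.
have : rnorm y12 ^+ 2 <= Num.sqrt (A ^+ 2) * Num.sqrt (B ^+ 2).
  apply: le_sqrt_of_scaled_mean; rewrite ?sqr_ge0// => s s0.
  have t0 : 0 < Num.sqrt s by rewrite sqrtr_gt0.
  have := h _ _ _ _ (psd_scale t0 P).
  rewrite !rnormZ !rnormR sqr_sqrtr ?(ltW s0)// !ger0_norm ?invr_ge0 ?(ltW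
    s0)//.
  by rewrite !exprMn exprVn.
rewrite !sqrtr_sqr !ger0_norm// => AB.
rewrite -ler_sqr ?nnegrE ?rnorm_ge0 ?divr_ge0 ?addr_ge0//.
apply: le_trans AB _; rewrite -subr_ge0.
have -> : ((A + B) / 2) ^+ 2 - A * B = ((A - B) / 2) ^+ 2 by field.
exact: sqr_ge0.
Qed.

Lemma sqr_rnormE (R : realType) (z : R[i]) :
  rnorm z ^+ 2 = complex.Re z ^+ 2 + complex.Im z ^+ 2.
Proof. by apply: complexI; rewrite sqr_rnorm -normCK -add_Re2_Im2. Qed.

Section RationalScalars.
Context (R : realType).

Lemma quadratic_ge0_of_rat (A B C : R) :
  (forall q : rat, 0 <= A + ratr q * B + ratr q ^+ 2 * C) ->
  forall x, 0 <= A + x * B + x ^+ 2 * C.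
Proof.
move=> h x; pose f (x : R) := A + x * B + x ^+ 2 * C.
have cf : continuous f.
  move=> y; apply: cvgD; last by apply: cvgMl; exact: exprn_continuous.
  by apply: cvgD; [exact: cvg_cst | apply: cvgMl; exact: cvg_id].
have cl : closed (f @^-1` [set y | 0 <= y]).
  by apply: preimage_closed; [move=> y _; exact: cf | exact: closed_ge].
apply: (cl x) => U xU.
have [V [oV Vx VU]] : exists V, [/\ open V, V x & V `<=` U].
  by move: xU; rewrite nbhsE => -[V [oV Vx] VU]; exists V.
have Vn : V !=set0 by exists x.
have [y [Vy [q _ qy]]] := @dense_rat R V Vn oV.
rewrite -qy in Vy.
by exists (ratr q); split; [exact: h | exact: VU].
Qed.

(** The hypothesis is polynomial in the real and imaginary parts of l, hence
    extends from rational to real values, one variable at a time. *)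
Lemma scalar_mean_rat (a c d b : R[i]) :
  (forall p q : rat, let l : R[i] := ratr p +i* ratr q in
    0 <= a + l^* * c + l * d + (l * l^*) * b) ->
  rnorm c <= (complex.Re a + complex.Re b) / 2.
Proof.
move=> h; apply: (@scalar_mean_circle _ a b c d) => l l1.
have -> : b = (l * l^*) * b by rewrite -sqr_rnorm l1 expr1n mul1r.
case: a c d b l h {l1} => [a1 a2] [c1 c2] [d1 d2] [b1 b2] [x y] h.
pose F (x y : R) := a1 + x * c1 + y * c2 + x * d1 - y * d2
  + (x ^+ 2 + y ^+ 2) * b1.
pose G (x y : R) := a2 + x * c2 - y * c1 + x * d2 + y * d1
  + (x ^+ 2 + y ^+ 2) * b2.
have FG u v : let l : R[i] := u +i* v in
    (a1 +i* a2) + l^* * (c1 +i* c2) + l * (d1 +i* d2) + (l * l^*) * (b1 +i* b2)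
    = F u v +i* G u v.
  by apply/eqP; rewrite eq_complex /=; apply/andP; split; apply/eqP;
    rewrite /F /G; ring.
have ext (P : R -> R -> R) (A B : R -> R) C C' B' A' :
    (forall u v, P u v = A v + u * B v + u ^+ 2 * C) ->
    (forall u v, P u v = A' u + v * B' u + v ^+ 2 * C') ->
    (forall p q : rat, 0 <= P (ratr p) (ratr q)) -> forall u v, 0 <= P u v.
  move=> PA PA' P0 u v; rewrite PA'; apply: quadratic_ge0_of_rat => q.
  rewrite -PA' PA; apply: quadratic_ge0_of_rat => p; rewrite -PA; exact: P0.
have := FG x y => /= ->; rewrite lecE /=.
have F0 : forall u v, 0 <= F u v.
  apply: (ext _ (fun v => a1 + v * (c2 - d2) + v ^+ 2 * b1)
    (fun=> c1 + d1) b1 b1 (fun=> c2 - d2)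
    (fun u => a1 + u * (c1 + d1) + u ^+ 2 * b1)).
  - by move=> u v; rewrite /F; ring.
  - by move=> u v; rewrite /F; ring.
  by move=> p q; have := h p q; rewrite /= FG lecE => /andP[].
have G0 : forall u v, 0 <= G u v.
  apply: (ext _ (fun v => a2 + v * (d1 - c1) + v ^+ 2 * b2)
    (fun=> c2 + d2) b2 b2 (fun=> d1 - c1)
    (fun u => a2 + u * (c2 + d2) + u ^+ 2 * b2)).
  - by move=> u v; rewrite /G; ring.
  - by move=> u v; rewrite /G; ring.
  by move=> p q; have := h p q; rewrite /= FG lecE => /andP[/eqP /= -> _].
have G1 : forall u v, 0 <= - G u v.
  apply: (ext (fun u v => - G u v) (fun v => - (a2 + v * (d1 - c1) + v ^+ 2 *
    b2))
    (fun=> - (c2 + d2)) (- b2) (- b2) (fun=> - (d1 - c1))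
    (fun u => - (a2 + u * (c2 + d2) + u ^+ 2 * b2))).
  - by move=> u v; rewrite /G; ring.
  - by move=> u v; rewrite /G; ring.
  by move=> p q; have := h p q; rewrite /= FG lecE => /andP[/eqP /= -> _];
    rewrite oppr0.
rewrite F0 andbT; apply/eqP/le_anti; rewrite G0 andbT.
by have := G1 x y; rewrite oppr_ge0.
Qed.

End RationalScalars.

Section LpSpaces.
Context d (T : measurableType d) (R : realType).
Variable mu : {measure set T -> \bar R}.
Variables (V : normedModType R[i]) (J : V -> T -> R[i]) (p : R).
Hypothesis J_Lp : is_Lp mu p J.

(** Countably many scalars suffice, so a single null set is discarded. *)
Lemma Lp_psd_ae y11 y12 y21 y22 : psd (Lp_cone mu J) y11 y12 y21 y22 ->
  {ae mu, forall t, rnorm (J y12 t) <= (rnorm (J y11 t) + rnorm (J y22 t)) / 2}.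
Proof.
move=> P; have [P1 P2] := psd_diag P.
have lin := Lp_linear J_Lp.
have J0 : {ae mu, forall t, J 0 t = 0}.
  have := lin (-1) 0 0; apply: filterS => t.
  by rewrite scaler0 addr0 mulN1r addNr.
have lin2 (a b : R[i]) (v w : V) :
    {ae mu, forall t, J (a *: v + b *: w) t = a * J v t + b * J w t}.
  have h1 := lin a v (b *: w); have h2 := lin b w 0.
  apply: filterS3 h1 h2 J0 => t /= -> h2 h0.
  by rewrite -[b *: w]addr0 h2 h0 addr0.
have key (l : R[i]) : {ae mu, forall t,
    0 <= J y11 t + l^* * J y12 t + l * J y21 t + (l * l^*) * J y22 t}.
  have h := P 1 l; rewrite rmorph1 !mul1r in h.
  have h1 := lin2 1 l^* y11 y12; have h2 := lin2 l (l * l^*) y21 y22.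
  have h3 := lin2 1 1 (1 *: y11 + l^* *: y12) (l *: y21 + (l * l^*) *: y22).
  have h4 : {ae mu, forall t, 0 <= J (1 *: y11 + l^* *: y12) t
      + J (l *: y21 + (l * l^*) *: y22) t}.
    apply: filterS2 h3 h => t /=; rewrite !scale1r !mul1r !addrA => ->.
    by [].
  apply: filterS3 h1 h2 h4 => t /= -> ->.
  by rewrite mul1r !addrA.
pose Q (n : nat) (t : T) := forall q r : rat, unpickle n = Some (q, r) ->
  let l : R[i] := ratr q +i* ratr r in
  0 <= J y11 t + l^* * J y12 t + l * J y21 t + (l * l^*) * J y22 t.
have hQ : forall n, \forall t \ae mu, Q n t.
  move=> n; rewrite /Q; case: (unpickle n) => [[q r]|]; last exact: aeW.
  have := key (ratr q +i* ratr r); apply: filterS => t h q' r' [<- <-].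
  exact: h.
have := ae_foralln hQ; apply: filterS3 P1 P2 => t h1 h2 h.
rewrite (rnorm_ge0E h1) (rnorm_ge0E h2).
apply: (@scalar_mean_rat _ _ _ (J y21 t)) => q r.
exact: (h (pickle (q, r)) q r (pickleK _)).
Qed.

Lemma measurable_rnorm (f : T -> R[i]) : complex_measurable f ->
  measurable_fun setT (fun t => rnorm (f t)).
Proof.
move=> [mRe mIm].
rewrite [X in measurable_fun _ X](_ : _ =
  (fun x : R => x `^ 2^-1) \o (fun t => complex.Re (f t) ^+ 2 + complex.Im (f
    t) ^+ 2)).
  apply: measurableT_comp; first exact: measurable_powR.
  by apply: measurable_funD; exact: measurable_funX.
apply/funext => t /=.
by rewrite -sqr_rnormE powR12_sqrt ?sqr_ge0// sqrtr_sqr ger0_norm ?rnorm_ge0.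
Qed.

End LpSpaces.

Section L1L2.
Context d (T : measurableType d) (R : realType).
Variable mu : {measure set T -> \bar R}.
Variables (V : normedModType R[i]) (J : V -> T -> R[i]).

Lemma half_sumE (a b : R) :
  ((a + b) / 2)%:E = ((2^-1)%:E * (a%:E + b%:E))%E.
Proof. by rewrite mulrC EFinM. Qed.

Lemma integral_mean (f g h : T -> R) :
  measurable_fun setT f -> measurable_fun setT g -> measurable_fun setT h ->
  (forall t, 0 <= f t) -> (forall t, 0 <= g t) -> (forall t, 0 <= h t) ->
  {ae mu, forall t, h t <= (f t + g t) / 2} ->
  (\int[mu]_t (h t)%:E <=
   (2^-1)%:E * (\int[mu]_t (f t)%:E + \int[mu]_t (g t)%:E))%E.
Proof.
move=> mf mg mh f0 g0 h0 hfg.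
rewrite -ge0_integralD//; [|by move=> t _; rewrite lee_fin|
  exact/measurable_EFinP|by move=> t _; rewrite lee_fin|
  exact/measurable_EFinP].
rewrite -ge0_integralZl_EFin//; last first.
- apply/measurable_EFinP; exact: measurable_funD.
- by move=> t _; rewrite lee_fin addr_ge0.
apply: ae_ge0_le_integral => //.
- by move=> t _; rewrite lee_fin.
- exact/measurable_EFinP.
- by move=> t _; rewrite lee_fin mulr_ge0 ?addr_ge0.
- apply/measurable_EFinP; apply: measurable_funM; first exact: measurable_cst.
  exact: measurable_funD.
- apply: filterS hfg => t ht _; rewrite lee_fin; apply: le_trans ht _.
  by rewrite mulrC.
Qed.

Lemma mean_inequality_L1 : is_Lp mu 1 J -> mean_inequality (Lp_cone mu J).
Proof.
move=> JL y11 y12 y21 y22 P; have hP := Lp_psd_ae JL P.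
have N v : (rnorm v)%:E = (\int[mu]_t (rnorm (J v t))%:E)%E.
  rewrite (Lp_norm JL) /complex_Lnorm Lnorm1; apply: eq_integral => t _.
  by rewrite /= ger0_norm ?rnorm_ge0.
rewrite -lee_fin half_sumE !N.
apply: integral_mean hP.
1-3: exact: measurable_rnorm (Lp_measurable JL _).
all: by move=> t; exact: rnorm_ge0.
Qed.

Lemma mean_inequality_L2 : is_Lp mu 2 J -> mean_inequality (Lp_cone mu J).
Proof.
move=> JL; apply: mean_inequality_of_squares => y11 y12 y21 y22 P.
have hP := Lp_psd_ae JL P.
have N v : (rnorm v ^+ 2)%:E = (\int[mu]_t (rnorm (J v t) ^+ 2)%:E)%E.
  rewrite -powR_mulrn ?rnorm_ge0// -poweR_EFin (Lp_norm JL) /complex_Lnorm.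
  rewrite poweR_Lnorm ?pnatr_eq0//; apply: eq_integral => t _.
  by rewrite /= ger0_norm ?rnorm_ge0// powR_mulrn ?rnorm_ge0.
rewrite -lee_fin half_sumE !N.
apply: integral_mean.
1-3: by apply: measurable_funX; exact: measurable_rnorm (Lp_measurable JL _).
1-3: by move=> t; exact: sqr_ge0.
apply: filterS hP => t; have := rnorm_ge0 (J y12 t).
have := sqr_ge0 (rnorm (J y11 t) - rnorm (J y22 t)).
by move: (rnorm (J y11 t)) (rnorm (J y22 t)) (rnorm (J y12 t)) => x y z; nra.
Qed.

End L1L2.

(** Half of the additivity of the norm on a cone: it is what allows bounds for
    the pieces of a positive element to be added up. *)
Definition superadditive_norm (R : realType) (V : normedModType R[i])
    (K : set V) :=
  forall y y' : V, K y -> K y' -> rnorm y + rnorm y' <= rnorm (y + y').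

Lemma cvg_rnormP (R : realType) (V : normedModType R[i]) (u : nat -> V)
    (l : V) :
  u @ \oo --> l <->
  forall e : R, 0 < e -> exists N, forall n, (N <= n)%N -> rnorm (l - u n) < e.
Proof.
split=> [/cvgrPdist_lt h e e0|h].
  have e0C : 0 < e%:C :> R[i] by rewrite ltcR.
  have [N _ hN] := h _ e0C; exists N => n /hN /=.
  by rewrite normE ltcR.
apply/cvgrPdist_lt => e e0.
have eR : e = (complex.Re e)%:C by rewrite RRe_real// gtr0_real.
have [N hN] := h (complex.Re e) ltac:(by rewrite -ltcR -eR).
by exists N => // n /= /hN; rewrite eR normE ltcR.
Qed.

Section SquareSummable.
Context (R : realType) (Omega : topologicalType).
Hypothesis Omega_compact : compact [set: Omega].
Variables (V : normedModType R[i]) (J : V -> nat -> Omega -> R[i]).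
Hypothesis J_l2C : is_l2C J.

Lemma l2C_partial_sum (y : V) n t :
  \sum_(i < n) rnorm (J y i t) ^+ 2 <= rnorm y ^+ 2.
Proof.
have [g hg] := l2C_summable J_l2C y.
rewrite (l2C_norm J_l2C hg); case: hg => cJ cg /pointwise_uniform_cvg.
move=> /pointwise_cvgP /(_ t).
rewrite -[_ --> _]/((fun n => \sum_(i < n) rnorm (J y i t) ^+ 2) @ \oo --> g t).
move=> ug.
have le_g : \sum_(i < n) rnorm (J y i t) ^+ 2 <= g t.
  have nd : {homo (fun n => \sum_(i < n) rnorm (J y i t) ^+ 2) :
      m k / (m <= k)%N >-> m <= k}.
    move=> m k mk; rewrite -(big_mkord xpredT (fun i => rnorm (J y i t) ^+ 2)).
    rewrite -(big_mkord xpredT (fun i => rnorm (J y i t) ^+ 2)).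
    rewrite (big_cat_nat _ mk)//= lerDl sumr_ge0// => i _; exact: sqr_ge0.
  rewrite -(cvg_lim _ ug)//; apply: (nondecreasing_cvgn_le nd).
  by apply/cvg_ex; exists (g t).
have bg : has_ubound [set g t | t in [set: Omega]].
  have cpt : compact [set g t | t in [set: Omega]].
    by apply: continuous_compact => //; exact: continuous_subspaceT.
  have [M [_ hM]] := compact_bounded cpt.
  exists (M + 1) => _ [s _ <-]; apply: le_trans (ler_norm _) _.
  by apply: (hM (M + 1)); [rewrite ltrDl | exists s].
have gs : g t <= sup [set g t | t in [set: Omega]].
  by apply: (ub_le_sup bg); exists t.
rewrite sqr_sqrtr; first exact: le_trans le_g gs.
by apply: le_trans gs; apply: le_trans le_g; rewrite sumr_ge0// => i _;
  exact: sqr_ge0.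
Qed.

Lemma rnorm_l2C_le (y : V) (M : R) : 0 <= M ->
  (forall n t, \sum_(i < n) rnorm (J y i t) ^+ 2 <= M) -> rnorm y ^+ 2 <= M.
Proof.
move=> M0 h; have [g hg] := l2C_summable J_l2C y.
rewrite (l2C_norm J_l2C hg); case: hg => cJ cg /pointwise_uniform_cvg.
move=> /pointwise_cvgP ug.
have gM t : g t <= M.
  have ug' : (fun n => \sum_(i < n) rnorm (J y i t) ^+ 2) @ \oo --> g t := ug t.
  by apply: (cvgr_to_le ug'); apply: nearW => n; exact: h.
have [->|/set0P[_ [t0 _ _]]] := eqVneq [set g t | t in [set: Omega]] set0.
  by rewrite sup0 sqrtr0 expr0n.
have s0 : [set g t | t in [set: Omega]] !=set0 by exists (g t0), t0.
have [h0|h0] := leP 0 (sup [set g t | t in [set: Omega]]); last first.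
  by rewrite ltr0_sqrtr// expr0n.
by rewrite sqr_sqrtr//; apply: ge_sup => // _ [t _ <-].
Qed.

(** The scalar inequality, squared and summed over n at every point t. *)
Lemma mean_inequality_l2C : mean_inequality (l2C_cone J).
Proof.
apply: mean_inequality_of_squares => y11 y12 y21 y22 P.
apply: rnorm_l2C_le => [|n t]; first by rewrite divr_ge0 ?addr_ge0 ?sqr_ge0.
apply: (@le_trans _ _ ((\sum_(i < n) rnorm (J y11 i t) ^+ 2 +
    \sum_(i < n) rnorm (J y22 i t) ^+ 2) / 2)); last first.
  by rewrite ler_pM2r ?invr_gt0// lerD ?l2C_partial_sum.
rewrite -big_split /= big_distrl /=; apply: ler_sum => i _.
have : rnorm (J y12 i t) <= (rnorm (J y11 i t) + rnorm (J y22 i t)) / 2.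
  apply: (@mean_inequality_scalar R _ _ (J y21 i t)).
  apply: (psd_map (W := R[i]^o) (f := fun v => J v i t) _ _ P).
    by move=> a v w; rewrite (l2C_linear J_l2C).
  by move=> v; exact.
have := rnorm_ge0 (J y12 i t).
have := sqr_ge0 (rnorm (J y11 i t) - rnorm (J y22 i t)).
by move: (rnorm (J y11 i t)) (rnorm (J y22 i t)) (rnorm (J y12 i t)) => x y z;
  nra.
Qed.

End SquareSummable.

Section RadonMeasures.
Context (R : realType) (Omega : topologicalType).
Variables (V : normedModType R[i]) (J : V -> set Omega -> R[i]).
Hypothesis J_radon : is_radon_measures J.

(** The total variation is a supremum of sums over partitions, and the scalar
    inequality holds on each piece of a partition. *)
Lemma mean_inequality_radon : mean_inequality (radon_cone J).
Proof.
move=> y11 y12 y21 y22 P; rewrite -lee_fin half_sumE !(radon_norm J_radon).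
apply: ge_ereal_sup => _ [F [bF tF UF] <-].
have sup_le v : (\sum_(0 <= n <oo) (rnorm (J v (F n)))%:E <=
    Defs.variation (J v) setT)%E by apply: ereal_sup_ubound; exists F.
apply: (@le_trans _ _ ((2^-1)%:E * (\sum_(0 <= n <oo) (rnorm (J y11 (F n)))%:E +
   \sum_(0 <= n <oo) (rnorm (J y22 (F n)))%:E))%E); last first.
  by apply: lee_wpmul2l; [rewrite lee_fin | apply: leeD; exact: sup_le].
have r0 v n : (0 <= (rnorm (J v (F n)))%:E)%E by rewrite lee_fin rnorm_ge0.
rewrite -nneseriesD// -nneseriesZl//; last by move=> i _; rewrite adde_ge0.
apply: lee_nneseries => // n _; rewrite -half_sumE lee_fin.
apply: (@mean_inequality_scalar R _ _ (J y21 (F n))).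
apply: (psd_map (W := R[i]^o) (f := fun v => J v (F n)) _ _ P).
  by move=> a v w; rewrite (radon_linear J_radon).
by move=> v; exact.
Qed.

Lemma borelT : borel [set: Omega].
Proof. by apply: sub_gen_smallest; exact: openT. Qed.

(** By countable additivity, a positive measure has total variation equal to
    its total mass. *)
Lemma rnorm_radon_cone y : radon_cone J y ->
  rnorm y = complex.Re (J y setT).
Proof.
move=> Ky; have b0 : borel (set0 : set Omega).
  by apply: sub_gen_smallest; exact: open0.
have Re0 E : borel E -> 0 <= complex.Re (J y E).
  by move=> /Ky; rewrite lecE /= => /andP[].
apply/le_anti/andP; split; last first.
  rewrite -lee_fin (radon_norm J_radon).
  pose F n : set Omega := if n is 0%N then setT else set0.
  apply: (@le_trans _ _ (\sum_(0 <= n <oo) (rnorm (J y (F n)))%:E)%E).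
    apply: le_trans (@nneseries_lim_ge _ _ xpredT _ 1 _); last first.
      by move=> n _ _; rewrite lee_fin rnorm_ge0.
    by rewrite big_nat1 lee_fin; exact: Re_le_rnorm.
  apply: ereal_sup_ubound; exists F => //; split.
  - by case=> [|n]; [exact: borelT | exact: b0].
  - apply/trivIsetP => -[|i] [|j]//= _ _ _; rewrite ?setI0 ?set0I//.
  - by apply/seteqP; split=> // t _; exists 0%N.
rewrite -lee_fin (radon_norm J_radon).
apply: ge_ereal_sup => _ [F [bF tF UF] <-].
apply: lime_le.
  by apply: is_cvg_nneseries => n _ _; rewrite lee_fin rnorm_ge0.
apply: nearW => m; rewrite sumEFin lee_fin big_mkord.
apply/ler_addgt0Pr => e e0.
have [/(_ F bF tF) cF _] := radon_radon J_radon y.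
rewrite UF in cF.
have [N hN] := (cvg_rnormP _ _).1 cF e e0.
have /= hm := hN (maxn N m) (leq_maxl _ _).
have -> : \sum_(i < m) rnorm (J y (F i)) = complex.Re (\sum_(i < m) J y (F i)).
  rewrite [RHS](raddf_sum (@complex.Re R : {additive _ -> _})).
  by apply: eq_bigr => i _; rewrite rnorm_ge0E//; exact/Ky.
apply: (@le_trans _ _ (complex.Re (\sum_(i < maxn N m) J y (F i)))).
  have -> : \sum_(i < maxn N m) J y (F i) =
      \sum_(i < m) J y (F i) + \sum_(m <= i < maxn N m) J y (F i).
    rewrite -(big_mkord xpredT (fun i => J y (F i))).
    rewrite -(big_mkord xpredT (fun i => J y (F i))).
    by rewrite (big_cat_nat _ (leq_maxr N m)).
  have : 0 <= \sum_(m <= i < maxn N m) J y (F i).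
    by apply: sumr_ge0 => i _; exact/Ky.
  move: (\sum_(_ < m) _) (\sum_(_ <= _ < _) _) => [a1 a2] [b1 b2].
  by rewrite lecE /= => /andP[_]; lra.
set S := \sum_(_ < _) _ in hm *.
have := Re_le_rnorm (S - J y setT); rewrite rnormBC.
by move: hm; move: S (J y setT) => [S1 S2] [T1 T2] /=; lra.
Qed.

Lemma superadditive_radon : superadditive_norm (radon_cone J).
Proof.
move=> y y' Ky Ky'.
have lin E : borel E -> J (y + y') E = J y E + J y' E.
  by move=> bE; rewrite -[y]scale1r (radon_linear J_radon)// scale1r mul1r.
have Kyy' : radon_cone J (y + y').
  by move=> E bE; rewrite lin// addr_ge0 ?Ky ?Ky'.
rewrite !rnorm_radon_cone// lin; last exact: borelT.
by case: (J y setT) (J y' setT) => [? ?] [? ?].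
Qed.

End RadonMeasures.

(** * Approximating contractions by positive elements *)

Section RootsOfUnity.
Context (R : realType).

Lemma prim_root_exists n : (0 < n)%N -> exists z : R[i], n.-primitive_root z.
Proof.
move=> n0; pose p : {poly R[i]} := 'X^n - 1.
have [r Dp] := closed_field_poly_normal p.
rewrite (monicP _) ?monicXnsubC// scale1r in Dp.
have rn1 : all n.-unity_root r.
  by apply/allP => z; rewrite -root_prod_XsubC -Dp.
have sz_r : (n < (size r).+1)%N.
  by rewrite -(size_prod_XsubC r id) -Dp size_XnsubC.
have [|z _ zP] := hasP (cyclic.has_prim_root n0 rn1 _ sz_r); last by exists z.
by rewrite -separable.separable_prod_XsubC -Dp cyclotomic.separable_Xn_sub_1//
  pnatr_eq0 -lt0n.
Qed.

Lemma rnorm_prim_root n (z : R[i]) : (0 < n)%N -> n.-primitive_root z ->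
  rnorm z = 1.
Proof.
move=> n0 /prim_expr_order zn; apply/eqP.
by rewrite -(pexpr_eq1 n0 (rnorm_ge0 _)) -rnormX zn /rnorm normr1.
Qed.

Lemma sum_prim_root n (z : R[i]) j k : n.-primitive_root z ->
  (j < n)%N -> (k < n)%N ->
  \sum_(m < n) ((z ^+ m)^* ^+ j * (z ^+ m) ^+ k) = (n * (j == k))%:R.
Proof.
move=> zP jn kn; have n0 : (0 < n)%N by exact: leq_ltn_trans jn.
have zz : z^* * z = 1 by rewrite mulrC -sqr_rnorm (rnorm_prim_root n0 zP)
  expr1n.
pose w := z^* ^+ j * z ^+ k.
have -> : \sum_(m < n) ((z ^+ m)^* ^+ j * (z ^+ m) ^+ k) = \sum_(m < n) w ^+ m.
  apply: eq_bigr => m _.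
  by rewrite /w rmorphXn exprMn -!exprM [(m * j)%N]mulnC [(m * k)%N]mulnC.
have [jk|jk] := eqVneq j k.
  have -> : w = 1 by rewrite /w jk -exprMn zz expr1n.
  under eq_bigr do rewrite expr1n.
  by rewrite sumr_const card_ord muln1.
have w1 : w != 1.
  apply: contra jk => /eqP w1.
  rewrite -[j](modn_small jn) -[k](modn_small kn) -(eq_prim_root_expr zP).
  apply/eqP; have zj : z^* ^+ j * z ^+ j = 1 by rewrite -exprMn zz expr1n.
  rewrite -[z ^+ j]mulr1 -w1 /w mulrA [_ * z^* ^+ j]mulrC zj mul1r.
  by [].
have wn : w ^+ n = 1.
  by rewrite /w exprMn -!exprM ![(_ * n)%N]mulnC !exprM -rmorphXn
    (prim_expr_order zP) rmorph1 !expr1n mulr1.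
rewrite muln0; apply: (mulfI (x := w - 1)); first by rewrite subr_eq0.
by rewrite -subrX1 wn subrr mulr0.
Qed.

End RootsOfUnity.

(** A discrete Herglotz representation. For the kernel c j k = (a^* )^j a^k the
    sum at z is S^* (1 - a^* a) S, where S = 1 + z a + .. + (z a)^(n-1).
    Averaging over the roots of unity z, with weight 1 or z^*, leaves one
    diagonal of the double sum, which telescopes. *)
Section Herglotz.
Context (R : realType) (V : lmodType R[i]).
Variable c : nat -> nat -> V.

Definition herglotz_sum n (z : R[i]) : V :=
  \sum_(j < n) \sum_(k < n) (z^* ^+ j * z ^+ k) *: (c j k - c j.+1 k.+1).

Lemma herglotz_average n (z : R[i]) (s : nat) : n.+1.-primitive_root z ->
  (s <= 1)%N ->
  \sum_(m < n.+1) ((z ^+ m)^* ^+ s / n.+1%:R) *: herglotz_sum n (z ^+ m) =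
  \sum_(j < n) \sum_(k < n | (j + s == k)%N) (c j k - c j.+1 k.+1).
Proof.
move=> zP s1; under eq_bigr do rewrite /herglotz_sum scaler_sumr.
rewrite exchange_big /=; apply: eq_bigr => j _.
under eq_bigr do rewrite scaler_sumr.
rewrite exchange_big [RHS]big_mkcond /=; apply: eq_bigr => k _.
under eq_bigr do rewrite scalerA.
rewrite -scaler_suml.
have -> : \sum_(m < n.+1) (z ^+ m)^* ^+ s / n.+1%:R *
    ((z ^+ m)^* ^+ j * (z ^+ m) ^+ k) = (j + s == k)%N%:R.
  under eq_bigr do rewrite mulrAC mulrA -exprD.
  rewrite -mulr_suml (sum_prim_root zP); last 2 first.
  - by rewrite ltnS; have := ltn_ord j; case: s s1 => [|[|]]//= _; lia.
  - by rewrite ltnS ltnW.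
  by rewrite natrM mulrAC mulfV ?mul1r ?pnatr_eq0// addnC.
by case: eqP; rewrite ?scale1r ?scale0r.
Qed.

Lemma herglotz_sum0 n (z : R[i]) : n.+1.-primitive_root z ->
  \sum_(m < n.+1) (n.+1%:R^-1) *: herglotz_sum n (z ^+ m) = c 0%N 0%N - c n n.
Proof.
move=> zP; have := herglotz_average zP (leq0n 1).
under eq_bigr do rewrite expr0 mul1r.
move=> ->; under eq_bigr => j _.
  rewrite (big_pred1 j); last by move=> k; rewrite addn0 eq_sym.
  over.
rewrite -(big_mkord xpredT (fun j => c j j - c j.+1 j.+1)).
rewrite -[LHS]opprK -sumrN; under eq_bigr do rewrite opprB.
by rewrite (telescope_sumr (fun j => c j j))// opprB.
Qed.

Lemma herglotz_sum1 n (z : R[i]) : n.+2.-primitive_root z ->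
  \sum_(m < n.+2) ((z ^+ m)^* / n.+2%:R) *: herglotz_sum n.+1 (z ^+ m) =
  c 0%N 1%N - c n n.+1.
Proof.
move=> zP; have := herglotz_average zP (leqnn 1).
under eq_bigr do rewrite expr1.
move=> ->; rewrite big_ord_recr /= [X in _ + X]big_pred0; last first.
  by move=> k; apply/eqP; have := ltn_ord k; rewrite /=; lia.
rewrite addr0; under eq_bigr => j _.
  rewrite (big_pred1 (lift ord0 j)); last first.
    move=> k; rewrite -[RHS]/(val k == bump 0 j).
    by rewrite /bump /= add1n addn1 eq_sym.
  over.
rewrite -(big_mkord xpredT (fun j => c j j.+1 - c j.+1 j.+2)).
rewrite -[LHS]opprK -sumrN; under eq_bigr do rewrite opprB.
by rewrite (telescope_sumr (fun j => c j j.+1))// opprB.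
Qed.

End Herglotz.

(** This is how a bound on the positive elements reaches the whole unit ball:
    it takes the place of the Russo-Dye theorem and of the spectral resolution
    of unitaries. *)
Definition approx_by_positives (R : realType) (V : normedModType R[i])
    (K : set V) (e : V) :=
  forall (a : V) (eps : R), rnorm a <= 1 -> 0 < eps ->
  exists (N : nat) (l : 'I_N -> R[i]) (p : 'I_N -> V),
    [/\ forall m, rnorm (l m) = 1, forall m, K (p m), K (e - \sum_m p m)
      & rnorm (a - \sum_m l m *: p m) <= eps].

Lemma pow_small (R : realType) (r eps : R) : 0 < r < 1 -> 0 < eps ->
  exists n, r ^+ n <= eps.
Proof.
move=> /andP[r0 r1] e0.
have /cvgrPdist_le /(_ _ e0) [N _ /(_ N (leqnn N)) /=] : (GRing.exp r @ \oo -->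
  0).
  by apply: cvg_expr; rewrite ger0_norm ?ltW.
by rewrite sub0r normrN normrX gtr0_norm// => h; exists N.
Qed.

Section HerglotzKernel.
Context (R : realType) (V : lmodType R[i]) (K : set V).
Hypothesis K_scale : forall (t : R) x, 0 <= t -> K x -> K (t%:C *: x).

Definition herglotz_kernel (c : nat -> nat -> V) (e a : V) :=
  [/\ c 0%N 0%N = e, c 0%N 1%N = a, forall n, K (c n n)
    & forall n z, rnorm z = 1 -> K (herglotz_sum c n z)].

Lemma herglotz_kernel_decomposition c e a n : herglotz_kernel c e a ->
  exists (N : nat) (l : 'I_N -> R[i]) (p : 'I_N -> V),
    [/\ forall m, rnorm (l m) = 1, forall m, K (p m), K (e - \sum_m p m)
      & a - \sum_m l m *: p m = c n n.+1].
Proof.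
move=> [ce ca cK hK]; have [z zP] := @prim_root_exists R n.+2 isT.
have nz m : rnorm (z ^+ m) = 1.
  by rewrite rnormX (rnorm_prim_root _ zP)// expr1n.
exists n.+2, (fun m : 'I_n.+2 => (z ^+ m)^*),
  (fun m : 'I_n.+2 => n.+2%:R^-1 *: herglotz_sum c n.+1 (z ^+ m)).
split=> [m|m||]; first by rewrite rnormJ nz.
- have -> : n.+2%:R^-1 = (n.+2%:R^-1)%:C :> R[i] by rewrite fmorphV rmorph_nat.
  by apply: K_scale => //; exact: hK.
- by rewrite herglotz_sum0// ce opprB addrC subrK.
under eq_bigr do rewrite scalerA.
by rewrite herglotz_sum1// ca opprB addrC subrK.
Qed.

End HerglotzKernel.

(** Contractions are first shrunk by a factor r < 1, so that the remainder of
    the decomposition decays geometrically. *)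
Lemma approx_of_kernels (R : realType) (V : normedModType R[i]) (K : set V)
    (e : V) :
  (forall (t : R) x, 0 <= t -> K x -> K (t%:C *: x)) ->
  (forall (a : V) (r : R), rnorm a <= 1 -> 0 < r < 1 ->
    exists2 c : nat -> nat -> V, herglotz_kernel K c e (r%:C *: a)
      & forall n, rnorm (c n n.+1) <= r ^+ n) ->
  approx_by_positives K e.
Proof.
move=> KZ kern a eps a1 e0.
pose d := Num.min (eps / 2) 2^-1.
have d0 : 0 < d by rewrite /d lt_min divr_gt0//=.
have d1 : d <= 2^-1 by rewrite /d ge_min lexx orbT.
have dE : d <= eps / 2 by rewrite /d ge_min lexx.
have r01 : 0 < 1 - d < 1 by apply/andP; split; lra.
have [n hn] := pow_small r01 (divr_gt0 e0 (ltr0Sn _ 1)).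
have [c ck hc] := kern a _ a1 r01.
have [N [l [p [l1 pK eK hp]]]] := herglotz_kernel_decomposition KZ n ck.
exists N, l, p; split=> //.
have -> : a - \sum_m l m *: p m = d%:C *: a + c n n.+1.
  by rewrite -hp rmorphB rmorph1 scalerBl scale1r addrA addrCA subrr addr0.
apply: le_trans (rnormD _ _) _; rewrite rnormZ rnormR ger0_norm ?(ltW d0)//.
have : d * rnorm a <= d by rewrite ler_piMr// ltW.
by have := le_trans (hc n) hn; lra.
Qed.

Section Operators.
Context (R : realType) (E F : normedModType R[i]).
Variables (KE : set E) (e : E) (KF : set F).
Hypothesis KE0 : KE 0.
Hypothesis KED : forall x y, KE x -> KE y -> KE (x + y).
Hypothesis KE_approx : approx_by_positives KE e.
Hypothesis KF_mean : mean_inequality KF.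
Hypothesis KF_super : superadditive_norm KF.

(** The pieces p m and the rest of e add up to e. *)
Lemma superadditive_operator (T : E -> F) N (p : 'I_N -> E) : bounded_op T ->
  (forall x, KE x -> KF (T x)) -> (forall m, KE (p m)) ->
  KE (e - \sum_m p m) -> \sum_m rnorm (T (p m)) <= rnorm (T e).
Proof.
move=> [lin _] TK pK eK.
have TD x y : T (x + y) = T x + T y by rewrite -[x]scale1r lin !scale1r.
have [Kp le_p] : KE (\sum_m p m) /\
    \sum_m rnorm (T (p m)) <= rnorm (T (\sum_m p m)).
  elim/big_rec2: _ => [|m y x _ [Ky xy]]; first by split=> //; exact: rnorm_ge0.
  split; first exact: KED.
  rewrite TD; apply: le_trans (KF_super (TK _ (pK m)) (TK _ Ky)).
  by rewrite lerD2l.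
apply: le_trans le_p _.
have := KF_super (TK _ eK) (TK _ Kp); rewrite -TD subrK.
by have := rnorm_ge0 (T (e - \sum_m p m)); lra.
Qed.

(** On the positive pieces p m of a contraction the inequality is that of F, and
    the right-hand sides add up to at most their value at e. *)
Lemma mean_operators (T11 T12 T21 T22 : E -> F) :
  bounded_op T11 -> bounded_op T12 -> bounded_op T22 ->
  (forall x, KE x -> psd KF (T11 x) (T12 x) (T21 x) (T22 x)) ->
  forall a, rnorm a <= 1 -> rnorm (T12 a) <= (rnorm (T11 e) + rnorm (T22 e)) /
    2.
Proof.
move=> b11 [lin [k hk]] b22 P a a1.
apply/ler_addgt0Pr => eps eps0.
pose k' := `|k| + 1.
have k'0 : 0 < k' by rewrite /k' ltr_wpDl.
have [N [l [p [l1 pK eK hp]]]] := KE_approx a1 (divr_gt0 eps0 k'0).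
have TD x y : T12 (x + y) = T12 x + T12 y by rewrite -[x]scale1r lin !scale1r.
have T0 : T12 0 = 0 by have := lin (-1) 0 0; rewrite scaler0 addr0 scaleN1r
  addNr.
have TZ c x : T12 (c *: x) = c *: T12 x by rewrite -[c *: x]addr0 lin T0 addr0.
have -> : T12 a = \sum_m l m *: T12 (p m) + T12 (a - \sum_m l m *: p m).
  rewrite -[in LHS](subrK (\sum_m l m *: p m) a) TD addrC; congr (_ + _).
  elim/big_rec2: _ => [//|m y x _ <-]; by rewrite TD TZ.
apply: le_trans (rnormD _ _) _; apply: lerD; last first.
  apply: le_trans (hk _) _.
  apply: (@le_trans _ _ (k' * rnorm (a - \sum_m l m *: p m))).
    rewrite ler_wpM2r ?rnorm_ge0//.
    by apply: le_trans (ler_norm _) _; rewrite /k' lerDl.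
  by rewrite -ler_pdivlMl// mulrC.
apply: le_trans (rnorm_sum _) _.
have h11 := superadditive_operator b11 (fun x Kx => (psd_diag (P x Kx)).1) pK
  eK.
have h22 := superadditive_operator b22 (fun x Kx => (psd_diag (P x Kx)).2) pK
  eK.
apply: (@le_trans _ _ ((\sum_m rnorm (T11 (p m)) + \sum_m rnorm (T22 (p m))) /
  2)).
  rewrite -big_split mulr_suml; apply: ler_sum => m _ /=.
  apply: le_trans (KF_mean (P _ (pK m))).
  by rewrite rnormZ l1 mul1r.
by rewrite ler_pM2r ?invr_gt0// lerD.
Qed.

Lemma rnorm_le_opnorm (T : E -> F) x : bounded_op T -> rnorm x <= 1 ->
  rnorm (T x) <= opnorm T.
Proof.
move=> [_ [k hk]] x1; apply: ub_le_sup; last by exists x.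
exists `|k| => _ [y /= y1 <-]; apply: le_trans (hk y) _.
apply: (@le_trans _ _ (`|k| * rnorm y)); first by rewrite ler_wpM2r ?rnorm_ge0
  ?ler_norm.
by rewrite ler_piMr.
Qed.

Lemma opnorm_le (T : E -> F) (M : R) :
  (forall x, rnorm x <= 1 -> rnorm (T x) <= M) -> opnorm T <= M.
Proof.
move=> h; apply: ge_sup => [|_ [x x1 <-]]; last exact: h.
by exists (rnorm (T 0)), 0 => //=; rewrite rnorm0.
Qed.

Hypothesis e1 : rnorm e <= 1.

Lemma mean_inequality_B (V : normedModType R[i]) (J : V -> E -> F) :
  is_B J -> mean_inequality (B_cone KE KF J).
Proof.
move=> JB y11 y12 y21 y22 P; rewrite (B_norm JB).
apply: opnorm_le => x x1.
have b v := B_bounded JB v.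
apply: le_trans (mean_operators (T21 := J y21) (b y11) (b y12) (b y22) _ x1) _.
  move=> q Kq; apply: (psd_map (f := fun v => J v q) _ _ P).
    by move=> a v w; rewrite (B_linear JB).
  by move=> v; apply.
rewrite ler_pM2r ?invr_gt0// lerD// (B_norm JB);
  exact: rnorm_le_opnorm.
Qed.

End Operators.

(** * Functionals, and spaces of continuous functions *)

Lemma superadditive_scalar (R : realType) :
  superadditive_norm [set z : R[i]^o | 0 <= z].
Proof.
move=> z w /= z0 w0; have zw0 : 0 <= z + w by rewrite addr_ge0.
rewrite (rnorm_ge0E z0) (rnorm_ge0E w0) (rnorm_ge0E zw0).
by case: z w {z0 w0 zw0} => [? ?] [? ?].
Qed.

Section ContinuousFunctions.
Context (R : realType) (Omega : topologicalType).
Variables (E : normedModType R[i]) (JE : E -> Omega -> R[i]).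
Hypothesis JE_C : is_C JE.

Lemma C_sum (I : finType) (F : I -> E) t :
  JE (\sum_i F i) t = \sum_i JE (F i) t.
Proof.
have J0 : JE 0 t = 0.
  by have := C_linear JE_C (-1) 0 0; rewrite scaler0 addr0 => ->; rewrite
    mulN1r addNr.
elim/big_rec2: _ => [//|i x y _ <-].
by have := C_linear JE_C 1 (F i) y; rewrite scale1r => ->; rewrite mul1r.
Qed.

Lemma C_scale a (f : E) t : JE (a *: f) t = a * JE f t.
Proof.
have J0 : JE 0 t = 0.
  by have := C_linear JE_C (-1) 0 0; rewrite scaler0 addr0 => ->; rewrite
    mulN1r addNr.
by rewrite -[a *: f]addr0 (C_linear JE_C) J0 addr0.
Qed.

Lemma C_sub (f g : E) t : JE (f - g) t = JE f t - JE g t.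
Proof.
have := C_linear JE_C (-1) g f; rewrite scaleN1r addrC => ->.
by rewrite mulN1r addrC.
Qed.

Lemma rnorm_C_ge (f : E) t : rnorm (JE f t) <= rnorm f.
Proof.
rewrite (C_norm JE_C); apply: ub_le_sup; last by exists t.
have [_ [k hk]] := C_continuous JE_C f.
by exists k => _ [s _ <-]; exact: hk.
Qed.

Lemma rnorm_C_le (f : E) M : 0 <= M -> (forall t, rnorm (JE f t) <= M) ->
  rnorm f <= M.
Proof.
move=> M0 h; rewrite (C_norm JE_C).
have [->|/set0P S0] := eqVneq [set rnorm (JE f t) | t in [set: Omega]] set0.
  by rewrite sup0.
by apply: ge_sup => // _ [t _ <-].
Qed.

Lemma C_injective (f g : E) : JE f = JE g -> f = g.
Proof.
move=> fg; apply/eqP; rewrite -subr_eq0; apply/eqP/rnorm0_eq0/le_anti.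
rewrite rnorm_ge0 andbT; apply: rnorm_C_le => // t.
by rewrite C_sub fg subrr rnorm0.
Qed.

End ContinuousFunctions.

Section Functionals.
Context (R : realType) (E : normedModType R[i]).
Variables (KE : set E) (e : E).
Hypothesis KE0 : KE 0.
Hypothesis KED : forall x y, KE x -> KE y -> KE (x + y).
Hypothesis KE_approx : approx_by_positives KE e.

(** Pointwise, a map into C(Omega) is a family of functionals. *)
Lemma mean_inequality_B_C (Omega : topologicalType) (F : normedModType R[i])
    (JF : F -> Omega -> R[i]) (V : normedModType R[i]) (J : V -> E -> F) :
  rnorm e <= 1 -> is_C JF -> is_B J ->
  mean_inequality (B_cone KE (C_cone JF) J).
Proof.
move=> e1 CF JB y11 y12 y21 y22 P.
rewrite (B_norm JB); apply: opnorm_le => x x1.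
apply: (rnorm_C_le CF) => [|t]; first by rewrite divr_ge0// addr_ge0//
  rnorm_ge0.
pose T v : E -> R[i]^o := fun x => JF (J v x) t.
have bT v : bounded_op (T v).
  have [lin [k hk]] := B_bounded JB v; split=> [a z w|].
    by rewrite /T lin (C_linear CF).
  by exists k => z; apply: le_trans (rnorm_C_ge CF _ _) (hk z).
have PT q : KE q -> psd [set z : R[i]^o | 0 <= z]
    (T y11 q) (T y12 q) (T y21 q) (T y22 q).
  move=> Kq; apply: (psd_map (W := R[i]^o) (f := fun v => T v q) _ _ P).
    by move=> a v w; rewrite /T (B_linear JB) (C_linear CF).
  by move=> v /(_ q Kq); exact.
have := mean_operators KE0 KED KE_approx (@mean_inequality_scalar R)
  (@superadditive_scalar R) (bT y11) (bT y12) (bT y22) PT x1.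
move=> h; apply: le_trans h _; rewrite ler_pM2r ?invr_gt0//.
apply: lerD; apply: le_trans (rnorm_C_ge CF _ _) _; rewrite (B_norm JB);
  apply: rnorm_le_opnorm => //; exact: B_bounded.
Qed.

(** The upper bound is the mean inequality for a quadruple with four equal
    entries. *)
Lemma rnorm_positive_functional (V : normedModType R[i]) (J : V -> E -> R[i]^o)
    y : rnorm e <= 1 -> KE e -> is_B J ->
  B_cone KE [set z : R[i]^o | 0 <= z] J y -> rnorm y = complex.Re (J y e).
Proof.
move=> e1 Ke JB Ky; rewrite (B_norm JB); apply/le_anti/andP; split.
  apply: opnorm_le => x x1; have b := B_bounded JB y.
  have P q : KE q -> psd [set z : R[i]^o | 0 <= z]
      (J y q) (J y q) (J y q) (J y q).
    move=> /Ky /= J0 al be; rewrite -!scalerDl /=.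
    have -> : al * al^* + al * be^* + al^* * be + be * be^* =
        (al + be) * (al + be)^* by rewrite rmorphD /=; ring.
    by rewrite mulr_ge0// mul_conjC_ge0.
  have := mean_operators KE0 KED KE_approx (@mean_inequality_scalar R)
    (@superadditive_scalar R) b b b P x1.
  by rewrite (rnorm_ge0E (Ky _ Ke)); move: (complex.Re _) => r; lra.
exact: le_trans (Re_le_rnorm _) (rnorm_le_opnorm (B_bounded JB y) e1).
Qed.

Lemma superadditive_functional (V : normedModType R[i])
    (J : V -> E -> R[i]^o) : rnorm e <= 1 -> KE e -> is_B J ->
  superadditive_norm (B_cone KE [set z : R[i]^o | 0 <= z] J).
Proof.
move=> e1 Ke JB y y' Ky Ky'.
have JD x : J (y + y') x = J y x + J y' x.
  by rewrite -[y]scale1r (B_linear JB) !scale1r.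
have Kyy' : B_cone KE [set z : R[i]^o | 0 <= z] J (y + y').
  by move=> x Kx /=; rewrite JD addr_ge0 ?Ky ?Ky'.
rewrite !(rnorm_positive_functional e1 Ke JB)// JD.
by case: (J y e) (J y' e) => [? ?] [? ?].
Qed.

End Functionals.


Section ContinuousFunctionKernel.
Context (R : realType) (Omega : topologicalType).
Variables (E : normedModType R[i]) (JE : E -> Omega -> R[i]).
Hypothesis JE_C : is_C JE.

Lemma bounded_continuousM (f g : Omega -> R[i]) :
  bounded_continuous f -> bounded_continuous g ->
  bounded_continuous (fun t => f t * g t).
Proof.
move=> [cf [k hk]] [cg [l hl]]; split.
  by move=> t; apply: (@cvgM R[i] Omega); [exact: cf | exact: cg].
exists (k * l) => t; rewrite rnormM.
by apply: ler_pM; rewrite ?rnorm_ge0.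
Qed.

Lemma bounded_continuous_cst (a : R[i]) :
  bounded_continuous (fun _ : Omega => a).
Proof. by split; [move=> t; exact: cvg_cst | exists (rnorm a)]. Qed.

Lemma bounded_continuousX (f : Omega -> R[i]) n :
  bounded_continuous f -> bounded_continuous (fun t => f t ^+ n).
Proof.
move=> bf; elim: n => [|n IH].
  have -> : (fun t => f t ^+ 0) = (fun=> 1).
    by apply/funext => t; rewrite expr0.
  exact: bounded_continuous_cst.
have -> : (fun t => f t ^+ n.+1) = (fun t => f t * f t ^+ n).
  by apply/funext => t; rewrite exprS.
exact: bounded_continuousM.
Qed.

Lemma bounded_continuousJ (f : Omega -> R[i]) :
  bounded_continuous f -> bounded_continuous (fun t => (f t)^*).
Proof.
move=> [cf [k hk]]; split; last by exists k => t; rewrite rnormJ.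
move=> t; apply/cvgrPdist_lt => eps eps0.
have /cvgrPdist_lt /(_ _ eps0) := cf t; apply: filterS => s.
by rewrite -(norm_conjC (f t - f s)) rmorphB.
Qed.

Lemma C_unit : exists2 e : E, JE e = (fun=> 1) & C_cone JE e.
Proof.
have [e he] := C_onto JE_C (bounded_continuous_cst 1).
by exists e => // t; rewrite he ler01.
Qed.

Lemma approx_C (e : E) : JE e = (fun=> 1) ->
  approx_by_positives (C_cone JE) e.
Proof.
move=> he; apply: approx_of_kernels => [x f x0 Kf t|a r a1 /andP[r0 r1]].
  by rewrite (C_scale JE_C) mulr_ge0// lecR.
pose h t := r%:C * JE a t.
have hr t : rnorm (h t) <= r.
  rewrite /h rnormM rnormR ger0_norm ?(ltW r0)// ler_piMr ?(ltW r0)//.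
  exact: le_trans (rnorm_C_ge JE_C _ _) a1.
have bh : bounded_continuous h.
  apply: bounded_continuousM; first exact: bounded_continuous_cst.
  exact: C_continuous JE_C a.
have bc j k : bounded_continuous (fun t => (h t)^* ^+ j * h t ^+ k).
  apply: bounded_continuousM; last exact: bounded_continuousX.
  by apply: bounded_continuousX; exact: bounded_continuousJ.
pose c j k := projT1 (cid (C_onto JE_C (bc j k))).
have cE j k t : JE (c j k) t = (h t)^* ^+ j * h t ^+ k.
  by rewrite /c; case: cid => f /= ->.
have hh0 t : 0 <= (h t)^* * h t by rewrite mulrC mul_conjC_ge0.
exists c; last first.
  move=> n; apply: (rnorm_C_le JE_C) => [|t]; first by rewrite exprn_ge0 ?ltW.
  rewrite cE rnormM !rnormX rnormJ -exprD.
  apply: (@le_trans _ _ (r ^+ (n + n.+1))).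
    by apply: lerXn2r; rewrite ?nnegrE ?rnorm_ge0 ?(ltW r0).
  by apply: ler_wiXn2l; rewrite ?(ltW r0) ?(ltW r1) ?leq_addr.
split=> [|||].
- by apply: (C_injective JE_C); apply/funext => t; rewrite cE he expr0 mul1r.
- apply: (C_injective JE_C); apply/funext => t.
  by rewrite cE expr0 mul1r expr1 (C_scale JE_C).
- by move=> n t; rewrite cE -exprMn exprn_ge0.
move=> n z z1 t; rewrite /herglotz_sum (C_sum JE_C).
pose S := \sum_(k < n) (z * h t) ^+ k.
rewrite [X in 0 <= X](_ : _ = (1 - (h t)^* * h t) * (S^* * S)).
  rewrite mulr_ge0//; last by rewrite mulrC mul_conjC_ge0.
  have -> : (h t)^* * h t = (rnorm (h t) ^+ 2)%:C by rewrite sqr_rnorm mulrC.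
  rewrite -[1]/(1%:C) -rmorphB /= lecR subr_ge0 expr_le1//.
  - exact: le_trans (hr t) (ltW r1).
  - exact: rnorm_ge0.
rewrite /S rmorph_sum /= mulrA [(1 - _) * \sum_(_ < _) _]mulr_sumr mulr_suml.
apply: eq_bigr => j _.
rewrite (C_sum JE_C) mulr_sumr; apply: eq_bigr => k _.
rewrite (C_scale JE_C) (C_sub JE_C) !cE; move: (h t) => x.
by rewrite rmorphXn rmorphM !exprMn !exprS; ring.
Qed.

End ContinuousFunctionKernel.

(** * Hilbert spaces: Riesz representation and orthogonal projection *)

Lemma complete_seq (R : realType) (V : completeNormedModType R[i])
    (u : nat -> V) :
  (forall e : R, 0 < e -> exists N, forall n m, (N <= n)%N -> (N <= m)%N ->
    rnorm (u n - u m) < e) ->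
  exists l : V, u @ \oo --> l.
Proof.
move=> h; suff /cvg_ex[l ul] : [cvg (u @ \oo) in V] by exists l.
apply: cauchy_cvg; apply: cauchy_exP => e e0.
have eR : e = (complex.Re e)%:C by rewrite RRe_real// gtr0_real.
have [N hN] := h (complex.Re e) ltac:(by rewrite -ltcR -eR).
exists (u N); exists N => // n /= Nn; rewrite -ball_normE /= eR normE ltcR.
exact: hN.
Qed.

Lemma cvg_bounded_op (R : realType) (E F : normedModType R[i]) (T : E -> F)
    (u : nat -> E) (l : E) :
  bounded_op T -> u @ \oo --> l -> T \o u @ \oo --> T l.
Proof.
move=> [lin [k hk]] /cvg_rnormP ul; apply/cvg_rnormP => e e0.
have k0 : 0 < `|k| + 1 by rewrite ltr_wpDl.
have [N hN] := ul _ (divr_gt0 e0 k0); exists N => n /hN un /=.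
have -> : T l - T (u n) = T (l - u n).
  by have := lin (-1) (u n) l; rewrite !scaleN1r !(addrC (- _)) => ->.
apply: le_lt_trans (hk _) _; rewrite ltr_pdivlMr// mulrC in un.
apply: le_lt_trans un; rewrite ler_wpM2r ?rnorm_ge0//.
by apply: le_trans (ler_norm k) _; rewrite lerDl.
Qed.

Section InnerProduct.
Context (R : realType) (H : hilbertSpace R).
Implicit Types x y z : H.

Lemma innerDl x y z : inner (x + y) z = inner x z + inner y z.
Proof. by rewrite -[x]scale1r inner_linear mul1r scale1r. Qed.

Lemma inner0l z : inner 0 z = 0 :> R[i].
Proof. by apply: (addrI (inner 0 z)); rewrite -innerDl !addr0. Qed.

Lemma innerZl a x z : inner (a *: x) z = a * inner x z.
Proof. by rewrite -[a *: x]addr0 inner_linear inner0l addr0. Qed.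

Lemma innerNl x z : inner (- x) z = - inner x z.
Proof. by rewrite -scaleN1r innerZl mulN1r. Qed.

Lemma innerBl x y z : inner (x - y) z = inner x z - inner y z.
Proof. by rewrite innerDl innerNl. Qed.

Lemma innerJ x y : (inner x y)^* = inner y x.
Proof. by rewrite [RHS]inner_conj. Qed.

Lemma innerDr x y z : inner z (x + y) = inner z x + inner z y.
Proof. by rewrite -innerJ innerDl rmorphD /= !innerJ. Qed.

Lemma inner0r z : inner z 0 = 0 :> R[i].
Proof. by rewrite -innerJ inner0l rmorph0. Qed.

Lemma innerZr a x z : inner z (a *: x) = a^* * inner z x.
Proof. by rewrite -innerJ innerZl rmorphM /= innerJ. Qed.

Lemma innerNr x z : inner z (- x) = - inner z x.
Proof. by rewrite -innerJ innerNl rmorphN /= innerJ. Qed.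

Lemma innerBr x y z : inner z (x - y) = inner z x - inner z y.
Proof. by rewrite innerDr innerNr. Qed.

Lemma innerxx x : inner x x = (rnorm x ^+ 2)%:C.
Proof. by rewrite inner_norm normE rmorphXn. Qed.

Lemma Re_innerxx x : complex.Re (inner x x) = rnorm x ^+ 2.
Proof. by rewrite innerxx. Qed.

Lemma inner_ge0 x : 0 <= inner x x.
Proof. by rewrite innerxx lecR sqr_ge0. Qed.

Lemma Re_innerC x y : complex.Re (inner y x) = complex.Re (inner x y).
Proof. by rewrite -innerJ; case: (inner x y). Qed.

Lemma rnormD_sqr x y : rnorm (x + y) ^+ 2 =
  rnorm x ^+ 2 + 2 * complex.Re (inner x y) + rnorm y ^+ 2.
Proof.
rewrite -!Re_innerxx innerDl !innerDr !raddfD /= (Re_innerC x y); ring.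
Qed.

Lemma rnormB_sqr x y : rnorm (x - y) ^+ 2 =
  rnorm x ^+ 2 - 2 * complex.Re (inner x y) + rnorm y ^+ 2.
Proof. by rewrite rnormD_sqr innerNr rnormN raddfN /= mulrN. Qed.

Lemma inner_cs x y : rnorm (inner x y) <= rnorm x * rnorm y.
Proof.
rewrite -[rnorm x]ger0_norm ?rnorm_ge0// -[rnorm y]ger0_norm ?rnorm_ge0//.
rewrite -!sqrtr_sqr; apply: le_sqrt_of_scaled_mean; rewrite ?sqr_ge0// => s s0.
have P : psd [set z : R[i]^o | 0 <= z] (inner x x) (inner x y) (inner y x)
  (inner y y).
  move=> al be /=; have := inner_ge0 (al *: x + be *: y).
  rewrite innerDl !innerDr !innerZl !innerZr !mulrA [be * al^*]mulrC.
  by rewrite !addrA.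
have := mean_inequality_scalar (psd_scale s0 P).
rewrite !rnormZ !rnormR !innerxx !rnormR !ger0_norm ?invr_ge0 ?exprn_ge0 ?(ltW
  s0) ?rnorm_ge0//.
Qed.

Lemma inner_ext x y : (forall z, inner z x = inner z y) -> x = y.
Proof.
move=> h; apply/eqP; rewrite -subr_eq0; apply/eqP/rnorm0_eq0.
have := Re_innerxx (x - y); rewrite innerBr h subrr /= => /esym/eqP.
by rewrite sqrf_eq0 => /eqP.
Qed.

Lemma bounded_op_inner y : bounded_op (fun x => inner x y : R[i]^o).
Proof.
split=> [a x z|]; first by rewrite inner_linear.
by exists (rnorm y) => x; rewrite mulrC; exact: inner_cs.
Qed.

(** By the parallelogram law, a minimizing sequence of |x|^2 - 2 Re f(x) on the
    subspace S is Cauchy; its limit z represents f on S because the first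
    variation vanishes there. With S = H this is the Riesz representation, and
    with f = <., x0> the point z is the projection of x0 on the closure of
    S. *)
Lemma riesz_subspace (S : set H) (f : H -> R[i]) (k : R) :
  S 0 -> (forall a x y, S x -> S y -> S (a *: x + y)) ->
  (forall a x y, f (a *: x + y) = a * f x + f y) ->
  (forall x, rnorm (f x) <= k * rnorm x) ->
  exists z, (forall e : R, 0 < e -> exists2 s, S s & rnorm (z - s) < e) /\
    forall s, S s -> f s = inner s z.
Proof.
move=> S0 Slin flin fk.
have f0 : f 0 = 0 by have := flin (-1) 0 0; rewrite scaler0 addr0 mulN1r addNr.
have fD x y : f (x + y) = f x + f y by rewrite -[x]scale1r flin mul1r scale1r.
have fZ a x : f (a *: x) = a * f x by rewrite -[a *: x]addr0 flin f0 addr0.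
have SZ a x : S x -> S (a *: x) by move=> Sx; rewrite -[a *: x]addr0; exact:
  Slin.
have SD x y : S x -> S y -> S (x + y).
  by move=> Sx Sy; rewrite -[x]scale1r; exact: Slin.
pose Q x := rnorm x ^+ 2 - 2 * complex.Re (f x).
pose A := [set Q s | s in S].
have lbA : lbound A (- k ^+ 2).
  move=> _ [s _ <-]; rewrite /Q; have := le_trans (Re_le_rnorm (f s)) (fk s).
  by have := sqr_ge0 (rnorm s - k); nra.
have iA : has_inf A by split; [exists (Q 0), 0 | exists (- k ^+ 2)].
pose m := inf A.
have mQ s : S s -> m <= Q s by move=> Ss; apply: ge_inf; [case: iA | exists s].
have pick n : exists s, S s /\ Q s < m + n.+1%:R^-1.
  have n0 : 0 < n.+1%:R^-1 :> R by rewrite invr_gt0.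
  by have [_ [s Ss <-] hs] := inf_adherent n0 iA; exists s.
pose u n := projT1 (cid (pick n)).
have uS n : S (u n) by rewrite /u; case: cid => s [].
have uQ n : Q (u n) < m + n.+1%:R^-1 by rewrite /u; case: cid => s [].
have small (e : R) : 0 < e -> exists N, forall n, (N <= n)%N -> n.+1%:R^-1 < e.
  move=> e0; have /cvgrPdist_lt /(_ _ e0) [N _ hN] := @cvg_harmonic R.
  by exists N => n /hN /=; rewrite sub0r normrN ger0_norm.
have [z uz] : exists z : H, u @ \oo --> z.
  apply: complete_seq => e e0.
  have [N hN] := small (e ^+ 2 / 4) (divr_gt0 (exprn_gt0 2 e0) (ltr0Sn _ 3)).
  exists N => n l /hN hn /hN hl.
  have par : rnorm (u n - u l) ^+ 2 =
      2 * Q (u n) + 2 * Q (u l) - 4 * Q ((2^-1)%:C *: (u n + u l)).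
    rewrite /Q fZ fD rnormZ rnormR ger0_norm// exprMn rnormB_sqr rnormD_sqr.
    have -> : complex.Re ((2^-1)%:C * (f (u n) + f (u l))) =
        2^-1 * (complex.Re (f (u n)) + complex.Re (f (u l))).
      by case: (f (u n)) (f (u l)) => [? ?] [? ?] /=; ring.
    by field.
  rewrite -ltr_sqr ?nnegrE ?rnorm_ge0 ?(ltW e0)// par.
  have := mQ _ (SZ (2^-1)%:C _ (SD _ _ (uS n) (uS l))).
  have := uQ n; have := uQ l; move: hn hl; clear.
  by move: (n.+1%:R^-1) (l.+1%:R^-1) (Q _) (Q _) (Q _) => *; lra.
exists z; split=> [e e0|w Sw].
  by have [N /(_ N (leqnn N)) hN] := (cvg_rnormP _ _).1 uz e e0; exists (u N).
pose d := inner w z - f w.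
(* The variation of the functional in the direction c w, at the limit z. *)
have var c : 0 <= rnorm (c *: w) ^+ 2 + 2 * complex.Re (c * d).
  apply/ler_addgt0Pr => e e0.
  pose K := 1 + 2 * rnorm (c *: w).
  have K0 : 0 < K by rewrite /K ltr_pwDl// mulr_ge0 ?rnorm_ge0.
  have [N1 hN1] := small _ (divr_gt0 e0 K0).
  have [N2 hN2] := (cvg_rnormP _ _).1 uz _ (divr_gt0 e0 K0).
  pose n := maxn N1 N2.
  have hn1 := hN1 n (leq_maxl _ _); have hn2 := hN2 n (leq_maxr _ _).
  have := mQ _ (SD _ _ (uS n) (SZ c _ Sw)); have := uQ n.
  rewrite /Q fD rnormD_sqr raddfD /= fZ.
  have := inner_cs (c *: w) (u n - z); rewrite (rnormBC (u n)).
  have := Re_le_rnorm (inner (c *: w) (u n - z)).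
  have -> : complex.Re (inner (c *: w) (u n - z)) =
      complex.Re (inner (u n) (c *: w)) - complex.Re (inner (c *: w) z).
    by rewrite innerBr raddfB /= (Re_innerC (u n) (c *: w)).
  have -> : complex.Re (c * d) = complex.Re (inner (c *: w) z) - complex.Re (c
    * f w).
    by rewrite /d mulrBr raddfB /= innerZl.
  have hK : e / K + 2 * (rnorm (c *: w) * (e / K)) = e.
    by rewrite /K; field; rewrite gt_eqF.
  have := ler_wpM2l (rnorm_ge0 (c *: w)) (ltW hn2).
  move: hn1 hK (rnorm (inner _ _)).
  by move: (n.+1%:R^-1) (rnorm (z - u n)) (complex.Re _) (complex.Re _) => *;
    lra.
apply/eqP; rewrite eq_sym -subr_eq0 -/d; apply/eqP/rnorm0_eq0.
(* In the direction - t d^* w the linear term dominates for small t. *)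
pose t := (rnorm w ^+ 2 + 1)^-1.
have t0 : 0 < t by rewrite invr_gt0 ltr_wpDl// sqr_ge0.
have := var (- t%:C * d^*).
have -> : - t%:C * d^* * d = - (t * rnorm d ^+ 2)%:C.
  by rewrite rmorphM /= sqr_rnorm !mulNr -mulrA [d^* * d]mulrC.
rewrite rnormZ rnormM rnormN rnormR rnormJ ger0_norm ?(ltW t0)// raddfN /=.
have tw : t * rnorm w ^+ 2 <= 1.
  by rewrite mulrC ler_pdivrMr ?mul1r ?lerDl// ltr_wpDl// sqr_ge0.
have := rnorm_ge0 d; move: (rnorm d) (rnorm w) tw => D W tw D0.
rewrite !exprMn => h; apply/eqP; rewrite -sqrf_eq0 eq_le sqr_ge0 andbT leNgt.
apply/negP => Dpos; have tD : 0 < t * D ^+ 2 by rewrite mulr_gt0.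
have : 0 <= (t * D ^+ 2) * (t * W ^+ 2 - 2).
  by apply: le_trans h _; rewrite le_eqVlt; apply/orP; left; apply/eqP; ring.
by rewrite pmulr_rge0// subr_ge0 => /le_trans/(_ tw); rewrite (ler_nat _ 2 1).
Qed.

End InnerProduct.

(** * The algebra of bounded operators *)

Section BoundedOperators.
Context (R : realType) (H : hilbertSpace R).

Definition bounded_pred : {pred H -> H} :=
  [pred T : H -> H | `[< bounded_op T >]].

Lemma bounded_submod : submod_closed bounded_pred.
Proof.
split=> [|a S T /asboolP[linS [k hk]] /asboolP[linT [l hl]]]; apply/asboolP.
  split=> [b x y|]; first by rewrite scaler0 addr0.
  by exists 0 => x; rewrite mul0r rnorm0.
split=> [b x y|].
  rewrite /= !fctE linS linT !scalerDr !scalerA [a * b]mulrC.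
  by rewrite !addrA; congr (_ + _); rewrite addrAC.
exists (rnorm a * k + l) => x; rewrite !fctE; apply: le_trans (rnormD _ _) _.
by rewrite rnormZ mulrDl lerD// -mulrA ler_wpM2l// rnorm_ge0.
Qed.

HB.instance Definition _ := GRing.isSubmodClosed.Build R[i] (H -> H)
  bounded_pred bounded_submod.

(** The space H may be zero, so the operators form a ring in which 0 = 1 is
    allowed. *)
Record bop := Bop { bop_fun :> H -> H; bop_bounded : bop_fun \in bounded_pred }.

HB.instance Definition _ := [isSub for bop_fun].
HB.instance Definition _ := [Choice of bop by <:].
HB.instance Definition _ := [SubChoice_isSubLmodule of bop by <:].

Lemma bopP (A : bop) : bounded_op A.
Proof. by case: A => A /= /asboolP. Qed.

Lemma bop_ext (A B : bop) : (forall x, A x = B x) -> A = B.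
Proof. by move=> AB; apply/val_inj/funext. Qed.

Definition mkbop (T : H -> H) (bT : bounded_op T) : bop := Bop (asboolT bT).

Lemma bopDr (A : bop) x y : A (x + y) = A x + A y.
Proof. by have [lin _] := bopP A; rewrite -[x]scale1r lin !scale1r. Qed.

Lemma bop0r (A : bop) : A 0 = 0.
Proof. by apply: (addrI (A 0)); rewrite -bopDr !addr0. Qed.

Lemma bopZr (A : bop) a x : A (a *: x) = a *: A x.
Proof. by have [lin _] := bopP A; rewrite -[a *: x]addr0 lin bop0r addr0. Qed.

Lemma bounded_id : bounded_op (@id H).
Proof. by split=> //; exists 1 => x; rewrite mul1r. Qed.

Lemma bounded_comp (S T : H -> H) : bounded_op S -> bounded_op T ->
  bounded_op (S \o T).
Proof.
move=> [linS [k hk]] [linT [l hl]]; split=> [a x y|]; first by rewrite /= linT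
  linS.
exists (`|k| * `|l|) => x /=; apply: le_trans (hk _) _.
apply: (@le_trans _ _ (`|k| * rnorm (T x))).
  by rewrite ler_wpM2r ?rnorm_ge0 ?ler_norm.
rewrite -mulrA ler_wpM2l//; apply: le_trans (hl x) _.
by rewrite ler_wpM2r ?rnorm_ge0 ?ler_norm.
Qed.

Definition bop_one : bop := mkbop bounded_id.
Definition bop_mul (A B : bop) : bop := mkbop (bounded_comp (bopP A) (bopP B)).

Fact bop_mulA : associative bop_mul.
Proof. by move=> A B C; apply: bop_ext. Qed.
Fact bop_mul1l : left_id bop_one bop_mul.
Proof. by move=> A; apply: bop_ext. Qed.
Fact bop_mul1r : right_id bop_one bop_mul.
Proof. by move=> A; apply: bop_ext. Qed.
Fact bop_mulDl : left_distributive bop_mul +%R.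
Proof. by move=> A B C; apply: bop_ext. Qed.
Fact bop_mulDr : right_distributive bop_mul +%R.
Proof. by move=> A B C; apply: bop_ext => x; rewrite /= fctE bopDr. Qed.

HB.instance Definition _ := GRing.Zmodule_isPzRing.Build bop
  bop_mulA bop_mul1l bop_mul1r bop_mulDl bop_mulDr.

Lemma bop_scalerAl (a : R[i]) (A B : bop) : (a *: A) * B = a *: (A * B).
Proof. exact: bop_ext. Qed.

Lemma bop_scalerAr (a : R[i]) (A B : bop) : A * (a *: B) = a *: (A * B).
Proof. by apply: bop_ext => x; rewrite /= fctE bopZr. Qed.

Lemma bopDE (A B : bop) x : (A + B) x = A x + B x. Proof. by []. Qed.
Lemma bopNE (A : bop) x : (- A) x = - A x. Proof. by []. Qed.
Lemma bopBE (A B : bop) x : (A - B) x = A x - B x. Proof. by []. Qed.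
Lemma bopZE a (A : bop) x : (a *: A) x = a *: A x. Proof. by []. Qed.
Lemma bopME (A B : bop) x : (A * B) x = A (B x). Proof. by []. Qed.
Lemma bop0E x : (0 : bop) x = 0. Proof. by []. Qed.
Lemma bop1E x : (1 : bop) x = x. Proof. by []. Qed.

Definition bopE := (bopDE, bopNE, bopZE, bopME, bop0E, bop1E).

Lemma adjoint_exists (A : bop) : exists B : bop, forall x y,
  inner (A x) y = inner x (B y).
Proof.
have [lin [k hk]] := bopP A.
have repr y : exists z, forall x, inner (A x) y = inner x z.
  have [||||z [_ hz]] := @riesz_subspace _ H setT (fun x => inner (A x) y)
    (`|k| * rnorm y).
  - by [].
  - by [].
  - by move=> a x z; rewrite lin inner_linear.
  - move=> x; apply: le_trans (inner_cs _ _) _.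
    rewrite mulrAC; apply: ler_wpM2r; first exact: rnorm_ge0.
    by apply: le_trans (hk x) _; rewrite ler_wpM2r ?rnorm_ge0 ?ler_norm.
  by exists z => x; exact: hz.
pose B y := projT1 (cid (repr y)).
have hB x y : inner (A x) y = inner x (B y) by rewrite /B; case: cid.
have bB : bounded_op B.
  split=> [a x y|].
    by apply: inner_ext => z; rewrite -hB !innerDr !innerZr -!hB.
  exists `|k| => y; have [->|y0] := eqVneq (rnorm (B y)) 0.
    by rewrite mulr_ge0 ?rnorm_ge0.
  have Bp : 0 < rnorm (B y) by rewrite lt_def y0 rnorm_ge0.
  rewrite -(ler_pM2l Bp) -expr2 -Re_innerxx -hB.
  apply: le_trans (Re_le_rnorm _) _; apply: le_trans (inner_cs _ _) _.
  rewrite mulrA; apply: ler_wpM2r; first exact: rnorm_ge0.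
  rewrite mulrC; apply: le_trans (hk _) _.
  by rewrite ler_wpM2r ?rnorm_ge0 ?ler_norm.
by exists (mkbop bB).
Qed.

Definition adj (A : bop) : bop := projT1 (cid (adjoint_exists A)).

Lemma adjP (A : bop) x y : inner (A x) y = inner x (adj A y).
Proof. by rewrite /adj; case: cid. Qed.

Lemma adjPr (A : bop) x y : inner (adj A x) y = inner x (A y).
Proof. by rewrite -innerJ -adjP innerJ. Qed.

Lemma adj_unique (A B : bop) : (forall x y, inner (A x) y = inner x (B y)) ->
  B = adj A.
Proof. by move=> h; apply: bop_ext => x; apply: inner_ext => z; rewrite -adjP
  h. Qed.

Lemma adjK (A : bop) : adj (adj A) = A.
Proof. by apply/esym/adj_unique => x y; rewrite adjPr. Qed.

Lemma adjM (A B : bop) : adj (A * B) = adj B * adj A.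
Proof. by apply/esym/adj_unique => x y; rewrite /= !adjP. Qed.

Lemma adjD (A B : bop) : adj (A + B) = adj A + adj B.
Proof.
by apply/esym/adj_unique => x y; rewrite !bopE innerDl innerDr !adjP.
Qed.

Lemma adjZ a (A : bop) : adj (a *: A) = a^* *: adj A.
Proof.
by apply/esym/adj_unique => x y; rewrite !bopE innerZl innerZr conjCK adjP.
Qed.

Lemma adjN (A : bop) : adj (- A) = - adj A.
Proof. by rewrite -scaleN1r adjZ rmorphN rmorph1 scaleN1r. Qed.

Lemma adjB (A B : bop) : adj (A - B) = adj A - adj B.
Proof. by rewrite adjD adjN. Qed.

Lemma adj1 : adj 1 = 1.
Proof. exact/esym/adj_unique. Qed.

Lemma adj0 : adj 0 = 0.
Proof. by apply/esym/adj_unique => x y; rewrite inner0l inner0r. Qed.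

Lemma adjX (A : bop) n : adj (A ^+ n) = adj A ^+ n.
Proof.
elim: n => [|n IH]; first by rewrite !expr0 adj1.
by rewrite exprS adjM IH exprSr.
Qed.

Lemma adj_sum (I : finType) (F : I -> bop) : adj (\sum_i F i) = \sum_i adj (F
  i).
Proof.
by elim/big_rec2: _ => [|i y z _ <-]; [exact: adj0 | rewrite adjD].
Qed.

Definition pos (A : bop) := positive_op A.
Definition normle (A : bop) (k : R) := forall x, rnorm (A x) <= k * rnorm x.

Implicit Types A B c : bop.

Lemma normle_exists (A : bop) : exists2 k, 0 < k & normle A k.
Proof.
have [_ [k hk]] := bopP A; exists (`|k| + 1) => [|x]; first by rewrite ltr_wpDl.
apply: le_trans (hk x) _; rewrite ler_wpM2r ?rnorm_ge0//.
by apply: le_trans (ler_norm k) _; rewrite lerDl.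
Qed.

Lemma normle1 : normle 1 1.
Proof. by move=> x; rewrite /= mul1r. Qed.

Lemma normleM A B k l : 0 <= k -> normle A k -> normle B l ->
  normle (A * B) (k * l).
Proof.
move=> k0 hA hB x; apply: le_trans (hA _) _.
by rewrite -mulrA ler_wpM2l.
Qed.

Lemma normleZ a A k : normle A k -> normle (a *: A) (rnorm a * k).
Proof.
by move=> hA x; rewrite bopE rnormZ -mulrA ler_wpM2l ?rnorm_ge0.
Qed.

Lemma normle_adj A k : normle A k -> normle (adj A) k.
Proof.
move=> hA x; have [->|x0] := eqVneq (rnorm (adj A x)) 0.
  have [y0|y0] := eqVneq (rnorm x) 0; first by rewrite y0 mulr0.
  rewrite pmulr_lge0 ?lt_def ?y0 ?rnorm_ge0//.
  have := hA x; have := rnorm_ge0 (A x) => h1 /(le_trans h1).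
  by rewrite pmulr_lge0// lt_def y0 rnorm_ge0.
have xp : 0 < rnorm (adj A x) by rewrite lt_def x0 rnorm_ge0.
rewrite -(ler_pM2l xp) -expr2 -Re_innerxx adjPr.
apply: le_trans (Re_le_rnorm _) _; apply: le_trans (inner_cs _ _) _.
by rewrite mulrC mulrA [_ * k]mulrC; apply: ler_wpM2r; rewrite ?rnorm_ge0.
Qed.

Lemma pos_real A x : pos A -> inner (A x) x = (complex.Re (inner (A x) x))%:C.
Proof. by move=> /(_ x) h; rewrite RRe_real// ger0_real. Qed.

Lemma pos_Re A : (forall x y, inner (A x) y = inner x (A y)) ->
  (forall x, 0 <= complex.Re (inner (A x) x)) -> pos A.
Proof.
move=> sA hA x; have := innerJ (A x) x; rewrite -sA.
move: (hA x); case: (inner (A x) x) => a b /= a0 [/eqP].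
by rewrite eq_sym -subr_eq0 opprK -mulr2n mulrn_eq0/= lecE /= a0 andbT.
Qed.

(** Real values of <A x, x> at x + y and x + i y. *)
Lemma pos_adj A : pos A -> adj A = A.
Proof.
move=> pA; apply/esym/adj_unique => x y.
have real z : inner (A z) z = inner z (A z).
  by rewrite -[RHS]innerJ pos_real// conjR.
have h1 := real (x + y); have h2 := real (x + 'i *: y).
have c : ('i : R[i])^* = - 'i by apply/eqP; rewrite eq_complex /= oppr0 !eqxx.
move: h1 h2; rewrite !bopDr !bopZr !(innerDl, innerDr, innerZl, innerZr) c.
rewrite !(real x) !(real y).
move: (inner x (A x)) (inner y (A y)) => u v.
move: (inner (A x) y) (inner (A y) x) (inner x (A y)) (inner y (A x)).
move=> [a1 a2] [b1 b2] [c1 c2] [d1 d2].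
case: u v => [u1 u2] [v1 v2] /eqP + /eqP; rewrite !eq_complex /=.
move=> /andP[/eqP e1 /eqP e2] /andP[/eqP e3 /eqP e4].
by apply/eqP; rewrite eq_complex /=; apply/andP; split; apply/eqP; lra.
Qed.

Lemma pos_sym A x y : pos A -> inner (A x) y = inner x (A y).
Proof. by move=> pA; rewrite adjP pos_adj. Qed.

Lemma pos0 : pos 0.
Proof. by move=> x; rewrite bop0E inner0l. Qed.

Lemma pos1 : pos 1.
Proof. by move=> x; exact: inner_ge0. Qed.

Lemma posD A B : pos A -> pos B -> pos (A + B).
Proof. by move=> pA pB x; rewrite bopE innerDl addr_ge0 ?pA ?pB. Qed.

Lemma posZ (t : R) A : 0 <= t -> pos A -> pos (t%:C *: A).
Proof. by move=> t0 pA x; rewrite bopE innerZl mulr_ge0 ?lecR ?pA. Qed.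

Lemma pos_conj A B : pos A -> pos (adj B * A * B).
Proof. by move=> pA x; rewrite !bopE adjPr pA. Qed.

Lemma pos_adjM B : pos (adj B * B).
Proof. by move=> x; rewrite !bopE adjPr inner_ge0. Qed.

(** c (1 - c) is positive for 0 <= c <= 1, because it is
    c (1 - c) c + (1 - c) c (1 - c). *)
Lemma pos_mul1B c : pos c -> pos (1 - c) -> pos (c - c * c).
Proof.
move=> c0 c1.
have -> : c - c * c = c * (1 - c) * c + (1 - c) * c * (1 - c).
  by rewrite !mulrBr !mulrBl !mulr1 !mul1r [RHS]addrC subrK.
by apply: posD; [rewrite -{1}(pos_adj c0) | rewrite -{1}(pos_adj c1)];
  exact: pos_conj.
Qed.

(** That is, c^2 <= c. *)
Lemma rnorm_pos_le1 c x : pos c -> pos (1 - c) ->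
  rnorm (c x) ^+ 2 <= complex.Re (inner (c x) x).
Proof.
move=> c0 c1; have := pos_mul1B c0 c1 x.
rewrite bopBE innerBl bopME (pos_sym (c x) x c0) lecE /= => /andP[_].
by rewrite -Re_innerxx; case: (inner (c x) x) (inner (c x) (c x)) => [? ?] [?
  ?] /=; lra.
Qed.

Lemma normle_pos1 c : pos c -> pos (1 - c) -> normle c 1.
Proof.
move=> c0 c1 x; rewrite mul1r -ler_sqr ?nnegrE ?rnorm_ge0//.
apply: le_trans (rnorm_pos_le1 x c0 c1) _.
have := c1 x; rewrite bopBE bop1E innerBl innerxx lecE /= => /andP[_].
by case: (inner (c x) x) => [? ?] /=; lra.
Qed.

Lemma pos_normle A k : pos A -> normle A k -> pos (k%:C *: (1 : bop) - A).
Proof.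
move=> pA hA; apply: pos_Re => [x y|x].
  rewrite !bopBE !bopE innerBl innerBr innerZl innerZr conjR.
  by rewrite (pos_sym _ _ pA).
rewrite bopBE !bopE innerBl innerZl innerxx -rmorphM /= raddfB /= subr_ge0.
apply: le_trans (Re_le_rnorm _) _; apply: le_trans (inner_cs _ _) _.
by rewrite expr2 mulrA ler_wpM2r ?rnorm_ge0.
Qed.

Lemma pos_normle_adj A k : 0 <= k -> normle A k ->
  pos ((k ^+ 2)%:C *: (1 : bop) - adj A * A).
Proof.
move=> k0 hA; apply: pos_normle; first exact: pos_adjM.
by rewrite expr2; apply: normleM => //; exact: normle_adj.
Qed.

End BoundedOperators.

Arguments bop {R} H.
Arguments adj {R H}.
Arguments pos {R H}.

(** * Square roots and polar decompositions in strongly closed algebras *)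

Section StrongLimits.
Context (R : realType) (H : hilbertSpace R).
Implicit Types (A B T : bop H) (u v : nat -> bop H).

(** Limits in the strong operator topology. *)
Definition slim u A := forall x, (fun n => u n x) @ \oo --> A x.

Lemma slim_unique u A B : slim u A -> slim u B -> A = B.
Proof.
move=> uA uB; apply: bop_ext => x.
by apply: (cvg_unique _ (uA x) (uB x)); exact: norm_hausdorff.
Qed.

Lemma slim_cst A : slim (fun=> A) A.
Proof. by move=> x; exact: cvg_cst. Qed.

Lemma slimD u v A B : slim u A -> slim v B -> slim (fun n => u n + v n) (A + B).
Proof. by move=> uA vB x; apply: cvgD; [exact: uA | exact: vB]. Qed.

Lemma slimZ a u A : slim u A -> slim (fun n => a *: u n) (a *: A).
Proof. by move=> uA x; apply: cvgZr; exact: uA. Qed.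

Lemma slimN u A : slim u A -> slim (fun n => - u n) (- A).
Proof. by move=> uA x; apply: cvgN; exact: uA. Qed.

Lemma slimMr u A B : slim u A -> slim (fun n => u n * B) (A * B).
Proof. by move=> uA x; exact: uA. Qed.

Lemma slimMl u A B : slim u A -> slim (fun n => B * u n) (B * A).
Proof. by move=> uA x; apply: (cvg_bounded_op (bopP B)); exact: uA. Qed.

Lemma slim_shift u A : slim u A -> slim (fun n => u n.+1) A.
Proof. by move=> uA x; have := uA x; rewrite -(cvg_shiftS (fun n => u n x)).
  Qed.

Lemma slimM u v A B k : (forall n, normle (u n) k) -> slim u A -> slim v B ->
  slim (fun n => u n * v n) (A * B).
Proof.
move=> uk uA vB x.
have h0 : (fun n => u n (v n x - B x)) @ \oo --> (0 : H).
  apply/cvg_rnormP => e e0; have k0 : 0 < `|k| + 1 by rewrite ltr_wpDl.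
  have [N hN] := (cvg_rnormP _ _).1 (vB x) _ (divr_gt0 e0 k0).
  exists N => n /hN; rewrite sub0r rnormN rnormBC ltr_pdivlMr// mulrC => h.
  apply: le_lt_trans (uk n _) _; apply: le_lt_trans h.
  rewrite ler_wpM2r ?rnorm_ge0//; apply: le_trans (ler_norm k) _.
  by rewrite lerDl.
have -> : (fun n => (u n * v n) x) =
    (fun n => u n (v n x - B x) + u n (B x)).
  by apply/funext => n; rewrite -bopDr subrK.
by rewrite -[(A * B) x]add0r; apply: cvgD => //; exact: uA.
Qed.

Lemma slim_normle u A k : (forall n, normle (u n) k) -> slim u A -> normle A k.
Proof.
move=> uk uA x; apply/ler_addgt0Pr => e e0.
have [N /(_ N (leqnn N)) hN] := (cvg_rnormP _ _).1 (uA x) e e0.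
have := rnormD (A x - u N x) (u N x); rewrite subrK => h.
by apply: le_trans h _; have := uk N x; lra.
Qed.

Lemma slim_inner u A x y : slim u A ->
  (fun n => inner (u n x) y : R[i]^o) @ \oo --> (inner (A x) y : R[i]^o).
Proof. by move=> uA; exact: (cvg_bounded_op (bounded_op_inner y) (uA x)). Qed.

Lemma slim_pos u A : (forall n, pos (u n)) -> slim u A -> pos A.
Proof.
move=> pu uA x; have hl := (cvg_rnormP _ _).1 (@slim_inner u A x x uA).
have key e : 0 < e -> `|complex.Im (inner (A x) x)| < e /\
    - e < complex.Re (inner (A x) x).
  move=> e0; have [N /(_ N (leqnn N)) hN] := hl e e0.
  have := pu N x; rewrite lecE /= => /andP[/eqP im re].
  have h1 := le_lt_trans (Re_le_rnorm _) hN.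
  have h2 := Re_le_rnorm (- (inner (A x) x - inner (u N x) x)).
  rewrite rnormN in h2; have {}h2 := le_lt_trans h2 hN.
  have h3 := Re_le_rnorm ('i * (inner (A x) x - inner (u N x) x)).
  have h4 := Re_le_rnorm (- 'i * (inner (A x) x - inner (u N x) x)).
  have ni : rnorm ('i : R[i]) = 1.
    by rewrite /rnorm normc_def /= expr0n add0r expr1n sqrtr1.
  rewrite !rnormM ?rnormN ni mul1r in h3 h4.
  have {}h3 := le_lt_trans h3 hN; have {}h4 := le_lt_trans h4 hN.
  move: h1 h2 h3 h4 im re {hN}.
  case: (inner (A x) x) (inner (u N x) x) => [a b] [c d] /=.
  by rewrite ltr_norml => *; split; [apply/andP; split|]; lra.
rewrite lecE /=; apply/andP; split.
  apply/negPn/negP => h; have /key [] : 0 < `|complex.Im (inner (A x) x)|.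
    by rewrite normr_gt0.
  by rewrite ltxx.
rewrite leNgt; apply/negP => h.
have /key [_] : 0 < - complex.Re (inner (A x) x) by rewrite oppr_gt0.
by rewrite opprK ltxx.
Qed.

Lemma strong_limit u k : (forall n, normle (u n) k) ->
  (forall x, exists l : H, (fun n => u n x) @ \oo --> l) ->
  exists2 A, slim u A & normle A k.
Proof.
move=> uk ul; pose L x := projT1 (cid (ul x)).
have hL x : (fun n => u n x) @ \oo --> L x by rewrite /L; case: cid.
have bL : bounded_op L.
  split=> [a x y|].
    have h : (fun n => u n (a *: x + y)) @ \oo --> a *: L x + L y.
      under eq_fun do rewrite bopDr bopZr.
      by apply: cvgD; [apply: cvgZr |]; exact: hL.
    by apply: (cvg_unique _ (hL _) h); exact: norm_hausdorff.
  exists k => x; apply/ler_addgt0Pr => e e0.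
  have [N /(_ N (leqnn N)) hN] := (cvg_rnormP _ _).1 (hL x) e e0.
  have := rnormD (L x - u N x) (u N x); rewrite subrK => h.
  by apply: le_trans h _; have := uk N x; lra.
exists (mkbop bL); first exact: hL.
by apply: (slim_normle uk); exact: hL.
Qed.

(** An increasing sequence of operators between 0 and 1 converges strongly:
    |(c_m - c_n) x|^2 <= <(c_m - c_n) x, x>, which is Cauchy. *)
Lemma vigier (c : nat -> bop H) : pos (c 0%N) ->
  (forall n, pos (c n.+1 - c n)) -> (forall n, pos (1 - c n)) ->
  exists2 A, slim c A & pos A /\ pos (1 - A).
Proof.
move=> c0 cS c1.
have inc n m : (n <= m)%N -> pos (c m - c n).
  elim: m => [|m IH]; first by rewrite leqn0 => /eqP->; rewrite subrr; exact:
    pos0.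
  rewrite leq_eqVlt => /predU1P[->|/IH h]; first by rewrite subrr; exact: pos0.
  by rewrite -(subrK (c m) (c m.+1)) -addrA; apply: posD.
have cp n : pos (c n) by rewrite -(subrK (c 0%N) (c n)); apply: posD => //;
  exact: inc.
have diff1 n m : pos (1 - (c m - c n)).
  by rewrite opprB addrCA; apply: posD.
have [A cA A1] : exists2 A, slim c A & normle A 1.
  apply: strong_limit => [n|x]; first exact: normle_pos1.
  apply: complete_seq => e e0.
  pose s n := complex.Re (inner (c n x) x).
  have sinc : {homo s : n m / (n <= m)%N >-> n <= m}.
    move=> n m nm; have := inc n m nm x.
    rewrite bopBE innerBl lecE /= => /andP[_].
    by rewrite /s; case: (inner (c m x) x) (inner (c n x) x) => [? ?] [? ?] /=;
      lra.
  have sub : has_ubound (range s).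
    exists (rnorm x ^+ 2) => _ [n _ <-]; have := c1 n x.
    rewrite bopBE bop1E innerBl innerxx lecE /= => /andP[_].
    by rewrite /s; case: (inner (c n x) x) => [? ?] /=; lra.
  have /cvgrPdist_lt cs := nondecreasing_cvgn sinc sub.
  have e20 : 0 < e ^+ 2 / 2 by rewrite divr_gt0 ?exprn_gt0.
  have [N _ hN] := cs _ e20.
  have sup n m : (n <= m)%N -> (N <= n)%N -> rnorm (c m x - c n x) < e.
    move=> nm Nn; rewrite -ltr_sqr ?nnegrE ?rnorm_ge0 ?(ltW e0)//.
    have := rnorm_pos_le1 x (inc n m nm) (diff1 n m).
    rewrite bopBE innerBl raddfB /= -/(s m) -/(s n) => h; apply: le_lt_trans h
      _.
    have := hN n Nn; have := hN m (leq_trans Nn nm).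
    by rewrite /= !ltr_distl => /andP[? ?] /andP[? ?]; lra.
  exists N => n m Nn Nm; case: (leqP m n) => [mn|/ltnW nm]; first exact: sup.
  by rewrite rnormBC; exact: sup.
exists A => //; split; first exact: slim_pos cA.
by apply: (slim_pos c1); apply: slimD; [exact: slim_cst | exact: slimN].
Qed.

End StrongLimits.

Section FunctionalCalculus.
Context (R : realType) (H : hilbertSpace R).
Implicit Types (A B T b x : bop H).

(** Both von Neumann algebras and the algebra of all bounded operators are of
    this kind. *)
Record strong_algebra (N : set (bop H)) : Prop := StrongAlgebra {
  sa1 : N 1;
  sa_lin : forall a A B, N A -> N B -> N (a *: A + B);
  saM : forall A B, N A -> N B -> N (A * B);
  sa_adj : forall A, N A -> N (adj A);
  sa_slim : forall u A, (forall n, N (u n)) -> slim u A -> N A }.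

Variable N : set (bop H).
Hypothesis NA : strong_algebra N.

Lemma sa0 : N 0.
Proof. by have := sa_lin NA (-1) (sa1 NA) (sa1 NA); rewrite scaleN1r addNr. Qed.

Lemma saZ a A : N A -> N (a *: A).
Proof. by move=> nA; rewrite -[a *: A]addr0; apply: sa_lin => //; exact: sa0.
  Qed.

Lemma saD A B : N A -> N B -> N (A + B).
Proof. by move=> nA nB; rewrite -[A]scale1r; exact: sa_lin. Qed.

Lemma saB A B : N A -> N B -> N (A - B).
Proof. by move=> nA nB; rewrite addrC -scaleN1r; exact: sa_lin. Qed.

Lemma saX A n : N A -> N (A ^+ n).
Proof.
move=> nA; elim: n => [|n IH]; first by rewrite expr0; exact: sa1.
by rewrite exprS; exact: saM.
Qed.

Lemma sa_sum (I : finType) (F : I -> bop H) : (forall i, N (F i)) ->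
  N (\sum_i F i).
Proof. by move=> h; elim/big_rec: _ => [|i y _]; [exact: sa0 | exact: saD]. Qed.

Lemma posX x n : pos x -> pos (x ^+ n).
Proof.
move=> px; elim/ltn_ind: n => -[|[|n]] IH; first by rewrite expr0; exact: pos1.
  by rewrite expr1.
rewrite exprS exprSr -{1}(pos_adj px) mulrA; apply: pos_conj.
by apply: IH; rewrite ltnS leqW.
Qed.

(** Polynomials in x with nonnegative coefficients: unlike general positive
    operators they are stable under products, and they commute. *)
Inductive pospoly x : bop H -> Prop :=
| pospolyX n : pospoly x (x ^+ n)
| pospolyD A B : pospoly x A -> pospoly x B -> pospoly x (A + B)
| pospolyZ (t : R) A : 0 <= t -> pospoly x A -> pospoly x (t%:C *: A).

Lemma pospoly_pos x A : pos x -> pospoly x A -> pos A.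
Proof.
move=> px; elim=> [n|B C _ pB _ pC|t B t0 _ pB].
- exact: posX.
- exact: posD.
- exact: posZ.
Qed.

Lemma pospoly_comm x A B : pospoly x A -> pospoly x B -> A * B = B * A.
Proof.
move=> hA; elim: hA B => [n|A1 A2 _ IH1 _ IH2|t A1 _ _ IH] B hB.
- elim: hB => [m|B1 B2 _ IH1 _ IH2|t B1 _ _ IH].
  + by rewrite -!exprD addnC.
  + by rewrite mulrDl mulrDr IH1 IH2.
  + by rewrite bop_scalerAl bop_scalerAr IH.
- by rewrite mulrDl mulrDr IH1// IH2.
- by rewrite bop_scalerAl bop_scalerAr IH.
Qed.

Lemma pospolyM x A B : pospoly x A -> pospoly x B -> pospoly x (A * B).
Proof.
move=> hA; elim: hA B => [n|A1 A2 _ IH1 _ IH2|t A1 t0 _ IH] B hB.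
- elim: hB => [m|B1 B2 _ IH1 _ IH2|t B1 t0 _ IH].
  + by rewrite -exprD; exact: pospolyX.
  + by rewrite mulrDr; exact: pospolyD.
  + by rewrite bop_scalerAr; exact: pospolyZ.
- by rewrite mulrDl; apply: pospolyD; [exact: IH1 | exact: IH2].
- by rewrite bop_scalerAl; apply: pospolyZ => //; exact: IH.
Qed.

(** The iteration y <- (x + y^2) / 2 increases from 0 to 1 - sqrt (1 - x). *)
Fixpoint sqrt_iter x n : bop H :=
  if n is n'.+1 then (2^-1)%:C *: (x + sqrt_iter x n' * sqrt_iter x n') else 0.

Lemma half_double (V : lmodType R[i]) (v : V) : (2^-1)%:C *: (v + v) = v.
Proof.
rewrite scalerDr -scalerDl -rmorphD /= (_ : 2^-1 + 2^-1 = 1 :> R) ?scale1r//.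
by field.
Qed.

Lemma sqrt_exists_le1 a : N a -> pos a -> pos (1 - a) ->
  exists2 s, N s & pos s /\ s * s = a.
Proof.
move=> na a0 a1; set x := 1 - a.
have half0 : 0 <= 2^-1 :> R by rewrite invr_ge0.
have x0 : pos x by [].
have x1 : pos (1 - x) by rewrite /x subKr.
pose y := sqrt_iter x.
have pp0 : pospoly x 0.
  by rewrite -(scale0r (x ^+ 0)); exact: (@pospolyZ x 0 _ (lexx 0) (pospolyX x
    0)).
have ppx : pospoly x x by rewrite -[X in pospoly _ X]expr1; exact: pospolyX.
have ppy n : pospoly x (y n).
  elim: n => [//|n IH] /=; apply: pospolyZ => //; apply: pospolyD => //.
  exact: pospolyM.
have ppS n : pospoly x (y n.+1 - y n).
  elim: n => [|n IH].
    rewrite -[y 1%N - _]/((2^-1)%:C *: (x + 0 * 0) - 0) subr0 mulr0 addr0.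
    exact: pospolyZ.
  have -> : y n.+2 - y n.+1 =
      (2^-1)%:C *: ((y n.+1 - y n) * (y n.+1 + y n)).
    rewrite -[LHS]/((2^-1)%:C *: (x + y n.+1 * y n.+1)
      - (2^-1)%:C *: (x + y n * y n)) -scalerBr; congr (_ *: _).
    rewrite opprD addrACA subrr add0r mulrBl !mulrDr.
    rewrite (pospoly_comm (ppy n) (ppy n.+1)) opprD addrA.
    by rewrite -[RHS]addrA -addrA; congr (_ + _); rewrite addrA subrr add0r.
  apply: pospolyZ => //; apply: pospolyM => //; exact: pospolyD.
have y1 n : pos (1 - y n).
  elim: n => [|n IH]; first by rewrite -[y 0%N]/(0 : bop H) subr0; exact: pos1.
  have -> : 1 - y n.+1 = (2^-1)%:C *: ((1 - x) + ((1 - y n) + (y n - y n * y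
    n))).
    rewrite -[y n.+1]/((2^-1)%:C *: (x + y n * y n)).
    rewrite -[X in X - _](half_double (1 : bop H)) -scalerBr.
    congr (_ *: _).
    by rewrite opprD addrACA subrKA.
  apply: posZ => //; apply: posD => //; apply: posD => //.
  by apply: pos_mul1B => //; exact: pospoly_pos (ppy n).
have [Y yY [Y0 Y1]] : exists2 Y, slim y Y & pos Y /\ pos (1 - Y).
  apply: vigier => // [|n]; first exact: pos0.
  exact: pospoly_pos (ppS n).
have nY : N Y.
  apply: (sa_slim NA) yY => n; elim: n => [|n IH] /=; first exact: sa0.
  by apply/saZ/saD; [apply: saB => //; exact: sa1 | exact: saM].
exists (1 - Y); first by apply: saB => //; exact: sa1.
split=> //.
have yy : slim (fun n => y n * y n) (Y * Y).
  apply: (slimM (k := 1)) => // n; apply: normle_pos1 => //.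
  exact: pospoly_pos (ppy n).
have fixY : Y = (2^-1)%:C *: (x + Y * Y).
  apply: (slim_unique (slim_shift yY)).
  by apply: slimZ; apply: slimD => //; exact: slim_cst.
have {}fixY : Y + Y = x + Y * Y.
  by rewrite {1 2}fixY -scalerDr half_double.
rewrite mulrBl mul1r mulrBr mulr1.
have -> : Y * Y = Y + Y - x by rewrite fixY addrC addKr.
have -> : Y - (Y + Y - x) = x - Y.
  by rewrite opprB opprD addrCA [Y + _]addrA subrr add0r.
by rewrite opprB subrKA /x subKr.
Qed.

Lemma sqrt_exists a : N a -> pos a -> exists2 s, N s & pos s /\ s * s = a.
Proof.
move=> na a0; have [k k0 ak] := normle_exists a.
have [||| s ns [s0 ss]] := @sqrt_exists_le1 (k^-1%:C *: a).
- exact: saZ.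
- by apply: posZ; rewrite // invr_ge0 ltW.
- have -> : 1 - k^-1%:C *: a = k^-1%:C *: (k%:C *: (1 : bop H) - a).
    by rewrite scalerBr scalerA -rmorphM /= mulVf ?gt_eqF// scale1r.
  by apply: posZ; [rewrite invr_ge0 ltW | exact: pos_normle].
exists ((Num.sqrt k)%:C *: s); first exact: saZ.
split; first by apply: posZ => //; exact: sqrtr_ge0.
rewrite bop_scalerAl bop_scalerAr ss !scalerA -!rmorphM /= -mulrA.
by rewrite [Num.sqrt k * _]mulrA -expr2 sqr_sqrtr ?(ltW k0)// mulfV ?gt_eqF//
  scale1r.
Qed.

(** The phase u is the strong limit of T (1 + e + .. + e^(n-1)) for e = 1 - b.
    The geometric sum tends to the inverse of b on the range of b, and the
    products with T are contractions because |T x| = |b x| and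
    b (1 + e + .. + e^(n-1)) = 1 - e^n is a contraction. *)
Lemma polar_le1 T b : N T -> N b -> pos b -> pos (1 - b) ->
  adj T * T = b * b ->
  exists2 u, N u & [/\ normle u 1, u * b = T & adj u * T = b].
Proof.
move=> nT nb b0 b1 Tb; pose e : bop H := 1 - b.
have e0 : pos e by [].
have e1 : pos (1 - e) by rewrite /e subKr.
have bE : b = 1 - e by rewrite /e subKr.
have ppe n : pospoly e (e ^+ n) by exact: pospolyX.
have normT w : rnorm (T w) = rnorm (b w).
  apply/eqP; rewrite -(@eqrXn2 _ 2) ?rnorm_ge0//; apply/eqP.
  rewrite -!Re_innerxx (adjP T w) -bopME Tb bopME.
  by rewrite -(pos_sym _ _ b0).
have eS n : pos (e ^+ n - e ^+ n.+1).
  have [m [->|->]] : exists m, n = m.*2 \/ n = m.*2.+1.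
    by exists n./2; have := odd_double_half n; case: odd => /= h; [right|left].
    - have -> : e ^+ m.*2 - e ^+ m.*2.+1 = adj (e ^+ m) * (1 - e) * e ^+ m.
      rewrite adjX pos_adj// mulrBr mulr1 mulrBl -exprSr -!exprD.
      by rewrite addSn addnn.
    exact: pos_conj.
  have -> : e ^+ m.*2.+1 - e ^+ m.*2.+2 = adj (e ^+ m) * (e - e * e) * e ^+ m.
    rewrite adjX pos_adj// mulrBr mulrBl mulrA -!exprSr -!exprD.
    by rewrite !addSn addnn.
  by apply: pos_conj; exact: pos_mul1B.
pose c n : bop H := 1 - e ^+ n.
have cp n : pos (c n).
  rewrite /c; elim: n => [|n IH]; first by rewrite expr0 subrr; exact: pos0.
  by rewrite -(subrK (e ^+ n) 1) -addrA; exact: posD.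
have [C cC _] : exists2 C, slim c C & pos C /\ pos (1 - C).
  apply: vigier => // n; last by rewrite /c subKr; exact: posX.
  by rewrite /c opprB addrC addrA subrK.
pose E : bop H := 1 - C.
have eE : slim (fun n => e ^+ n) E.
  have h := slimD (@slim_cst R H 1) (slimN cC).
  by move=> x; have := h x; under eq_fun do rewrite /c subKr.
have bEz : b * E = 0 :> bop H.
  apply: (slim_unique (slimMl (B := b) eE)).
  have h := slimD eE (slimN (slim_shift eE)); rewrite subrr in h.
  by move=> x; have := h x; under eq_fun do rewrite exprS -{1}[e ^+ _]mul1r
    -mulrBl -bE.
have TEz : T * E = 0 :> bop H.
  apply: bop_ext => x; apply: rnorm0_eq0.
  by rewrite bopE normT -bopME bEz rnorm0.
pose g n : bop H := \sum_(j < n) e ^+ j.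
have bg n : b * g n = c n.
  rewrite /c -[RHS]opprB subrX1 -mulNr opprB -bE.
  by [].
have gb n : g n * b = c n.
  rewrite -bg bE mulrBr mulrBl mulr1 mul1r; congr (_ - _).
  by rewrite mulr_suml mulr_sumr; apply: eq_bigr => j _; rewrite -exprS -exprSr.
have Tg1 n : normle (T * g n) 1.
  move=> x; rewrite bopE normT -bopME bg; apply: normle_pos1 => //.
  by rewrite /c subKr; exact: posX.
have [u Tu u1] : exists2 u, slim (fun n => T * g n) u & normle u 1.
  apply: strong_limit => // x; apply: complete_seq => d d0.
  have /cvg_rnormP hc := cC x.
  have [M hM] := hc _ (divr_gt0 d0 (ltr0Sn R 1)).
  exists M => n m /hM hn /hM hm.
  rewrite -bopBE -mulrBr bopE normT -bopME mulrBr !bg bopBE.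
  have := rnormD (c n x - C x) (C x - c m x).
  by rewrite addrA subrK (rnormBC (c n x) (C x)) => h; apply: le_lt_trans h _;
    lra.
exists u.
  by apply: (sa_slim NA) Tu => n; apply: saM => //; apply: sa_sum => j; apply:
    saX;
    apply: saB => //; exact: sa1.
split=> //.
  apply: (slim_unique (slimMr (B := b) Tu)) => x.
  have /(_ x) := slimMl (B := T) cC.
  rewrite (_ : T * C = T); last by rewrite -[C](subKr 1) -/E mulrBr mulr1 TEz
    subr0.
  by under eq_fun do rewrite -gb mulrA.
apply: bop_ext => x; apply: inner_ext => y; rewrite bopE -adjP.
have h1 := slim_inner (x := y) (y := T x) Tu.
have h2 := slim_inner (x := y) (y := b x) cC.
have h3 : (fun n => inner ((T * g n) y) (T x) : R[i]^o) @ \oo -->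
    (inner (C y) (b x) : R[i]^o).
  under eq_fun do rewrite bopE adjP -bopME Tb bopME -(pos_sym _ _ b0) -bopME bg.
  exact: h2.
rewrite (cvg_unique _ h1 h3); last exact: norm_hausdorff.
have bC : b * C = b by rewrite -[C](subKr 1) -/E mulrBr mulr1 bEz subr0.
by rewrite -(pos_sym _ _ b0) -bopME bC (pos_sym _ _ b0).
Qed.

Lemma polar T b : N T -> N b -> pos b -> adj T * T = b * b ->
  exists2 u, N u & [/\ normle u 1, u * b = T & adj u * T = b].
Proof.
move=> nT nb b0 Tb; have [k k0 bk] := normle_exists b.
have kC : k^-1%:C \is a GRing.unit by rewrite unitfE fmorph_eq0 invr_eq0 gt_eqF.
have [|||||u nu [u1 ub uT]] := @polar_le1 (k^-1%:C *: T) (k^-1%:C *: b).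
- exact: saZ.
- exact: saZ.
- by apply: posZ; rewrite // invr_ge0 ltW.
- have -> : 1 - k^-1%:C *: b = k^-1%:C *: (k%:C *: (1 : bop H) - b).
    by rewrite scalerBr scalerA -rmorphM /= mulVf ?gt_eqF// scale1r.
  by apply: posZ; [rewrite invr_ge0 ltW | exact: pos_normle].
- by rewrite adjZ conjR !bop_scalerAl !bop_scalerAr Tb.
exists u => //; split=> //; apply: (scalerI kC).
- by rewrite -bop_scalerAr.
- by rewrite -bop_scalerAr.
Qed.

End FunctionalCalculus.

(** * Traces on strongly closed algebras *)

Section HerglotzOperators.
Context (R : realType) (H : hilbertSpace R).
Implicit Types (A B : bop H).

(** For a contraction A, the associated Herglotz sums are visibly positive. *)
Definition bop_kernel A j k : bop H := adj A ^+ j * A ^+ k.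

Lemma bop_herglotz A n (z : R[i]) : let S := \sum_(k < n) z ^+ k *: A ^+ k in
  herglotz_sum (bop_kernel A) n z = adj S * (1 - adj A * A) * S.
Proof.
move=> S; rewrite /S adj_sum mulr_suml mulr_suml; apply: eq_bigr => j _.
rewrite mulr_sumr; apply: eq_bigr => k _.
rewrite adjZ adjX rmorphXn /= !bop_scalerAl !bop_scalerAr scalerA; congr (_ *:
  _).
by rewrite mulrBr mulrBl mulr1 /bop_kernel exprSr exprS !mulrA.
Qed.

Lemma bop_herglotz_kernel A : normle A 1 ->
  herglotz_kernel (@pos R H) (bop_kernel A) 1 A.
Proof.
move=> A1; split=> [|||n z _]; rewrite /bop_kernel ?expr0 ?mul1r ?expr1//.
- by move=> n; rewrite -adjX; exact: pos_adjM.
rewrite -/(bop_kernel A) bop_herglotz; apply: pos_conj.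
by have := pos_normle_adj ler01 A1; rewrite expr1n scale1r.
Qed.

Lemma normleX A r n : 0 <= r -> normle A r -> normle (A ^+ n) (r ^+ n).
Proof.
move=> r0 hA; elim: n => [x|n IH]; first by rewrite expr0 mul1r.
by rewrite !exprS; exact: normleM.
Qed.

Lemma normle_bop_kernel A r n : 0 <= r <= 1 -> normle A r ->
  normle (bop_kernel A n n.+1) (r ^+ n).
Proof.
move=> /andP[r0 r1] hA x.
have h : normle (bop_kernel A n n.+1) (r ^+ n * r ^+ n.+1).
  apply: normleM; [exact: exprn_ge0 | apply: normleX => // | exact: normleX].
  exact: normle_adj.
apply: le_trans (h x) _; rewrite ler_wpM2r ?rnorm_ge0//.
by rewrite ler_piMr ?exprn_ge0// exprn_ile1.
Qed.

Lemma normle_shrink A (r : R) : 0 <= r -> normle A 1 -> normle (r%:C *: A) r.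
Proof.
by move=> r0 hA; have := normleZ r%:C hA; rewrite rnormR ger0_norm// mulr1.
Qed.

End HerglotzOperators.

Section Trace.
Context (R : realType) (H : hilbertSpace R).
Implicit Types (a b p q s u x T S : bop H).
Variable N : set (bop H).
Hypothesis NA : strong_algebra N.

Record trace_on (tr : bop H -> \bar R) : Prop := TraceOn {
  tr_ge0 : forall a, N a -> pos a -> (0 <= tr a)%E;
  trD : forall a b, N a -> N b -> pos a -> pos b -> tr (a + b) = (tr a + tr
    b)%E;
  trZ : forall (l : R) a, 0 <= l -> N a -> pos a ->
    tr (l%:C *: a) = (l%:E * tr a)%E;
  tr_adjM : forall a, N a -> tr (adj a * a) = tr (a * adj a) }.

Variable tr : bop H -> \bar R.
Hypothesis trP : trace_on tr.

Definition fin_trace p := [/\ N p, pos p & (tr p < +oo)%E].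
Definition tau p : R := fine (tr p).

Lemma tauE p : fin_trace p -> tr p = (tau p)%:E.
Proof.
move=> [np pp tp]; rewrite /tau fineK// ge0_fin_numE//; exact: tr_ge0.
Qed.

Lemma fin_traceD p q : fin_trace p -> fin_trace q ->
  fin_trace (p + q) /\ tau (p + q) = tau p + tau q.
Proof.
move=> fp fq; have [np pp _] := fp; have [nq pq _] := fq.
have e : tr (p + q) = (tau p + tau q)%:E by rewrite (trD trP)// !tauE.
split; last by rewrite [LHS]/tau e.
by split; [exact: saD | exact: posD | rewrite e ltry].
Qed.

Lemma fin_traceZ (l : R) p : 0 <= l -> fin_trace p ->
  fin_trace (l%:C *: p) /\ tau (l%:C *: p) = l * tau p.
Proof.
move=> l0 fp; have [np pp _] := fp.
have e : tr (l%:C *: p) = (l * tau p)%:E by rewrite (trZ trP)// tauE.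
split; last by rewrite [LHS]/tau e.
by split; [exact: saZ | exact: posZ | rewrite e ltry].
Qed.

Lemma fin_trace0 : fin_trace 0 /\ tau 0 = 0.
Proof.
have e : tr 0 = 0%E.
  have := trZ trP (lexx 0) (sa0 NA) (@pos0 R H).
  by rewrite scaler0 mul0e.
split; last by rewrite [LHS]/tau e.
by split; [exact: sa0 | exact: pos0 | rewrite e ltry].
Qed.

Lemma fin_trace_le p q : N q -> pos q -> pos (p - q) -> fin_trace p ->
  fin_trace q /\ tau q <= tau p.
Proof.
move=> nq q0 pq fp; have [np p0 tp] := fp.
have npq : N (p - q) by exact: saB.
have e : tr p = (tr q + tr (p - q)%R)%E.
  by rewrite -(trD trP)// addrC subrK.
have le : (tr q <= tr p)%E by rewrite e leeDl// (tr_ge0 trP).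
have fq : fin_trace q by split=> //; exact: le_lt_trans le tp.
by split=> //; rewrite -lee_fin -!tauE.
Qed.

(** Twice the real part of the linear extension of the trace: defined when the
    hermitian part of a is a difference of positive elements of finite
    trace. *)
Definition has_retr a (r : R) := exists p q, [/\ fin_trace p, fin_trace q,
  a + adj a = p - q & r = tau p - tau q].
Definition in_dom a := exists r, has_retr a r.
Definition retr a : R := xget 0 [set r | has_retr a r].

Lemma retrE a r : has_retr a r -> retr a = r.
Proof.
have uniq r' : has_retr a r -> has_retr a r' -> r' = r.
  move=> [p [q [fp fq e ->]]] [p' [q' [fp' fq' e' ->]]].
  have : p + q' = p' + q.
    by apply/eqP; rewrite addrC -subr_eq -addrA -e e' addrCA subrr addr0.
  move=> /(congr1 tau); rewrite !(fin_traceD _ _).2//.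
  by move: (tau p) (tau q) (tau p') (tau q') => *; lra.
by move=> h; apply: uniq => //; apply: (xgetPex 0 (ex_intro _ r h)).
Qed.

Lemma in_domP a : in_dom a -> has_retr a (retr a).
Proof. by move=> [r h]; rewrite (retrE h). Qed.

Lemma retrD a b : in_dom a -> in_dom b ->
  in_dom (a + b) /\ retr (a + b) = retr a + retr b.
Proof.
move=> /in_domP[p [q [fp fq e ->]]] /in_domP[p' [q' [fp' fq' e' ->]]].
have [fpp tpp] := fin_traceD fp fp'; have [fqq tqq] := fin_traceD fq fq'.
have h : has_retr (a + b) (tau p - tau q + (tau p' - tau q')).
  exists (p + p'), (q + q'); split=> //.
    by rewrite adjD addrACA e e' opprD addrACA.
  by rewrite tpp tqq opprD addrACA.
by split; [exists (tau p - tau q + (tau p' - tau q')) | exact: retrE].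
Qed.

Lemma retrN a : in_dom a -> in_dom (- a) /\ retr (- a) = - retr a.
Proof.
move=> /in_domP[p [q [fp fq e ->]]].
have h : has_retr (- a) (- (tau p - tau q)).
  by exists q, p; split=> //; rewrite ?adjN -?opprD ?e opprB.
by split; [exists (- (tau p - tau q)) | exact: retrE].
Qed.

Lemma retrB a b : in_dom a -> in_dom b ->
  in_dom (a - b) /\ retr (a - b) = retr a - retr b.
Proof.
move=> da db; have [dn en] := retrN db; have [dd ed] := retrD da dn.
by rewrite ed en.
Qed.

Lemma retr_pos p : fin_trace p -> in_dom p /\ retr p = 2 * tau p.
Proof.
move=> fp; have [np pp _] := fp; have [fpp tpp] := fin_traceD fp fp.
have [f0 t0] := fin_trace0.
have h : has_retr p (2 * tau p).
  by exists (p + p), 0; split=> //; [rewrite pos_adj// subr0 | rewrite tpp t0;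
    ring].
by split; [exists (2 * tau p) | exact: retrE].
Qed.

(** From a + a = p - q follows a <= p. *)
Lemma fin_trace_in_dom a : N a -> pos a -> in_dom a -> fin_trace a.
Proof.
move=> na a0 [r [p [q [fp fq e _]]]]; have [nq q0 _] := fq.
apply: (fin_trace_le na a0 _ fp).1.
have -> : p = a + a + q by rewrite -[X in _ + X + _](pos_adj a0) e subrK.
by rewrite addrC -addrA addKr; exact: posD.
Qed.

Lemma polar_identity (x y p : bop H) :
  (x + 1) * p * (y + 1) - (x - 1) * p * (y - 1) =
  (x * p + p * y) + (x * p + p * y).
Proof.
have -> : (x + 1) * p * (y + 1) = (x * p * y + p) + (x * p + p * y).
  rewrite mulrDl mul1r mulrDr mulr1 mulrDl [x * p + p]addrC addrACA.
  by rewrite [p * y + _]addrC.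
have -> : (x - 1) * p * (y - 1) = (x * p * y + p) - (x * p + p * y).
  by rewrite mulrBl mul1r mulrBr mulr1 mulrBl opprB addrACA -opprD [p * y +
    _]addrC.
set P := x * p * y + p; set Q := x * p + p * y.
by rewrite opprB [Q - P]addrC addrACA subrr add0r.
Qed.

(** With s the square root of p, the trace does not distinguish x p + p x^* from
    s (x + x^* ) s, whose sign is known: polarize, and use the identity
    tr (w w^* ) = tr (w^* w) for w = (x + 1) s and w = (x - 1) s. *)
Lemma retr_mul_pos x p : N x -> fin_trace p ->
  in_dom (x * p) /\ (pos (x + adj x) -> 0 <= retr (x * p)).
Proof.
move=> nx fp; have [np p0 _] := fp; have [s ns [s0 ss]] := sqrt_exists NA np p0.
have as_ := pos_adj s0.
have half0 : 0 <= 2^-1 :> R by rewrite invr_ge0.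
have fw w : N w -> fin_trace (s * (adj w * w) * s) /\
    (fin_trace (w * p * adj w) /\
     tau (w * p * adj w) = tau (s * (adj w * w) * s)).
  move=> nw; have [k k0 wk] := normle_exists w.
  have e1 : s * (adj w * w) * s = adj (w * s) * (w * s).
    by rewrite adjM as_ !mulrA.
  have e2 : w * p * adj w = (w * s) * adj (w * s).
    by rewrite adjM as_ -ss !mulrA.
  have f1 : fin_trace (s * (adj w * w) * s).
    apply: (fin_trace_le (p := (k ^+ 2)%:C *: p) _ _ _ _).1.
    - by rewrite e1; apply: saM => //; [apply: sa_adj => // |]; exact: saM.
    - by rewrite e1; exact: pos_adjM.
    - have -> : (k ^+ 2)%:C *: p - s * (adj w * w) * s =
          adj s * ((k ^+ 2)%:C *: (1 : bop H) - adj w * w) * s.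
        by rewrite as_ mulrBr mulrBl bop_scalerAr mulr1 bop_scalerAl ss.
      by apply: pos_conj; exact: pos_normle_adj (ltW k0) wk.
    - exact: (fin_traceZ (exprn_ge0 2 (ltW k0)) fp).1.
  have te : tr (w * p * adj w) = tr (s * (adj w * w) * s).
    by rewrite e1 e2 (tr_adjM trP)//; exact: saM.
  split=> //; split; last by rewrite /tau te.
  split; last by rewrite te; case: f1.
    by apply: saM => //; [exact: saM | exact: sa_adj].
  by rewrite -{1}(adjK w); exact: pos_conj.
have n1 := sa1 NA.
have [fp1 [fp2 tp]] := fw (x + 1) (saD NA nx n1).
have [fm1 [fm2 tm]] := fw (x - 1) (saB NA nx n1).
have [hp1 hp2] := fin_traceZ half0 fp2.
have [hm1 hm2] := fin_traceZ half0 fm2.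
have hr : has_retr (x * p) (2^-1 * (tau (s * (adj (x + 1) * (x + 1)) * s)
    - tau (s * (adj (x - 1) * (x - 1)) * s))).
  exists ((2^-1)%:C *: ((x + 1) * p * adj (x + 1))),
    ((2^-1)%:C *: ((x - 1) * p * adj (x - 1))); split=> //.
    rewrite -scalerBr adjD adjB adj1 polar_identity half_double.
    by rewrite adjM (pos_adj p0).
  by rewrite hp2 hm2 tp tm mulrBr.
split; first by exists (2^-1 * (tau (s * (adj (x + 1) * (x + 1)) * s)
    - tau (s * (adj (x - 1) * (x - 1)) * s))).
move=> hx; rewrite (retrE hr) mulr_ge0// subr_ge0.
have [nm m0 _] := fm1.
apply: (fin_trace_le nm m0 _ fp1).2.
have -> : s * (adj (x + 1) * (x + 1)) * s - s * (adj (x - 1) * (x - 1)) * s =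
    adj s * ((adj x + x) + (adj x + x)) * s.
  rewrite as_ -mulrBl -mulrBr adjD adjB adj1.
  by have := polar_identity (adj x) x 1; rewrite !mulr1 !mul1r => ->.
by apply: pos_conj; apply: posD; rewrite addrC.
Qed.

Lemma in_dom_mul x p : N x -> fin_trace p -> in_dom (x * p).
Proof. by move=> nx fp; case: (retr_mul_pos nx fp). Qed.

(** The operator k - x has positive real part. *)
Lemma retr_mul_le x p k : N x -> fin_trace p -> 0 <= k -> normle x k ->
  retr (x * p) <= 2 * k * tau p.
Proof.
move=> nx fp k0 xk.
have [fk tk] := fin_traceZ k0 fp; have [dk rk] := retr_pos fk.
have nk : N (k%:C *: (1 : bop H)) by apply: saZ => //; exact: sa1.
have [_ /(_ _)] := retr_mul_pos (saB NA nk nx) fp.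
rewrite mulrBl bop_scalerAl mul1r (retrB dk (in_dom_mul nx fp)).2 rk tk => h.
suff /h : pos (k%:C *: (1 : bop H) - x + adj (k%:C *: (1 : bop H) - x)) by lra.
apply: pos_Re => [y z|y].
  by rewrite adjP adjD adjK addrC.
set B := k%:C *: (1 : bop H) - x.
have hB : 0 <= complex.Re (inner (B y) y).
  rewrite bopBE innerBl raddfB /= innerZl innerxx -rmorphM /= subr_ge0.
  apply: le_trans (Re_le_rnorm _) _; apply: le_trans (inner_cs _ _) _.
  by rewrite expr2 mulrA ler_wpM2r ?rnorm_ge0.
rewrite bopDE innerDl adjPr -[inner y (B y)]innerJ.
by case: (inner (B y) y) hB => [? ?] /=; lra.
Qed.

End Trace.

(** * Noncommutative L^1-spaces *)

Section TraceNorm.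
Context (R : realType) (H : hilbertSpace R).
Implicit Types (a b p q s u x T S : bop H).
Variable N : set (bop H).
Hypothesis NA : strong_algebra N.
Variable tr : bop H -> \bar R.
Hypothesis trP : trace_on N tr.
Variable V : normedModType R[i].
Implicit Types (v w y : V).

(** rep v T means that the vector v stands for the operator T. *)
Record trace_norm_rep (rep : V -> bop H -> Prop) : Prop := TraceNormRep {
  rep_lin : forall (c : R[i]) v w T S, rep v T -> rep w S ->
    rep (c *: v + w) (c *: T + S);
  rep_abs : forall v T, rep v T -> N T /\
    exists b, [/\ N b, pos b, adj T * T = b * b & tr b = (rnorm v)%:E] }.

Variable rep : V -> bop H -> Prop.
Hypothesis repP : trace_norm_rep rep.

Local Notation Rtr := (retr N tr).
Local Notation Dom := (in_dom N tr).
Local Notation Fin := (fin_trace N tr).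

Lemma rep_polar v T : rep v T -> exists u b, [/\ N u, normle u 1 &
  [/\ Fin b, tau tr b = rnorm v, u * b = T & adj u * T = b]].
Proof.
move=> vT; have [nT [b [nb b0 Tb tb]]] := rep_abs repP vT.
have [u nu [u1 ub uT]] := polar NA nT nb b0 Tb.
exists u, b; split=> //; split=> //; last by rewrite /tau tb.
by split=> //; rewrite tb ltry.
Qed.

Lemma rep_dom x v T : N x -> rep v T -> Dom (x * T).
Proof.
move=> nx vT; have [u [b [nu u1 [fb tb <- _]]]] := rep_polar vT.
by rewrite mulrA; apply: (in_dom_mul NA trP) => //; exact: saM.
Qed.

Lemma retr_rep_le x v T k : N x -> 0 <= k -> normle x k -> rep v T ->
  Rtr (x * T) <= 2 * k * rnorm v.
Proof.
move=> nx k0 xk vT; have [u [b [nu u1 [fb <- <- _]]]] := rep_polar vT.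
rewrite mulrA; apply: (retr_mul_le NA trP) => //; first exact: saM.
by have := normleM k0 xk u1; rewrite mulr1.
Qed.

Lemma retr_rep_attained v T : rep v T ->
  exists2 u, N u /\ normle u 1 & Rtr (u * T) = 2 * rnorm v.
Proof.
move=> vT; have [u [b [nu u1 [fb <- _ uT]]]] := rep_polar vT.
exists (adj u); first by split; [exact: sa_adj | exact: normle_adj].
by rewrite uT (retr_pos NA trP fb).2.
Qed.

(** The norm of v is the trace of some positive b with b^2 = p^2. Each of p and
    b is the product of a contraction with the other, so their traces
    agree. *)
Lemma rep_pos v p : rep v p -> pos p -> Fin p /\ tau tr p = rnorm v.
Proof.
move=> vp p0; have [np _] := rep_abs repP vp.
have n1 := @normle1 R H.
have fp : Fin p.
  apply: (fin_trace_in_dom NA trP) => //.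
  by have := rep_dom (sa1 NA) vp; rewrite mul1r.
have h1 := retr_rep_le (sa1 NA) ler01 n1 vp.
rewrite mul1r mulr1 (retr_pos NA trP fp).2 in h1.
have [u [nu u1] h2] := retr_rep_attained vp.
have := retr_mul_le NA trP nu fp ler01 u1; rewrite h2 mulr1 => h3.
by split=> //; apply/le_anti/andP; split; lra.
Qed.

Definition norm_bound x : R := projT1 (cid2 (normle_exists x)).
Lemma norm_bound_gt0 x : 0 < norm_bound x.
Proof. by rewrite /norm_bound; case: cid2. Qed.
Lemma norm_boundP x : normle x (norm_bound x).
Proof. by rewrite /norm_bound; case: cid2. Qed.

(** The pairing Rtr (x T), extended to all vectors of V by the McShane
    formula; on the closure of the representable vectors it is the extension
    by continuity, and no limits need to be chosen. *)
Definition pairing x y : R :=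
  inf [set r | exists v T, rep v T /\
    r = Rtr (x * T) + 2 * norm_bound x * rnorm (y - v)].

Definition adherent y := forall e : R, 0 < e ->
  exists v T, rep v T /\ rnorm (y - v) < e.

Lemma rep_sub v w T S : rep v T -> rep w S -> rep (v - w) (T - S).
Proof.
move=> vT wS; have := rep_lin repP (-1) wS vT.
by rewrite !scaleN1r [- w + v]addrC [- S + T]addrC.
Qed.

Lemma pairing_near x y v T : N x -> rep v T ->
  `|Rtr (x * T) - pairing x y| <= 2 * norm_bound x * rnorm (y - v).
Proof.
move=> nx vT; have kp := norm_bound_gt0 x; set k := norm_bound x in kp *.
have lb w S : rep w S -> Rtr (x * T) - 2 * k * rnorm (y - v) <=
    Rtr (x * S) + 2 * k * rnorm (y - w).
  move=> wS; have := retr_rep_le nx (ltW kp) (norm_boundP x) (rep_sub vT wS).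
  rewrite mulrBr (retrB NA trP (rep_dom nx vT) (rep_dom nx wS)).2 => h.
  have : 2 * k * rnorm (v - w) <= 2 * k * (rnorm (y - v) + rnorm (y - w)).
    rewrite ler_wpM2l ?mulr_ge0 ?(ltW kp)// -(rnormBC v).
    by have := rnormD (v - y) (y - w); rewrite addrA subrK.
  by rewrite -/k in h; lra.
pose A := [set r | exists v T, rep v T /\ r = Rtr (x * T) + 2 * k * rnorm (y -
  v)].
have A0 : A !=set0 by exists (Rtr (x * T) + 2 * k * rnorm (y - v)), v, T.
have iA : has_inf A.
  split=> //; exists (Rtr (x * T) - 2 * k * rnorm (y - v)).
  by move=> _ [w [S [wS ->]]]; exact: lb.
have h1 : pairing x y <= Rtr (x * T) + 2 * k * rnorm (y - v).
  by apply: ge_inf; [case: iA | exists v, T].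
have h2 : Rtr (x * T) - 2 * k * rnorm (y - v) <= pairing x y.
  by apply: lb_le_inf => // _ [w [S [wS ->]]]; exact: lb.
by rewrite ler_distl; apply/andP; split; lra.
Qed.

Lemma pairing_unique x y (r C : R) : N x -> adherent y ->
  (forall v T, rep v T -> `|Rtr (x * T) - r| <= C * rnorm (y - v)) ->
  pairing x y = r.
Proof.
move=> nx ay h; apply/eqP; rewrite -subr_eq0 -normr_eq0 eq_le normr_ge0 andbT.
apply/ler_addgt0Pr => e e0; rewrite add0r.
have kp := norm_bound_gt0 x.
pose K := 2 * norm_bound x + `|C| + 1.
have K0 : 0 < K by rewrite /K; have := normr_ge0 C; lra.
have [v [T [vT hv]]] := ay _ (divr_gt0 e0 K0).
have h1 := pairing_near y nx vT; have h2 := h _ _ vT.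
have h3 : C * rnorm (y - v) <= `|C| * rnorm (y - v).
  by rewrite ler_wpM2r ?rnorm_ge0 ?ler_norm.
have h4 : K * rnorm (y - v) <= e.
  by rewrite mulrC -ler_pdivlMr// ltW.
have := ler_distD (Rtr (x * T)) (pairing x y) r.
rewrite (distrC (pairing x y) (Rtr (x * T))) => h5; apply: le_trans h5 _.
by have := rnorm_ge0 (y - v); rewrite /K in h4; lra.
Qed.

Lemma adherent_rep v T : rep v T -> adherent v.
Proof. by move=> vT e e0; exists v, T; rewrite subrr rnorm0. Qed.

Lemma adherent_lin (c : R[i]) y y' : adherent y -> adherent y' ->
  adherent (c *: y + y').
Proof.
move=> ay ay' e e0; pose K := rnorm c + 1.
have K0 : 0 < K by rewrite /K ltr_wpDl ?rnorm_ge0.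
have [v [T [vT hv]]] := ay _ (divr_gt0 e0 K0).
have [|v' [T' [vT' hv']]] := ay' (e - rnorm c * rnorm (y - v)).
  rewrite subr_gt0; apply: (@le_lt_trans _ _ (rnorm c * (e / K))).
    by rewrite ler_wpM2l ?rnorm_ge0 ?ltW.
  by rewrite mulrCA -[X in _ < X]mulr1 ltr_pM2l// ltr_pdivrMr// mul1r /K ltrDl.
exists (c *: v + v'), (c *: T + T'); split; first exact: (rep_lin repP).
rewrite opprD addrACA -scalerBr; apply: le_lt_trans (rnormD _ _) _.
by rewrite rnormZ; lra.
Qed.

Lemma pairing_addl x x' y : N x -> N x' -> adherent y ->
  pairing (x + x') y = pairing x y + pairing x' y.
Proof.
move=> nx nx' ay; apply: (@pairing_unique _ _ _
    (2 * norm_bound x + 2 * norm_bound x')) => // [|v T vT]; first exact: saD.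
rewrite mulrDl (retrD NA trP (rep_dom nx vT) (rep_dom nx' vT)).2 opprD addrACA.
apply: le_trans (ler_normD _ _) _; rewrite mulrDl.
by apply: lerD; exact: pairing_near.
Qed.

Lemma pairing_scale x (c : R[i]) y : N x -> adherent y -> adherent (c *: y) ->
  pairing x (c *: y) = pairing (c *: x) y.
Proof.
move=> nx ay acy; apply/esym.
apply: (@pairing_unique _ _ _ (2 * norm_bound x * rnorm c)) => // [|v T vT].
  exact: saZ.
rewrite bop_scalerAl -bop_scalerAr -mulrA -rnormZ scalerBr.
apply: pairing_near => //.
have r0 : rep 0 0.
  by have := rep_lin repP (-1) vT vT; rewrite !scaleN1r !addNr.
by rewrite -[c *: v]addr0 -[c *: T]addr0; exact: (rep_lin repP).
Qed.

Lemma pairing_addr x y y' : N x -> adherent y -> adherent y' ->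
  pairing x (y + y') = pairing x y + pairing x y'.
Proof.
move=> nx ay ay'; apply/eqP; rewrite -subr_eq0 -normr_eq0 eq_le normr_ge0 andbT.
apply/ler_addgt0Pr => e e0; rewrite add0r.
have kp := norm_bound_gt0 x; set k := norm_bound x in kp.
have d0 : 0 < e / (8 * k) by rewrite divr_gt0// mulr_gt0.
have [v [T [vT hv]]] := ay _ d0; have [v' [T' [vT' hv']]] := ay' _ d0.
have vv : rep (v + v') (T + T').
  by rewrite -[v]scale1r -[T]scale1r; exact: (rep_lin repP).
have h1 := pairing_near y nx vT; have h2 := pairing_near y' nx vT'.
have h3 := pairing_near (y + y') nx vv.
rewrite mulrDr (retrD NA trP (rep_dom nx vT) (rep_dom nx vT')).2 in h3.
rewrite -/k in h1 h2 h3.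
have hd : rnorm (y + y' - (v + v')) <= rnorm (y - v) + rnorm (y' - v').
  by rewrite opprD addrACA; exact: rnormD.
have hm : 2 * k * rnorm (y + y' - (v + v')) <=
    2 * k * (rnorm (y - v) + rnorm (y' - v')).
  by rewrite ler_wpM2l ?mulr_ge0 ?(ltW kp).
have hk z : z < e / (8 * k) -> 2 * k * z <= e / 4.
  move=> hz; have -> : e / 4 = 2 * k * (e / (8 * k)) by field; rewrite gt_eqF.
  by rewrite ler_wpM2l ?mulr_ge0 ?(ltW kp)// ltW.
have := hk _ hv; have := hk _ hv'; rewrite mulrDr in hm.
move: h1 h2 h3; rewrite !ler_norml => /andP[? ?] /andP[? ?] /andP[? ?] ? ?.
by apply/andP; split; lra.
Qed.

Lemma pairing_le x y k : N x -> adherent y -> 0 <= k -> normle x k ->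
  pairing x y <= 2 * k * rnorm y.
Proof.
move=> nx ay k0 xk; apply/ler_addgt0Pr => e e0.
have kp := norm_bound_gt0 x; pose K := 2 * norm_bound x + 2 * k + 1.
have K0 : 0 < K by rewrite /K; lra.
have [v [T [vT hv]]] := ay _ (divr_gt0 e0 K0).
have h1 := pairing_near y nx vT; have h2 := retr_rep_le nx k0 xk vT.
have h3 : 2 * k * rnorm v <= 2 * k * (rnorm y + rnorm (y - v)).
  rewrite ler_wpM2l ?mulr_ge0//.
  by have := rnormD (v - y) y; rewrite subrK (rnormBC v) addrC.
have h4 : K * rnorm (y - v) <= e by rewrite mulrC -ler_pdivlMr// ltW.
rewrite /K in h4; have := rnorm_ge0 (y - v); rewrite mulrDr in h3.
by move: h1; rewrite ler_norml => /andP[? ?] ?; lra.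
Qed.

Lemma pairing_attained y (e : R) : adherent y -> 0 < e ->
  exists2 u, N u /\ normle u 1 & 2 * rnorm y <= pairing u y + e.
Proof.
move=> ay e0; have e4 : 0 < e / 4 by rewrite divr_gt0.
have [v [T [vT hv]]] := ay _ e4.
have [u [nu u1] uE] := retr_rep_attained vT.
exists u => //; have nyv : adherent (y - v).
  rewrite addrC -scaleN1r; apply: adherent_lin => //; exact: adherent_rep vT.
have nvy : adherent (v - y).
  rewrite addrC -scaleN1r; apply: adherent_lin => //; exact: adherent_rep vT.
have := pairing_le nu nvy ler01 u1; rewrite mulr1.
have vE : pairing u v = 2 * rnorm v.
  have := pairing_near v nu vT; rewrite subrr rnorm0 mulr0 normr_le0 subr_eq0
    uE.
  by move/eqP.
have : pairing u v = pairing u (v - y) + pairing u y.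
  by rewrite -(pairing_addr nu nvy ay) subrK.
rewrite vE (rnormBC v) => h1 h2.
by have := rnormD (y - v) v; rewrite subrK; lra.
Qed.

Definition adherent_pos y := forall e : R, 0 < e ->
  exists v p, [/\ rep v p, pos p & rnorm (y - v) < e].

Lemma adherent_pos_adherent y : adherent_pos y -> adherent y.
Proof. by move=> h e /h[v [p [vp _ hv]]]; exists v, p. Qed.

Lemma pairing_pos x y : N x -> pos (x + adj x) -> adherent_pos y ->
  0 <= pairing x y.
Proof.
move=> nx px py; rewrite -oppr_le0; apply/ler_addgt0Pr => e e0; rewrite add0r.
have kp := norm_bound_gt0 x; pose K := 2 * norm_bound x.
have K0 : 0 < K by rewrite /K; lra.
have [v [p [vp p0 hv]]] := py _ (divr_gt0 e0 K0).
have [fp _] := rep_pos vp p0.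
have h1 := (retr_mul_pos NA trP nx fp).2 px.
have h2 := pairing_near y nx vp.
have h4 : K * rnorm (y - v) <= e by rewrite mulrC -ler_pdivlMr// ltW.
by rewrite /K in h4; move: h2; rewrite ler_norml => /andP[? ?]; lra.
Qed.

Lemma conj_i : ('i : R[i])^* = - 'i.
Proof. by apply/eqP; rewrite eq_complex /= oppr0 !eqxx. Qed.

(** Both i q and - i q have real part zero. *)
Lemma pairing_imaginary q y : N q -> pos q -> adherent_pos y ->
  pairing ('i *: q) y = 0.
Proof.
move=> nq q0 py; have ay := adherent_pos_adherent py.
have niq : N ('i *: q) by exact: saZ.
have niq' : N (- 'i *: q) by exact: saZ.
have z (c : R[i]) : c^* = - c -> pos (c *: q + adj (c *: q)).
  by move=> hc; rewrite adjZ pos_adj// hc scaleNr subrr; exact: pos0.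
have h1 := pairing_pos niq (z _ conj_i) py.
have h2 : 0 <= pairing (- 'i *: q) y.
  by apply: pairing_pos => //; apply: z; rewrite rmorphN /= conj_i.
have h3 := pairing_addl niq niq' ay.
rewrite scaleNr subrr in h3.
have : pairing 0 y = 0.
  apply: (@pairing_unique _ _ _ 0) => // [|v T vT]; first exact: sa0.
  have [f0 t0] := fin_trace0 NA trP.
  by rewrite mul0r (retr_pos NA trP f0).2 t0 mulr0 subrr normr0 mul0r.
by rewrite scaleNr in h2; rewrite h3; lra.
Qed.

(** The vector y21 is not assumed to be the adjoint of y12. What replaces this
    is the first step: the pairing with i q vanishes on the positive vectors
    y11 + m y12 + m^* y21 + y22 with |m| = 1, and m = - i l gives
    pairing (l q) y12 = pairing (l^* q) y21. Positivity at m = - l then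
    concludes. *)
Lemma pairing_mean q y11 y12 y21 y22 (l : R[i]) : N q -> pos q ->
  psd adherent_pos y11 y12 y21 y22 -> adherent y12 -> adherent y21 ->
  rnorm l = 1 -> 2 * pairing (l *: q) y12 <= pairing q (y11 + y22).
Proof.
move=> nq q0 P a12 a21 l1.
have [p11 p22] := psd_diag P.
have [a11 a22] := (adherent_pos_adherent p11, adherent_pos_adherent p22).
have aZ (c : R[i]) y : adherent y -> adherent (c *: y).
  move=> ay; have a0 : adherent 0.
    have := adherent_lin (-1) ay ay; by rewrite scaleN1r addNr.
  by rewrite -[c *: y]addr0; exact: adherent_lin.
have aD y y' : adherent y -> adherent y' -> adherent (y + y').
  by move=> ay ay'; rewrite -[y]scale1r; exact: adherent_lin.
pose z (m : R[i]) := y11 + m *: y12 + m^* *: y21 + y22.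
have zpos m : rnorm m = 1 -> adherent_pos (z m).
  move=> m1; have := P 1 m^*; rewrite rmorph1 !mul1r conjCK.
  have -> : m^* * m = 1 by rewrite mulrC -sqr_rnorm m1 expr1n.
  by rewrite !scale1r.
have zE x m : N x -> pairing x (z m) =
    pairing x y11 + pairing x (m *: y12) + pairing x (m^* *: y21) + pairing x
      y22.
  have aw := aZ m _ a12; have aw' := aZ m^* _ a21.
  move=> nx; rewrite /z (pairing_addr nx (aD _ _ (aD _ _ a11 aw) aw') a22).
  by rewrite (pairing_addr nx (aD _ _ a11 aw) aw') (pairing_addr nx a11 aw).
have niq : N ('i *: q) by exact: saZ.
have sym : pairing (l *: q) y12 = pairing (l^* *: q) y21.
  have n1 : rnorm (- 'i * l) = 1.
    rewrite rnormM rnormN l1 mulr1 /rnorm normc_def /= expr0n add0r expr1n.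
    by rewrite sqrtr1.
  have := pairing_imaginary nq q0 (zpos _ n1).
  rewrite zE// (pairing_imaginary nq q0 p11) (pairing_imaginary nq q0 p22).
  rewrite add0r addr0.
  rewrite !(pairing_scale niq) //; [|exact: aZ|exact: aZ].
  rewrite !scalerA rmorphM rmorphN /= conj_i opprK.
  have ii : 'i * 'i = -1 :> R[i] by rewrite -expr2 sqr_i.
  have -> : - 'i * l * 'i = l by rewrite mulrAC mulNr ii opprK mul1r.
  have -> : 'i * l^* * 'i = - l^* by rewrite mulrAC ii mulN1r.
  have h := pairing_addl (saZ NA l^* nq) (saZ NA (- l^*) nq) a21.
  rewrite scaleNr subrr in h *.
  have p0 : pairing 0 y21 = 0.
    have := pairing_addl (sa0 NA) (sa0 NA) a21; rewrite addr0; lra.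
  by rewrite p0 in h; lra.
have := pairing_pos nq (posD q0 (_ : pos (adj q))) (zpos (- l) _).
rewrite pos_adj// rnormN => /(_ q0 l1); rewrite zE//.
rewrite !(pairing_scale nq) //; [|exact: aZ|exact: aZ].
rewrite rmorphN /= pairing_addr//.
have neg x y : N x -> adherent y -> pairing (- x) y = - pairing x y.
  move=> nx ay; have nNx : N (- x) by rewrite -scaleN1r; exact: saZ.
  have h := pairing_addl nx nNx ay; rewrite subrr in h.
  have p0 : pairing 0 y = 0.
    have := pairing_addl (sa0 NA) (sa0 NA) ay; rewrite addr0; lra.
  by rewrite p0 in h; lra.
rewrite !scaleNr !neg; [|exact: saZ|by []|exact: saZ|by []].
by rewrite -sym; lra.
Qed.

(** The trace norm of y12 is attained on a contraction u; u is replaced by a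
    combination of positive elements q with sum at most 1, for which the
    scalar inequality applies. *)
Lemma mean_inequality_trace (K : set V) :
  (forall y, K y -> adherent_pos y) -> mean_inequality K.
Proof.
move=> hK y11 y12 y21 y22 PK.
have P : psd adherent_pos y11 y12 y21 y22 by move=> al be; exact/hK/PK.
have [p11 p22] := psd_diag P.
have [a11 a22] := (adherent_pos_adherent p11, adherent_pos_adherent p22).
have aD y y' : adherent y -> adherent y' -> adherent (y + y').
  by move=> ay ay'; rewrite -[y]scale1r; exact: adherent_lin.
have a0 : adherent 0.
  have := adherent_lin (-1) a11 a11; by rewrite scaleN1r addNr.
have aZ (c : R[i]) y : adherent y -> adherent (c *: y).
  by move=> ay; rewrite -[c *: y]addr0; exact: adherent_lin.
have half_sum (v w : V) : (2^-1)%:C *: ((v + w) + (v - w)) = v.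
  by rewrite addrACA subrr addr0 half_double.
have aQ (m : R[i]) : rnorm m = 1 -> adherent (m^* *: y12 + m *: y21).
  move=> m1; have := adherent_pos_adherent (P 1 m).
  rewrite rmorph1 !mul1r scale1r (_ : m * m^* = 1); last first.
    by rewrite -sqr_rnorm m1 expr1n.
  rewrite scale1r addrAC [y11 + _ + y22]addrAC -!addrA [y11 + _]addrA => az.
  by have := adherent_lin (-1) (aD _ _ a11 a22) az; rewrite scaleN1r addKr.
have n1 : rnorm (1 : R[i]) = 1 by rewrite /rnorm normr1.
have ni : rnorm ('i : R[i]) = 1.
  by rewrite /rnorm normc_def /= expr0n add0r expr1n sqrtr1.
have ii : 'i * 'i = -1 :> R[i] by rewrite -expr2 sqr_i.
have a1 : adherent (y12 + y21) by have := aQ 1 n1; rewrite rmorph1 !scale1r.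
have ai : adherent (y12 - y21).
  have := aZ 'i _ (aQ 'i ni); rewrite conj_i scalerDr !scalerA mulrN ii opprK.
  by rewrite scale1r scaleN1r.
have a12 : adherent y12 by rewrite -(half_sum y12 y21); exact/aZ/aD.
have a21 : adherent y21.
  rewrite -(half_sum y21 y12); apply/aZ/aD; first by rewrite addrC.
  by rewrite -opprB -scaleN1r; exact: aZ.
pose y0 := y11 + y22; have a_0 : adherent y0 by exact: aD.
have pairing_suml (I : finType) (F : I -> bop H) y : (forall i, N (F i)) ->
    adherent y -> pairing (\sum_i F i) y = \sum_i pairing (F i) y.
  move=> nF ay; suff [] : N (\sum_i F i) /\
    pairing (\sum_i F i) y = \sum_i pairing (F i) y by [].
  elim/big_rec2: _ => [|i r A _ [nA <-]].
    split; first exact: sa0.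
    by have := pairing_addl (sa0 NA) (sa0 NA) ay; rewrite addr0; lra.
  by split; [exact: saD | rewrite pairing_addl].
apply/ler_addgt0Pr => e e0.
have [u [nu u1] hu] := pairing_attained a12 e0.
pose Z := rnorm y12; have Z0 : 0 <= Z by exact: rnorm_ge0.
(* The contraction is shrunk by the factor 1 - d; both d u and the remainder
   of the decomposition then contribute at most 2 d |y12|. *)
pose d := Num.min (e / (4 * (Z + 1))) 2^-1.
have Z1 : 0 < 4 * (Z + 1) by lra.
have d0 : 0 < d by rewrite /d lt_min divr_gt0//=.
have d1 : d <= 2^-1 by rewrite /d ge_min lexx orbT.
have dE : 4 * (Z + 1) * d <= e.
  by rewrite mulrC -ler_pdivlMr// /d ge_min lexx.
have r01 : 0 < 1 - d < 1 by apply/andP; split; lra.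
have r01' : 0 <= 1 - d <= 1 by apply/andP; split; lra.
have [n hn] := pow_small r01 d0.
pose A := (1 - d)%:C *: u.
have A1 : normle A (1 - d) by apply: normle_shrink => //; lra.
have nA : N A by exact: saZ.
have ncA j k : N (bop_kernel A j k).
  by apply: saM => //; apply: saX => //; exact: sa_adj.
have ker : herglotz_kernel [set q | N q /\ pos q] (bop_kernel A) 1 A.
  have [|c0 c1 cn hz] := @bop_herglotz_kernel _ _ A.
    by move=> x; apply: le_trans (A1 x) _; rewrite ler_wpM2r ?rnorm_ge0//; lra.
  split=> // m z z1; split; last exact: hz.
  by apply: sa_sum => // j; apply: sa_sum => // k; apply: saZ => //; exact: saB.
have [|m [l [p [l1 pK [nS pS] hS]]]] :=
    herglotz_kernel_decomposition (K := [set q | N q /\ pos q]) _ n ker.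
  by move=> t q t0 [nq q0]; split; [exact: saZ | exact: posZ].
have nlp i : N (l i *: p i) by apply: saZ => //; case: (pK i).
have uE : u = \sum_i l i *: p i + bop_kernel A n n.+1 + d%:C *: u.
  rewrite -hS [\sum_i _ + _]addrC subrK /A -scalerDl -rmorphD /= subrK.
  by rewrite scale1r.
have nB : N (bop_kernel A n n.+1) by [].
have nC : N (d%:C *: u) by exact: saZ.
have nSl : N (\sum_i l i *: p i) by exact: sa_sum.
have e1 : pairing u y12 = \sum_i pairing (l i *: p i) y12 +
    pairing (bop_kernel A n n.+1) y12 + pairing (d%:C *: u) y12.
  rewrite {1}uE (pairing_addl (saD NA nSl nB) nC a12) (pairing_addl nSl nB a12).
  by rewrite pairing_suml.
have e2 : pairing (bop_kernel A n n.+1) y12 <= 2 * d * Z.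
  apply: (pairing_le nB a12 (ltW d0)) => x.
  apply: le_trans (normle_bop_kernel n r01' A1 x) _.
  by rewrite ler_wpM2r ?rnorm_ge0.
have e3 : pairing (d%:C *: u) y12 <= 2 * d * Z.
  by apply: (pairing_le nC a12 (ltW d0)); apply: normle_shrink => //; exact:
    ltW.
have e4 : 2 * \sum_i pairing (l i *: p i) y12 <= 2 * rnorm y0.
  apply: (@le_trans _ _ (\sum_i pairing (p i) y0)).
    rewrite mulr_sumr; apply: ler_sum => i _; have [np p0] := pK i.
    exact: (pairing_mean np p0 P a12 a21 (l1 i)).
  have nP : N (\sum_i p i) by apply: sa_sum => // i; case: (pK i).
  rewrite -pairing_suml//; last by move=> i; case: (pK i).
  have := pairing_le (sa1 NA) a_0 ler01 (@normle1 R H); rewrite mulr1.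
  rewrite -[X in pairing X y0](subrK (\sum_i p i) 1) (pairing_addl nS nP a_0).
  have pos0' y : adherent_pos y -> 0 <= pairing (1 - \sum_i p i) y.
    by move=> py; apply: pairing_pos => //; apply: posD => //; rewrite pos_adj.
  have := pos0' _ p11; have := pos0' _ p22.
  have := pairing_addr nS a11 a22; rewrite -/y0.
  move: (pairing _ y11) (pairing _ y22) (pairing _ y0) (pairing _ y0).
  by move=> r1 r2 r3 r4 *; lra.
have := rnormD y11 y22; rewrite -/y0 -/Z in hu *; rewrite e1 in hu.
by move: (\sum_i pairing _ _) (pairing _ _) (pairing _ _) e2 e3 e4 hu => *; nra.
Qed.

(** On positive operators the norm is the trace. *)
Lemma rep_pos_superadditive v w p q : rep v p -> rep w q -> pos p -> pos q ->
  rnorm v + rnorm w <= rnorm (v + w).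
Proof.
move=> vp wq p0 q0; have [fp <-] := rep_pos vp p0; have [fq <-] := rep_pos wq
  q0.
have vw : rep (v + w) (p + q).
  by rewrite -[v]scale1r -[p]scale1r; exact: (rep_lin repP).
have [_ <-] := rep_pos vw (posD p0 q0).
by rewrite (fin_traceD NA trP fp fq).2.
Qed.

End TraceNorm.

(** * Von Neumann algebras and their noncommutative L^1-spaces *)

(** The operators with modulus of finite trace form a linear space: if w is the
    phase of W = c T + S, then the modulus of W is the hermitian element
    w^* (c T + S), a combination of products of elements of finite trace with
    bounded ones. *)
Lemma sa_ideal (R : realType) (H : hilbertSpace R) (N : set (bop H)) tr
    (c : R[i]) (T S b b' : bop H) :
  strong_algebra N -> trace_on N tr ->
  N T -> fin_trace N tr b -> adj T * T = b * b ->
  N S -> fin_trace N tr b' -> adj S * S = b' * b' ->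
  exists2 d, fin_trace N tr d & adj (c *: T + S) * (c *: T + S) = d * d.
Proof.
move=> NA trP nT fb Tb nS fb' Sb.
have [nb b0 _] := fb; have [nb' b0' _] := fb'.
have [u nu [_ ub _]] := polar NA nT nb b0 Tb.
have [u' nu' [_ ub' _]] := polar NA nS nb' b0' Sb.
set W := c *: T + S; have nW : N W by exact: sa_lin.
have nWW : N (adj W * W) by apply: saM => //; exact: sa_adj.
have [d nd [d0 dd]] := sqrt_exists NA nWW (pos_adjM W).
have [w nw [_ _ wW]] := polar NA nW nd d0 (esym dd).
exists d => //; apply: (fin_trace_in_dom NA trP) => //.
have -> : d = (c *: (adj w * u)) * b + (adj w * u') * b'.
  by rewrite -wW /W mulrDr bop_scalerAr bop_scalerAl -!mulrA ub ub'.
have naw : N (adj w) by exact: sa_adj.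
apply: (retrD NA trP _ _).1; apply: (in_dom_mul NA trP) => //.
  by apply: saZ => //; exact: saM.
exact: saM.
Qed.

Lemma rnorm_bound_opnorm (R : realType) (H : hilbertSpace R) (A : bop H) x :
  rnorm (A x) <= opnorm A * rnorm x.
Proof.
have [->|x0] := eqVneq x 0; first by rewrite bop0r !rnorm0 mulr0.
have xp : 0 < rnorm x.
  by rewrite lt_def rnorm_ge0 andbT; apply: contra_neq x0 => /rnorm0_eq0.
rewrite -ler_pdivrMr//.
have -> : rnorm (A x) / rnorm x = rnorm (A ((rnorm x)^-1%:C *: x)).
  by rewrite bopZr rnormZ rnormR ger0_norm ?invr_ge0 ?rnorm_ge0// mulrC.
apply: rnorm_le_opnorm; first exact: bopP.
by rewrite rnormZ rnormR ger0_norm ?invr_ge0 ?rnorm_ge0// mulVf// gt_eqF.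
Qed.

Section VonNeumann.
Context (R : realType) (M : vonNeumannAlgebra R).
Local Notation H := (vn_space M).
Implicit Types (a b x y : M).

Lemma vn_rep_bounded a : bounded_op (vn_rep a).
Proof.
have : range (@vn_rep R M) (vn_rep a) by exists a.
by rewrite -vn_bicommutant => -[].
Qed.

Definition vop a : bop H := mkbop (vn_rep_bounded a).

Lemma vop_lin c x y : vop (c *: x + y) = c *: vop x + vop y.
Proof. by apply: bop_ext => h; rewrite /= vn_rep_linear. Qed.

Lemma vopM x y : vop (smul x y) = vop x * vop y.
Proof. by apply: bop_ext => h; rewrite /= vn_rep_mul. Qed.

Lemma vop_star x : vop (star x) = adj (vop x).
Proof. by apply: adj_unique; exact: vn_rep_star. Qed.

Lemma vop0 : vop 0 = 0.
Proof. by have := vop_lin (-1) 0 0; rewrite scaler0 addr0 scaleN1r addNr. Qed.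

Lemma vopD x y : vop (x + y) = vop x + vop y.
Proof. by rewrite -[x]scale1r vop_lin !scale1r. Qed.

Lemma vopZ c x : vop (c *: x) = c *: vop x.
Proof. by rewrite -[c *: x]addr0 vop_lin vop0 addr0. Qed.

Lemma vopB x y : vop (x - y) = vop x - vop y.
Proof. by rewrite vopD -scaleN1r vopZ scaleN1r. Qed.

Lemma vop_sum (I : finType) (F : I -> M) : vop (\sum_i F i) = \sum_i vop (F i).
Proof. by elim/big_rec2: _ => [|i y z _ <-]; [exact: vop0 | exact: vopD]. Qed.

Lemma rnorm_vop_le x k : 0 <= k -> normle (vop x) k -> rnorm x <= k.
Proof.
move=> k0 xk; rewrite vn_rep_norm; apply: opnorm_le => h h1.
by apply: le_trans (xk h) _; rewrite ler_piMr.
Qed.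

Lemma normle_vop x : normle (vop x) (rnorm x).
Proof. by move=> h; rewrite vn_rep_norm; exact: (rnorm_bound_opnorm (vop x)).
  Qed.

Lemma vop_inj : injective vop.
Proof.
move=> x y xy; apply/eqP; rewrite -subr_eq0; apply/eqP/rnorm0_eq0/le_anti.
rewrite rnorm_ge0 andbT; apply: rnorm_vop_le => // h.
by rewrite vopB xy subrr mul0r bop0E rnorm0.
Qed.

(** The bicommutant property makes the image closed under strong limits. *)
Lemma vop_strong_algebra : strong_algebra (range vop).
Proof.
have inN (A : bop H) :
    commutant (commutant (range (@vn_rep R M))) A -> range vop A.
  rewrite vn_bicommutant => -[x _ xA]; exists x => //.
  by apply: bop_ext => h; rewrite /= xA.
split.
- by apply: inN; split=> [|U _]; [exact: bopP | apply/funext].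
- by move=> c _ _ [x _ <-] [y _ <-]; exists (c *: x + y) => //; exact: vop_lin.
- by move=> _ _ [x _ <-] [y _ <-]; exists (smul x y) => //; exact: vopM.
- by move=> _ [x _ <-]; exists (star x) => //; exact: vop_star.
move=> u A uN uA; apply: inN; split=> [|U [bU hU]]; first exact: bopP.
apply/funext => h /=.
have hl : (fun n => u n (U h)) @ \oo --> U (A h).
  have -> : (fun n => u n (U h)) = U \o (fun n => u n h).
    apply/funext => n /=; have [x _ <-] := uN n.
    by have /(congr1 (@^~ h)) := hU (vn_rep x) (ex_intro2 _ _ x I erefl).
  exact: cvg_bounded_op (uA h).
by apply: (cvg_unique _ (uA (U h)) hl); exact: norm_hausdorff.
Qed.

Lemma vn_unit : exists e : M, vop e = 1.
Proof. by have [e _ <-] := sa1 vop_strong_algebra; exists e. Qed.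

Lemma vn_pos0 : vn_pos (0 : M).
Proof. by rewrite /vn_pos /= -/(pos (vop 0)) vop0; exact: pos0. Qed.

Lemma vn_posD x y : vn_pos x -> vn_pos y -> vn_pos (x + y).
Proof.
by rewrite /vn_pos /= -!/(pos (vop _)) vopD; exact: posD.
Qed.

Lemma vn_pos_unit e : vop e = 1 -> vn_pos e /\ rnorm e <= 1.
Proof.
move=> e1; split; first by rewrite /vn_pos /= -/(pos (vop e)) e1; exact: pos1.
by apply: rnorm_vop_le; rewrite // e1; exact: normle1.
Qed.

Lemma approx_vn e : vop e = 1 -> approx_by_positives (@vn_pos R M) e.
Proof.
move=> e1; have NA := vop_strong_algebra.
apply: approx_of_kernels => [t x t0|a r a1 /andP[r0 r1]].
  by rewrite /vn_pos /= -!/(pos (vop _)) vopZ; exact: posZ.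
pose A := vop (r%:C *: a).
have Ar : normle A r.
  rewrite /A vopZ; apply: normle_shrink; first exact: ltW.
  by move=> h; apply: le_trans (normle_vop a h) _; rewrite ler_wpM2r ?rnorm_ge0.
have nA : range vop A by exists (r%:C *: a).
have nc j k : range vop (bop_kernel A j k).
  by apply: saM => //; apply: saX => //; exact: sa_adj.
pose c j k := projT1 (cid2 (nc j k)).
have cE j k : vop (c j k) = bop_kernel A j k by rewrite /c; case: cid2.
have r01 : 0 <= r <= 1 by rewrite !ltW.
exists c; last first.
  move=> n; apply: rnorm_vop_le; first by rewrite exprn_ge0// ltW.
  by rewrite cE; exact: normle_bop_kernel.
have [|k0 k1 kn kh] := @bop_herglotz_kernel _ _ A.
  by move=> h; apply: le_trans (Ar h) _; rewrite ler_wpM2r ?rnorm_ge0// ltW.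
split.
- by apply: vop_inj; rewrite cE k0 e1.
- by apply: vop_inj; rewrite cE k1.
- by move=> n; rewrite /vn_pos /= -/(pos (vop _)) cE.
move=> n z z1; rewrite /vn_pos /= -/(pos (vop _)).
have := kh n z z1; rewrite /herglotz_sum vop_sum.
under [in X in _ -> X]eq_bigr => j _.
  rewrite vop_sum; under eq_bigr do rewrite vopZ vopB !cE.
  over.
by [].
Qed.

End VonNeumann.

Section NoncommutativeL1.
Context (R : realType) (M : vonNeumannAlgebra R).
Variables (rho : M -> \bar R) (V : completeNormedModType R[i]) (iota : M -> V).
Hypotheses (rho_trace : is_trace rho) (iota_L1 : is_nc_L1 rho iota).
Local Notation H := (vn_space M).
Local Notation N := (range (@vop R M)).

(** The value 0 is for operators outside the image of M. *)
Definition vop_trace (A : bop H) : \bar R :=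
  rho (xget 0 [set a : M | vop a = A]).

Lemma vop_traceE a : vop_trace (vop a) = rho a.
Proof.
rewrite /vop_trace; congr rho; apply: vop_inj.
by apply: (xgetPex 0 (ex_intro (fun b : M => vop b = vop a) a erefl)).
Qed.

Lemma vop_trace_on : trace_on N vop_trace.
Proof.
split.
- by move=> _ [a _ <-] pa; rewrite vop_traceE; exact: trace_ge0.
- move=> _ _ [a _ <-] [b _ <-] pa pb; rewrite -vopD !vop_traceE.
  exact: traceD.
- by move=> l _ l0 [a _ <-] pa; rewrite -vopZ !vop_traceE; exact: traceZ.
- move=> _ [a _ <-]; rewrite -vop_star -!vopM !vop_traceE.
  exact: trace_star.
Qed.

Lemma is_abs_vop (a b : M) : is_abs a b <->
  pos (vop b) /\ adj (vop a) * vop a = vop b * vop b.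
Proof.
rewrite -vop_star -!vopM; split=> -[pb ab]; first by rewrite ab.
by split=> //; exact: vop_inj.
Qed.

Definition nc_L1_rep (v : V) (T : bop H) :=
  exists a : M, [/\ trace_ideal rho a, vop a = T & iota a = v].

Lemma nc_L1_trace_norm_rep : trace_norm_rep N vop_trace nc_L1_rep.
Proof.
split; last first.
  move=> _ _ [a [ia <- <-]]; split; first by exists a.
  have [b [ab rb]] := ia; exists (vop b).
  have [pb abE] := (is_abs_vop a b).1 ab.
  split=> //.
  by rewrite vop_traceE (nc_L1_norm iota_L1 ia ab).
move=> c _ _ _ _ [a [ia <- <-]] [b [ib <- <-]].
exists (c *: a + b); split; [|exact: vop_lin|exact: (nc_L1_linear iota_L1)].
have [a' [aa' ra]] := ia; have [b' [bb' rb]] := ib.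
have [pa' ea] := (is_abs_vop _ _).1 aa'; have [pb' eb] := (is_abs_vop _ _).1
  bb'.
have fa : fin_trace N vop_trace (vop a').
  by split; [exists a' | | rewrite vop_traceE].
have fb : fin_trace N vop_trace (vop b').
  by split; [exists b' | | rewrite vop_traceE].
have [||_ [[d _ <-] d0 td] dE] := @sa_ideal _ _ _ _ c (vop a) (vop b) _ _
  (@vop_strong_algebra R M) vop_trace_on _ fa ea _ fb eb.
- by exists a.
- by exists b.
exists d; split; last by rewrite -vop_traceE.
by apply/is_abs_vop; rewrite vop_lin.
Qed.

Lemma mean_inequality_nc_L1 : mean_inequality (nc_L1_cone rho iota).
Proof.
apply: (mean_inequality_trace (@vop_strong_algebra R M) vop_trace_on
  nc_L1_trace_norm_rep) => y Ky e e0.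
have e0C : 0 < e%:C :> R[i] by rewrite ltcR.
have [_ [[a [ia pa] <-] hv]] := Ky _ (nbhsx_ballx y _ e0C).
exists (iota a), (vop a); split=> //; first by exists a.
by move: hv; rewrite -ball_normE /= normE ltcR.
Qed.

End NoncommutativeL1.

(** * Orthonormal bases and trace-class operators *)

Section Parseval.
Context (R : realType) (H : hilbertSpace R).
Implicit Types (x y e f : H) (B : set H).

Definition ortho_proj (l : seq H) x : H := \sum_(e <- l) inner x e *: e.

Lemma inner_sum_seql (T : Type) (l : seq T) (F : T -> H) y :
  inner (\sum_(t <- l) F t) y = \sum_(t <- l) inner (F t) y.
Proof.
elim: l => [|t l IH]; first by rewrite !big_nil inner0l.
by rewrite !big_cons innerDl IH.
Qed.

Lemma inner_sum_seqr (T : Type) (l : seq T) (F : T -> H) y :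
  inner y (\sum_(t <- l) F t) = \sum_(t <- l) inner y (F t).
Proof.
elim: l => [|t l IH]; first by rewrite !big_nil inner0r.
by rewrite !big_cons innerDr IH.
Qed.

Variable B : set H.
Hypothesis HB : orthonormal_basis B.

Lemma ortho_proj_perp l x e : uniq l -> (forall f, f \in l -> B f) ->
  e \in l -> inner (x - ortho_proj l x) e = 0.
Proof.
have [B1 B0 _] := HB; move=> ul lB el.
rewrite innerBl inner_sum_seql (bigD1_seq e)//= innerZl B1 ?mulr1; last exact:
  lB.
rewrite big1_seq ?addr0 ?subrr// => f /andP[fe fl].
by rewrite innerZl (B0 _ _ (lB _ fl) (lB _ el) fe) mulr0.
Qed.

Lemma pythagoras x y : inner x y = 0 ->
  rnorm (x + y) ^+ 2 = rnorm x ^+ 2 + rnorm y ^+ 2.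
Proof. by move=> xy; rewrite rnormD_sqr xy mulr0 addr0. Qed.

Lemma sqr_ortho_proj l x : uniq l -> (forall f, f \in l -> B f) ->
  rnorm x ^+ 2 = rnorm (x - ortho_proj l x) ^+ 2 +
    \sum_(e <- l) rnorm (inner x e) ^+ 2.
Proof.
move=> ul lB; set p := ortho_proj l x.
have perp : inner (x - p) p = 0.
  rewrite {2}/p inner_sum_seqr big1_seq// => e /andP[_ el].
  by rewrite innerZr (ortho_proj_perp x ul lB el) mulr0.
rewrite -[in LHS](subrK p x) (pythagoras perp); congr (_ + _).
apply: (@complexI R); rewrite -innerxx.
have -> : inner p p = inner x p.
  by apply/eqP; rewrite -subr_eq0 -oppr_eq0 opprB -innerBl perp.
rewrite /p inner_sum_seqr rmorph_sum; apply: eq_bigr => e _.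
by rewrite innerZr mulrC -sqr_rnorm.
Qed.

Lemma bessel l x : uniq l -> (forall f, f \in l -> B f) ->
  \sum_(e <- l) rnorm (inner x e) ^+ 2 <= rnorm x ^+ 2.
Proof. by move=> ul lB; rewrite (sqr_ortho_proj x ul lB) lerDr sqr_ge0. Qed.

Definition finite_combination s := exists2 l : seq (R[i] * H),
  (forall ce, ce \in l -> B ce.2) & s = \sum_(ce <- l) ce.1 *: ce.2.

(** The projection of x on the closed span of B differs from x by a vector
    orthogonal to B, so it is x. *)
Lemma basis_dense x (d : R) : 0 < d ->
  exists2 s, finite_combination s & rnorm (x - s) < d.
Proof.
have [B1 B0 Bmax] := HB; move=> d0.
have [||||z [zS hz]] := @riesz_subspace R H finite_combination
  (fun y => inner y x) (rnorm x).
- by exists [::] => //; rewrite big_nil.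
- move=> a _ _ [l lB ->] [l' lB' ->].
  exists ([seq (a * ce.1, ce.2) | ce <- l] ++ l').
    by move=> ce; rewrite mem_cat => /orP[/mapP[ce' /lB ? ->]|/lB'].
  rewrite big_cat big_map scaler_sumr; congr (_ + _).
  by apply: eq_bigr => ce _; rewrite scalerA.
- by move=> a y w; rewrite inner_linear.
- by move=> y; rewrite mulrC; exact: inner_cs.
suff -> : x = z by exact: zS.
apply/eqP; rewrite -subr_eq0; apply/eqP/Bmax => e Be.
have fe : finite_combination e.
  exists [:: (1, e)]; first by move=> ce; rewrite inE => /eqP->.
  by rewrite big_seq1 scale1r.
by rewrite -innerJ innerBr hz// subrr rmorph0.
Qed.

(** By Bessel's inequality and the density of the span of B. *)
Lemma parseval x :
  (\esum_(e in B) (rnorm (inner x e) ^+ 2)%:E = (rnorm x ^+ 2)%:E)%E.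
Proof.
apply/le_anti/andP; split.
  apply: ge_ereal_sup => _ [X [fX XB] <-]; rewrite fsbig_finite//= sumEFin
    lee_fin.
  apply: bessel; first exact: finmap.fset_uniq.
  by move=> f; rewrite in_fset_set// inE => /XB.
apply/lee_addgt0Pr => d d0.
have sd0 : 0 < Num.sqrt d by rewrite sqrtr_gt0.
have [s [l lB sE] hs] := basis_dense x sd0.
pose k := undup [seq ce.2 | ce <- l].
have uk : uniq k by exact: undup_uniq.
have kB f : f \in k -> B f.
  by rewrite mem_undup => /mapP[ce /lB ? ->].
have xk := sqr_ortho_proj x uk kB; set p := ortho_proj k x in xk.
have perp : inner (x - p) (p - s) = 0.
  rewrite innerBr {2}/p /ortho_proj inner_sum_seqr big1_seq => [|e /andP[_ ek]].
    rewrite sub0r sE inner_sum_seqr big1_seq ?oppr0// => ce /andP[_ cel].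
    rewrite innerZr (ortho_proj_perp x uk kB) ?mulr0// mem_undup.
    by apply/mapP; exists ce.
  by rewrite innerZr (ortho_proj_perp x uk kB ek) mulr0.
have hd : rnorm (x - p) ^+ 2 <= d.
  have := pythagoras perp; rewrite addrA subrK => e.
  have h2 : rnorm (x - s) ^+ 2 <= d.
    by rewrite -(sqr_sqrtr (ltW d0)) ler_sqr ?nnegrE ?rnorm_ge0 ?sqrtr_ge0//
      ltW.
  by have := sqr_ge0 (rnorm (p - s)); lra.
apply: (@le_trans _ _ ((\sum_(e <- k) rnorm (inner x e) ^+ 2)%:E + d%:E)%E).
  by rewrite -EFinD lee_fin xk addrC lerD2l.
apply: leeD2r; apply: esum_ge; exists [set` k].
  by split; [exact: finite_seq | move=> f /= /kB].
by rewrite -fsbig_seq// sumEFin.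
Qed.

End Parseval.

Section HilbertSchmidt.
Context (R : realType) (H : hilbertSpace R).
Implicit Types (A : bop H) (B : set H).

(** Parseval for B', an exchange with a finite sum over B, and Bessel for B. *)
Lemma hilbert_schmidt_le B B' A : orthonormal_basis B -> orthonormal_basis B' ->
  (\esum_(e in B) (rnorm (A e) ^+ 2)%:E <=
   \esum_(f in B') (rnorm (adj A f) ^+ 2)%:E)%E.
Proof.
move=> HB HB'; apply: ge_ereal_sup => _ [X [fX XB] <-].
rewrite fsbig_finite//=.
under eq_bigr do rewrite -(parseval HB').
rewrite -esum_sum; last by move=> f e _ _; rewrite lee_fin sqr_ge0.
apply: le_esum => f _; rewrite sumEFin lee_fin.
have lB e : e \in finmap.enum_fset (fset_set X) -> B e by rewrite in_fset_set//
  inE => /XB.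
apply: le_trans (bessel HB (adj A f) (finmap.fset_uniq _) lB).
by apply: ler_sum => e _; rewrite adjP -innerJ rnormJ.
Qed.

Lemma hilbert_schmidt_eq B B' A : orthonormal_basis B -> orthonormal_basis B' ->
  (\esum_(e in B) (rnorm (A e) ^+ 2)%:E =
   \esum_(f in B') (rnorm (adj A f) ^+ 2)%:E)%E.
Proof.
move=> HB HB'; apply/le_anti; rewrite hilbert_schmidt_le//=.
by have := hilbert_schmidt_le (adj A) HB' HB; rewrite adjK.
Qed.

Definition basis_trace B A : \bar R :=
  (\esum_(e in B) (complex.Re (inner (A e) e))%:E)%E.

Lemma basis_trace_adjM B A :
  basis_trace B (adj A * A) = (\esum_(e in B) (rnorm (A e) ^+ 2)%:E)%E.
Proof.
by apply: eq_esum => e _; rewrite bopE adjPr Re_innerxx.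
Qed.

Lemma strong_algebraT : strong_algebra [set: bop H].
Proof. by split. Qed.

Lemma pos_sqrt A : pos A -> exists2 s, pos s & s * s = A.
Proof.
by move=> pA; have [s _ [? ?]] := sqrt_exists strong_algebraT I pA; exists s.
Qed.

(** Written as s^* s, a positive operator has the squared Hilbert-Schmidt norm
    of s as its trace. *)
Lemma basis_trace_indep B B' A : orthonormal_basis B -> orthonormal_basis B' ->
  pos A -> basis_trace B A = basis_trace B' A.
Proof.
move=> HB HB' /pos_sqrt[s s0 <-].
rewrite -{1 3}(pos_adj s0) !basis_trace_adjM (hilbert_schmidt_eq s HB HB').
by rewrite pos_adj.
Qed.

Lemma esumZ_le (T : choiceType) (D : set T) (g : T -> \bar R) (l : R) : 0 <= l
  ->
  (forall t, D t -> 0 <= g t)%E ->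
  (\esum_(t in D) (l%:E * g t) <= l%:E * \esum_(t in D) g t)%E.
Proof.
move=> l0 g0; apply: ge_ereal_sup => _ [X [fX XD] <-].
rewrite fsbig_finite//= big_seq_cond -ge0_sume_distrr; last first.
  by move=> t /andP[]; rewrite in_fset_set// inE => /XD /g0.
apply: lee_wpmul2l; rewrite ?lee_fin//; apply: esum_ge; exists X => //.
by rewrite [leRHS]fsbig_finite//= [leRHS]big_seq_cond.
Qed.

Lemma basis_trace_on B : orthonormal_basis B ->
  trace_on [set: bop H] (basis_trace B).
Proof.
move=> HB; have Re0 A e : pos A -> (0 <= (complex.Re (inner (A e) e))%:E)%E.
  by move=> /(_ e); rewrite lee_fin lecE /= => /andP[].
split.
- by move=> A _ pA; apply: esum_ge0 => e _; exact: Re0.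
- move=> A A' _ _ pA pA'; rewrite /basis_trace -esumD; last 2 first.
  + by move=> e _; exact: Re0.
  + by move=> e _; exact: Re0.
  apply: eq_esum => e _; rewrite bopE innerDl.
  by case: (inner (A e) e) (inner (A' e) e) => [? ?] [? ?].
- have le (l : R) A : 0 <= l -> pos A ->
      (basis_trace B (l%:C *: A) <= l%:E * basis_trace B A)%E.
    move=> l0 pA; apply: le_trans (esumZ_le _ _); rewrite ?lee_fin//; last
      first.
      by move=> e _; exact: Re0.
    apply: le_esum => e _; rewrite -EFinM lee_fin bopE innerZl.
    by case: (inner (A e) e) => ? ? /=; lra.
  move=> l A l0 _ pA; apply/le_anti; rewrite le//=.
  have [<-|ln0] := eqVneq 0 l.
    by rewrite mul0e; apply: esum_ge0 => e _; apply: Re0; exact: posZ.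
  have lp : 0 < l by rewrite lt_def eq_sym ln0.
  rewrite -lee_pdivlMl//; have li0 : 0 <= l^-1 by rewrite invr_ge0.
  have := le _ _ li0 (posZ l0 pA).
  by rewrite scalerA -rmorphM /= mulVf 1?eq_sym// scale1r.
move=> A _; rewrite basis_trace_adjM -[X in basis_trace B (X * _)](adjK A)
  basis_trace_adjM.
exact: hilbert_schmidt_eq.
Qed.

Variables (F : normedModType R[i]) (JF : F -> H -> H).
Hypothesis JF_trace : is_trace_class JF.

Lemma trace_class_basis : exists B, orthonormal_basis B.
Proof.
by have [P [B [_ HB _]]] := trace_class_norm JF_trace 0; exists B.
Qed.

Definition trace_class_op (v : F) : bop H :=
  mkbop (trace_class_bounded JF_trace v).

Lemma trace_class_rep B : orthonormal_basis B ->
  trace_norm_rep [set: bop H] (basis_trace B) (fun v T => trace_class_op v = T).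
Proof.
move=> HB; split.
  move=> c v w _ _ <- <-; apply: bop_ext => x.
  by rewrite /= (trace_class_linear JF_trace).
move=> v _ <-; split=> //.
have [P [B' [[bP posP [S [adjS PP]]] HB' tE]]] := trace_class_norm JF_trace v.
have p0 : pos (mkbop bP) by [].
exists (mkbop bP); split=> //; last first.
  by rewrite (basis_trace_indep HB HB' p0) tE.
apply: bop_ext => x; have /(congr1 (@^~ x)) /= -> := PP.
by apply: inner_ext => y; rewrite -adjP /= -adjS.
Qed.

Lemma mean_inequality_trace_class : mean_inequality (trace_class_cone JF).
Proof.
have [B HB] := trace_class_basis.
apply: (mean_inequality_trace strong_algebraT (basis_trace_on HB)
  (trace_class_rep HB)) => y Ky d d0.
by exists y, (trace_class_op y); split=> //; rewrite subrr rnorm0.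
Qed.

Lemma superadditive_trace_class : superadditive_norm (trace_class_cone JF).
Proof.
have [B HB] := trace_class_basis.
move=> y y' Ky Ky'.
exact: (rep_pos_superadditive strong_algebraT (basis_trace_on HB)
  (trace_class_rep HB) erefl erefl).
Qed.

End HilbertSchmidt.

(** * The theorem *)

Theorem proposition3p1 (R : realType) (X : lmodType R[i])
    (Omega Upsilon : topologicalType)
    (Omega_lc : locally_compact [set: Omega])
    (Omega_hausdorff : hausdorff_space Omega)
    (Upsilon_lc : locally_compact [set: Upsilon])
    (Upsilon_hausdorff : hausdorff_space Upsilon)
    (M M' : vonNeumannAlgebra R)
    (rho : M -> \bar R) (rho_trace : is_trace rho)
    (rho_faithful : faithful rho) (rho_semifinite : semifinite rho)
    (H : hilbertSpace R) (H_separable : separable H) :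
  (* (1) Y = L^2(Omega, mu), for any measure mu on any sigma-algebra <<s G>> *)
  (forall (A : starAlgebra R) (Y : orderedBanachBimodule A)
      (w : Omega) (G : set (set (pointed_at w)))
      (mu : {measure set (g_sigma_algebraType G) -> \bar R})
      (J : Y -> Omega -> R[i]),
    is_Lp mu 2 J -> cone Y = Lp_cone mu J -> cauchy_schwarz X Y) /\
  (* (2) Y = B(M, B_1(H)) over M *)
  (forall (F : completeNormedModType R[i]) (JF : F -> H -> H),
    is_trace_class JF ->
    forall (Y : orderedBanachBimodule M) (J : Y -> M -> F),
    is_B J -> cone Y = B_cone (@vn_pos R M) (trace_class_cone JF) J ->
    B_action J -> cauchy_schwarz X Y) /\
  (* (3) Y = M^* *)
  (forall (A : starAlgebra R) (Y : orderedBanachBimodule A)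
      (J : Y -> M -> R[i]^o),
    is_dual J -> cone Y = dual_cone J -> cauchy_schwarz X Y) /\
  (* (4) Y = M(Omega) over C(Omega) *)
  (forall (A : starAlgebra R) (J0 : A -> Omega -> R[i]),
    is_C_algebra J0 ->
    forall (Y : orderedBanachBimodule A) (J : Y -> set Omega -> R[i]),
    is_radon_measures J -> cone Y = radon_cone J ->
    radon_action J0 J -> cauchy_schwarz X Y) /\
  (* (5) Y = B(M, M(Omega)) over M *)
  (forall (F : completeNormedModType R[i]) (JF : F -> set Omega -> R[i]),
    is_radon_measures JF ->
    forall (Y : orderedBanachBimodule M) (J : Y -> M -> F),
    is_B J -> cone Y = B_cone (@vn_pos R M) (radon_cone JF) J ->
    B_action J -> cauchy_schwarz X Y) /\
  (* (6) Y = B(C(Omega), C(Upsilon)) *)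
  (forall (E F : completeNormedModType R[i])
      (JE : E -> Omega -> R[i]) (JF : F -> Upsilon -> R[i]),
    is_C JE -> is_C JF ->
    forall (A : starAlgebra R) (Y : orderedBanachBimodule A) (J : Y -> E -> F),
    is_B J -> cone Y = B_cone (C_cone JE) (C_cone JF) J ->
    cauchy_schwarz X Y) /\
  (* (6) Y = B(M, C(Omega)) *)
  (forall (F : completeNormedModType R[i]) (JF : F -> Omega -> R[i]),
    is_C JF ->
    forall (A : starAlgebra R) (Y : orderedBanachBimodule A) (J : Y -> M -> F),
    is_B J -> cone Y = B_cone (@vn_pos R M) (C_cone JF) J ->
    cauchy_schwarz X Y) /\
  (* (7) Y = L^1(rho) *)
  (forall (A : starAlgebra R) (Y : orderedBanachBimodule A) (iota : M -> Y),
    is_nc_L1 rho iota -> cone Y = nc_L1_cone rho iota ->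
    cauchy_schwarz X Y) /\
  (* (7) Y = L^1(Omega, mu) *)
  (forall (A : starAlgebra R) (Y : orderedBanachBimodule A)
      (w : Omega) (G : set (set (pointed_at w)))
      (mu : {measure set (g_sigma_algebraType G) -> \bar R})
      (J : Y -> Omega -> R[i]),
    is_Lp mu 1 J -> cone Y = Lp_cone mu J -> cauchy_schwarz X Y) /\
  (* (8) Y = B(M, M'^* ) over M *)
  (forall (F : completeNormedModType R[i]) (JF : F -> M' -> R[i]^o),
    is_dual JF ->
    forall (Y : orderedBanachBimodule M) (J : Y -> M -> F),
    is_B J -> cone Y = B_cone (@vn_pos R M) (dual_cone JF) J ->
    B_action J -> cauchy_schwarz X Y) /\
  (* (9) Y = Y_0 = l_2(C(Omega)), Omega compact *)
  (compact [set: Omega] ->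
    forall (A : starAlgebra R) (J0 : A -> nat -> Omega -> R[i]),
    is_l2C_algebra J0 ->
    forall (Y : orderedBanachBimodule A) (J : Y -> nat -> Omega -> R[i]),
    is_l2C J -> cone Y = l2C_cone J -> l2C_action J0 J ->
    cauchy_schwarz X Y).
Proof.
have [e e1] := vn_unit M; have [pe ne] := vn_pos_unit e1.
have ae := approx_vn e1.
have B_case (F : normedModType R[i]) (KF : set F) (Y : orderedBanachBimodule M)
    (J : Y -> M -> F) : mean_inequality KF -> superadditive_norm KF ->
    is_B J -> cone Y = B_cone (@vn_pos R M) KF J -> cauchy_schwarz X Y.
  move=> meanF superF JB coneY; apply: cauchy_schwarz_of_mean; rewrite coneY.
  exact: (mean_inequality_B (@vn_pos0 R M) (@vn_posD R M) ae meanF superF ne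
    JB).
split; [|split; [|split; [|split; [|split; [|split; [|split; [|split;
  [|split; [|split]]]]]]]]].
- move=> A Y w G mu J JL coneY; apply: cauchy_schwarz_of_mean.
  by rewrite coneY; exact: mean_inequality_L2.
- move=> F JF JFt Y J JB coneY _; apply: B_case JB coneY.
    exact: mean_inequality_trace_class.
  exact: superadditive_trace_class.
- move=> A Y J JB coneY; apply: cauchy_schwarz_of_mean; rewrite coneY.
  exact: (mean_inequality_B (@vn_pos0 R M) (@vn_posD R M) ae
    (@mean_inequality_scalar R) (@superadditive_scalar R) ne JB).
- move=> A J0 _ Y J JR coneY _; apply: cauchy_schwarz_of_mean; rewrite coneY.
  exact: mean_inequality_radon.
- move=> F JF JFr Y J JB coneY _; apply: B_case JB coneY.
    exact: mean_inequality_radon.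
  exact: superadditive_radon.
- move=> E F JE JF JEC JFC A Y J JB coneY; apply: cauchy_schwarz_of_mean.
  have [c c1 Kc] := C_unit JEC.
  have nc : rnorm c <= 1.
    by apply: (rnorm_C_le JEC) => // t; rewrite c1 /rnorm normr1.
  rewrite coneY; apply: (mean_inequality_B_C _ _ (approx_C JEC c1) nc JFC JB).
    by move=> t; have := C_scale JEC 0 0 t; rewrite scale0r mul0r => ->.
  move=> f g Kf Kg t; rewrite -[f]scale1r (C_linear JEC) mul1r.
  by rewrite addr_ge0 ?Kf ?Kg.
- move=> F JF JFC A Y J JB coneY; apply: cauchy_schwarz_of_mean; rewrite coneY.
  exact: (mean_inequality_B_C (@vn_pos0 R M) (@vn_posD R M) ae ne JFC JB).
- move=> A Y iota iotaL coneY; apply: cauchy_schwarz_of_mean; rewrite coneY.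
  exact: mean_inequality_nc_L1.
- move=> A Y w G mu J JL coneY; apply: cauchy_schwarz_of_mean.
  by rewrite coneY; exact: mean_inequality_L1.
- move=> F JF JFd Y J JB coneY _.
  have [e' e1'] := vn_unit M'; have [pe' ne'] := vn_pos_unit e1'.
  apply: B_case JB coneY.
    exact: (mean_inequality_B (@vn_pos0 R M') (@vn_posD R M') (approx_vn e1')
      (@mean_inequality_scalar R) (@superadditive_scalar R) ne' JFd).
  exact: (superadditive_functional (@vn_pos0 R M') (@vn_posD R M')
    (approx_vn e1') ne' pe' JFd).
- move=> Omega_compact A J0 _ Y J JL coneY _; apply: cauchy_schwarz_of_mean.
  by rewrite coneY; exact: mean_inequality_l2C.
Qed.
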